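(* Let $1\leq r\leq n-5$. The risk of estimators of the form $aS^+$ for a constant $a\leq\frac{n-r-2}{n}$ can be bounded in terms of the risk of $\frac{n-r-2}{n}S^+$ by $$E\left[\|aS^+-\Sigma^+\|_F^2\right]\leq E\left[\Big\|\frac{n-r-2}{n}S^+-\Sigma^+\Big\|_F^2\right]+\left(a-\frac{n-r-2}{n}\right)\left(a-\frac{n-r-6}{n}\right)E\left[\mathrm{tr}(S^{+2})\right].$$ The constant that minimizes this upper bound is $a=\frac{n-r-4}{n}$, and the corresponding estimator $\hat{\Sigma}^+_{\mathrm{EM1}}=\frac{n-r-4}{n}S^+$ dominates $\frac{n-r-2}{n}S^+$, which itself dominates $S^+$.
   Context: Model: $X_1,\dots,X_n$ are i.i.d. from the $p$-dimensional normal distribution $N_p(\mu,\Sigma)$ with $\mu\in\mathbb{R}^p$ and $\Sigma$ (symmetric positive semidefinite) unknown, where $r=\mathrm{rk}\,\Sigma<\min(n,p)$. The sample mean is $\bar X=\frac1n\sum_{i=1}^n X_i$ and the sample covariance matrix is $S=\frac1n\sum_{i=1}^n (X_i-\bar X)(X_i-\bar X)^t$. $A^+$ denotes the Moore-Penrose pseudoinverse of a matrix $A$, and $S^{+2}=(S^+)^2$. The estimation of $\Sigma^+$ is under the Frobenius loss $\|\hat\Sigma^+-\Sigma^+\|_F^2$, and the risk is the expected loss. ''Dominates'' is in the usual decision-theoretic sense with respect to this risk: the risk of the dominating estimator is no larger for every $(\mu,\Sigma)$ with $\mathrm{rk}\,\Sigma=r$, and strictly smaller for at least one. *)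

(* Defs.v *)
From HB Require Import structures.
From mathcomp Require Import all_boot all_order all_algebra.
From mathcomp Require Import all_classical all_reals all_analysis.
Set Implicit Arguments.
Unset Strict Implicit.
Unset Printing Implicit Defensive.
Import Order.TTheory GRing.Theory Num.Theory.
Import numFieldNormedType.Exports.
Local Open Scope classical_set_scope.
Local Open Scope ring_scope.

Section Matrices.
Context {R : realType}.

Definition frobenius_sq {m n : nat} (A : 'M[R]_(m, n)) : R :=
  \sum_(i < m) \sum_(j < n) A i j ^+ 2.

Definition penrose {m n : nat} (A : 'M[R]_(m, n)) (B : 'M[R]_(n, m)) : Prop :=
  [/\ A *m B *m A = A, B *m A *m B = B,
      (A *m B)^T = A *m B & (B *m A)^T = B *m A].

(* The default value 0 of xget is never used: see penrose_mpinv. *)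
Definition mpinv {m n : nat} (A : 'M[R]_(m, n)) : 'M[R]_(n, m) :=
  xget 0 [set B | penrose A B].

Lemma mulmx_tr_eq0 m n (A : 'M[R]_(m, n)) : A *m A^T = 0 -> A = 0.
Proof.
move=> A0; apply/matrixP => i j; rewrite [RHS]mxE.
have /eqP := congr1 (fun M : 'M[R]_m => M i i) A0.
rewrite !mxE psumr_eq0; last by move=> k _; rewrite mxE -expr2 sqr_ge0.
by move=> /allP /(_ j); rewrite mem_index_enum mxE mulf_eq0 orbb => /(_ isT)/eqP.
Qed.

Lemma row_free_gram_unit m n (A : 'M[R]_(m, n)) :
  row_free A -> A *m A^T \in unitmx.
Proof.
move=> Afree; rewrite -row_free_unit -kermx_eq0; apply/eqP.
apply: (row_free_inj Afree); rewrite mul0mx.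
by apply: mulmx_tr_eq0; rewrite trmx_mul !mulmxA -(mulmxA _ A) mulmx_ker mul0mx.
Qed.

Lemma penrose_exists m n (A : 'M[R]_(m, n)) : exists B, penrose A B.
Proof.
have FU : row_base A *m (row_base A)^T \in unitmx.
  by apply: row_free_gram_unit; exact: row_base_free.
have CU : (col_base A)^T *m col_base A \in unitmx.
  have /row_free_gram_unit : row_free (col_base A)^T.
    by rewrite /row_free mxrank_tr; exact: col_base_full.
  by rewrite trmxK.
have AE := mulmx_base A.
move: FU CU AE; move: (row_base A) (col_base A) => F C FU CU <-.
exists (F^T *m invmx (F *m F^T) *m (invmx (C^T *m C) *m C^T)).
have GF : (invmx (F *m F^T))^T = invmx (F *m F^T).
  by rewrite trmx_inv trmx_mul trmxK.
have GC : (invmx (C^T *m C))^T = invmx (C^T *m C).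
  by rewrite trmx_inv trmx_mul trmxK.
have EF : C *m F *m (F^T *m invmx (F *m F^T) *m (invmx (C^T *m C) *m C^T))
    = C *m invmx (C^T *m C) *m C^T.
  by rewrite !mulmxA -(mulmxA C F) -(mulmxA C) mulmxV // mulmx1.
have EC : F^T *m invmx (F *m F^T) *m (invmx (C^T *m C) *m C^T) *m (C *m F)
    = F^T *m invmx (F *m F^T) *m F.
  rewrite -!mulmxA; congr (_ *m (_ *m _)).
  by rewrite (mulmxA C^T) mulmxA mulVmx // mul1mx.
split.
- by rewrite EF !mulmxA -(mulmxA _ C^T C) -(mulmxA C) mulVmx // mulmx1.
- by rewrite EC !mulmxA -(mulmxA _ F F^T) -(mulmxA F^T) mulVmx // mulmx1.
- by rewrite EF !trmx_mul trmxK GC mulmxA.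
- by rewrite EC !trmx_mul trmxK GF mulmxA.
Qed.

Lemma penrose_unique m n (A : 'M[R]_(m, n)) (B1 B2 : 'M[R]_(n, m)) :
  penrose A B1 -> penrose A B2 -> B1 = B2.
Proof.
move=> [a1 b1 c1 d1] [a2 b2 c2 d2].
have AB : A *m B1 = A *m B2.
  by rewrite -c1 -{1}a2 -(mulmxA _ A) trmx_mul c1 c2 mulmxA a1.
have BA : B1 *m A = B2 *m A.
  by rewrite -d1 -{1}a2 -(mulmxA A) mulmxA trmx_mul d1 d2 -(mulmxA B2) (mulmxA A) a1.
by rewrite -b1 -mulmxA AB mulmxA BA.
Qed.

Lemma penrose_mpinv m n (A : 'M[R]_(m, n)) : penrose A (mpinv A).
Proof. by rewrite /mpinv; case: xgetP => // /(_ _ _) h; have [B /h] := penrose_exists A. Qed.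

Definition psdmx {p : nat} (A : 'M[R]_p) : Prop :=
  A^T = A /\ forall u : 'cV[R]_p, 0 <= (u^T *m A *m u) 0 0.

End Matrices.

Section Gaussian.
Context {R : realType}.

(* The univariate law N(m, v) with variance v >= 0. The degenerate case is
   needed for singular covariances and has to be treated apart: the library's
   [normal_prob m 0] is not the Dirac mass at m. *)
Definition normal_law (m v : R) (B : set R) : \bar R :=
  if v == 0 then \d_m B else normal_prob m (Num.sqrt v) B.

Definition borel_vec (p : nat) := g_sigma_algebraType (@open 'cV[R]_p).

Context {d : measure_display} {T : measurableType d}.

(* X ~ N_p(mu, Sigma), Sigma possibly singular: every linear functional u^t X
   is univariate normal with mean u^t mu and variance u^t Sigma u. *)
Definition multinormal {p : nat} (P : probability T R) (X : T -> 'cV[R]_p)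
    (mu : 'cV[R]_p) (Sigma : 'M[R]_p) : Prop :=
  measurable_fun [set: T] (X : T -> borel_vec p) /\
  forall (u : 'cV[R]_p) (B : set R), measurable B ->
    P ((fun w => (u^T *m X w) 0 0) @^-1` B) =
    normal_law ((u^T *m mu) 0 0) ((u^T *m Sigma *m u) 0 0) B.

Definition mutually_independent {n p : nat} (P : probability T R)
    (X : 'I_n -> T -> 'cV[R]_p) : Prop :=
  forall (J : {set 'I_n}) (B : 'I_n -> set (borel_vec p)),
    (forall i, measurable (B i)) ->
    P (\bigcap_(i in [set i | i \in J]) (X i @^-1` B i)) =
    (\prod_(i in J) P (X i @^-1` B i))%E.

Definition iid_normal {n p : nat} (P : probability T R)
    (X : 'I_n -> T -> 'cV[R]_p) (mu : 'cV[R]_p) (Sigma : 'M[R]_p) : Prop :=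
  (forall i, multinormal P (X i) mu Sigma) /\ mutually_independent P X.

End Gaussian.

Section Estimation.
Context {R : realType} {n p : nat}.

Definition sample_mean (x : 'I_n -> 'cV[R]_p) : 'cV[R]_p :=
  n%:R^-1 *: \sum_(i < n) x i.

Definition sample_cov (x : 'I_n -> 'cV[R]_p) : 'M[R]_p :=
  n%:R^-1 *: \sum_(i < n) (x i - sample_mean x) *m (x i - sample_mean x)^T.

Definition pinv_estimator (x : 'I_n -> 'cV[R]_p) : 'M[R]_p :=
  mpinv (sample_cov x).

Definition scaled_pinv_estimator (a : R) (x : 'I_n -> 'cV[R]_p) : 'M[R]_p :=
  a *: pinv_estimator x.

Context {d : measure_display} {T : measurableType d}.

Definition risk (P : probability T R) (X : 'I_n -> T -> 'cV[R]_p)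
    (delta : ('I_n -> 'cV[R]_p) -> 'M[R]_p) (Sigma : 'M[R]_p) : \bar R :=
  'E_P[fun w => frobenius_sq (delta (fun i => X i w) - mpinv Sigma)]%E.

Definition expected_tr_pinv2 (P : probability T R)
    (X : 'I_n -> T -> 'cV[R]_p) : \bar R :=
  'E_P[fun w => let Sp := pinv_estimator (fun i => X i w) in
                \tr (Sp *m Sp)]%E.

Definition cov_rank (r : nat) (Sigma : 'M[R]_p) : Prop :=
  psdmx Sigma /\ \rank Sigma = r.

(* A statistical model with parameter (mu, Sigma), rk Sigma = r: a family of
   probabilities on one sample space, under which the observations X_i are iid
   N_p(mu, Sigma). The values of P outside this parameter set are irrelevant. *)
Definition normal_model (r : nat)
    (P : 'cV[R]_p -> 'M[R]_p -> probability T R)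
    (X : 'I_n -> T -> 'cV[R]_p) : Prop :=
  forall mu Sigma, cov_rank r Sigma -> iid_normal (P mu Sigma) X mu Sigma.

Definition risk_dominates (r : nat)
    (P : 'cV[R]_p -> 'M[R]_p -> probability T R)
    (X : 'I_n -> T -> 'cV[R]_p)
    (delta1 delta2 : ('I_n -> 'cV[R]_p) -> 'M[R]_p) : Prop :=
  (forall mu Sigma, cov_rank r Sigma ->
     (risk (P mu Sigma) X delta1 Sigma <= risk (P mu Sigma) X delta2 Sigma)%E) /\
  (exists mu Sigma, cov_rank r Sigma /\
     (risk (P mu Sigma) X delta1 Sigma < risk (P mu Sigma) X delta2 Sigma)%E).

End Estimation.

(* Main.v *)
(** A full-rank factorisation Sigma = B S' B^t with a left inverse L of B reduces
    the problem to the nonsingular data Y = L X: almost surely S = B W B^t / n,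
    where W is the scatter matrix of Y, and S^+ = n L^t W^-1 L. With A = L L^t and
    c4 = (n - r - 4) / n, everything follows from the single inequality
      E tr(S^+ Sigma^+) <= c4 E tr(S^+2),
    because the risk of a S^+ is a^2 E tr(S^+2) - 2 a E tr(S^+ Sigma^+) + const.
    In terms of W it says that E tr(A W^-1 A S'^-1) is at most
    (n - r - 4) E tr(A W^-1 A W^-1). It comes from Stein's identity for the vector
    field A G A G Y C, with G = (W + e)^-1 and C the centering matrix, by letting
    e tend to 0 and using tr(A G A G) <= tr(A G)^2. The same identity with A = E_kk
    bounds E G_kk^2 uniformly in e, so that W is almost surely invertible and
    (tr W^-1)^2 is integrable, which justifies the limit.

    For the vector case of Stein's identity, the standardised functional xi of X_j
    along Sigma^-1 e_k, which is independent of X_j - (xi / s) e_k, is replaced by a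
    fresh standard normal variable. This does not change the law, and the univariate
    identity applies in the new variable. *)

Require Import Defs.
From HB Require Import structures.
From mathcomp Require Import all_boot all_order all_algebra.
From mathcomp Require Import all_classical all_reals all_analysis.
From mathcomp Require Import measurable_realfun ring lra.
Set Implicit Arguments.
Unset Strict Implicit.
Unset Printing Implicit Defensive.
Import Order.TTheory GRing.Theory Num.Theory.
Import numFieldNormedType.Exports.
Local Open Scope classical_set_scope.
Local Open Scope ring_scope.

(** * Positive semidefinite matrices and resolvents *)

Section Psd.
Context {R : realType}.

(** The model gives only the laws of the linear functionals of each X_i and the independence of the
    X_i. There is no joint density to integrate by parts against, so laws of data matrices are
    compared through characteristic functions and then orthants, and only the univariate normal
    density is ever used. The univariate identity is proved for bounded functions with bounded
    derivative; this is why the field is built from the resolvent, since W^-1 is unbounded.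

    The constant n - r - 4 arises as (n - 1) - r - 2 - 1: n - 1 is the trace of C, r and 2 come out
    of the divergence, and the last 1 is the price of replacing tr(AG)^2 by tr(AGAG). The assumption
    n - r >= 5 makes it at least 1, so that E G_kk^2 can be absorbed.

    With t = E tr(S^+2) and m = E tr(S^+ Sigma^+), the risks at a and b differ by (a - b)((a + b) t
    - 2 m). An upper bound on m bounds this from above when a <= b, which explains the restriction a
    <= c; it also makes the risk increase in a beyond c4, which gives both dominance statements. *)

Lemma mx11_trK (M : 'M[R]_1) : M^T = M.
Proof. by apply/matrixP => i j; rewrite mxE !ord1. Qed.

Lemma form_sym (p : nat) (A : 'M[R]_p) (x y : 'cV[R]_p) : A^T = A ->
  (x^T *m A *m y) 0 0 = (y^T *m A *m x) 0 0.
Proof.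
by move=> As; rewrite -[in LHS](mx11_trK (_ *m _)) !trmx_mul trmxK As mulmxA.
Qed.

Lemma form_delta (p : nat) (A : 'M[R]_p) i j :
  ((delta_mx i 0 : 'cV[R]_p)^T *m A *m (delta_mx j 0 : 'cV[R]_p)) 0 0 = A i j.
Proof. by rewrite trmx_delta -rowE -colE !mxE. Qed.

Lemma form_sq (p : nat) (x : 'cV[R]_p) : (x^T *m x) 0 0 = \sum_i x i 0 ^+ 2.
Proof. by rewrite mxE; apply: eq_bigr => i _; rewrite mxE expr2. Qed.

Lemma form_addZ (p : nat) (A : 'M[R]_p) (x y : 'cV[R]_p) (t : R) : A^T = A ->
  ((x + t *: y)^T *m A *m (x + t *: y)) 0 0 =
  (x^T *m A *m x) 0 0 + 2 * t * (x^T *m A *m y) 0 0 + t ^+ 2 * (y^T *m A *m y) 0 0.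
Proof.
move=> As; rewrite [(_ + _)^T]linearD /= [(_ *: _)^T]linearZ /= !mulmxDl !mulmxDr.
rewrite -!scalemxAl -!scalemxAr.
have D (M N : 'M[R]_1) : (M + N) 0 0 = M 0 0 + N 0 0 by rewrite mxE.
have Z (a : R) (M : 'M[R]_1) : (a *: M) 0 0 = a * M 0 0 by rewrite mxE.
rewrite !D !Z (form_sym y x As); ring.
Qed.

(** Along x + t A x the form equals 2 t |Ax|^2 + t^2 b, and it cannot stay nonnegative for small
    negative t unless |Ax|^2 = 0. *)
Lemma psd_form_eq0 (p : nat) (A : 'M[R]_p) (x : 'cV[R]_p) :
  psdmx A -> (x^T *m A *m x) 0 0 = 0 -> A *m x = 0.
Proof.
move=> [As Ap] x0; set y := A *m x.
set b := (y^T *m A *m y) 0 0; have b0 : 0 <= b by exact: Ap.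
set a := \sum_i y i 0 ^+ 2.
have quad t : 0 <= 2 * t * a + t ^+ 2 * b.
  have := Ap (x + t *: y); rewrite form_addZ// x0 -/b.
  have -> : (x^T *m A *m y) 0 0 = a by rewrite form_sym// -mulmxA -/y form_sq.
  by rewrite add0r.
have a0 : 0 <= a by apply: sumr_ge0 => i _; exact: sqr_ge0.
suff : a = 0.
  move=> /eqP; rewrite psumr_eq0 => [/allP h|i _]; last exact: sqr_ge0.
  apply/colP => i; rewrite [RHS]mxE -/y.
  by have := h i; rewrite mem_index_enum sqrf_eq0 => /(_ isT)/eqP.
apply/eqP; rewrite eq_le a0 andbT.
(* Dividing by b + 1 rather than b avoids the case b = 0; the value is still a negative multiple of
   a^2. *)
have := quad (- (b + 1)^-1 * a).
have b1 : 0 < b + 1 by rewrite ltr_wpDl.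
have -> : 2 * (- (b + 1)^-1 * a) * a + (- (b + 1)^-1 * a) ^+ 2 * b =
   - (a ^+ 2 * (b + 2) / (b + 1) ^+ 2).
  by field; rewrite gt_eqF.
rewrite oppr_ge0 pmulr_lle0 ?invr_gt0 ?exprn_gt0// pmulr_lle0 ?ltr_wpDl//.
by move=> h; rewrite leNgt; apply/negP => a1; have := exprn_gt0 2 a1; rewrite ltNge h.
Qed.

Lemma psd_unit_gt0 (p : nat) (A : 'M[R]_p) (x : 'cV[R]_p) :
  psdmx A -> A \in unitmx -> x != 0 -> 0 < (x^T *m A *m x) 0 0.
Proof.
move=> Ap Au x0; rewrite lt_neqAle eq_sym; have [_ ->] := Ap; rewrite andbT.
apply: contra_neq x0 => /(psd_form_eq0 Ap) Ax.
by rewrite -(mulKmx Au x) Ax mulmx0.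
Qed.

Lemma gt0_unitmx (p : nat) (A : 'M[R]_p) :
  (forall x : 'cV[R]_p, x != 0 -> 0 < (x^T *m A *m x) 0 0) -> A \in unitmx.
Proof.
move=> A0; rewrite -unitmx_tr -row_free_unit -kermx_eq0.
apply/eqP/row_matrixP => i; rewrite row0; set u := row i _.
have uA : u *m A^T = 0.
  by rewrite /u -row_mul mulmx_ker row0.
apply/eqP; apply: contraT => u0.
have := A0 u^T; rewrite trmx_eq0 u0 => /(_ isT).
by rewrite -mulmxA -[A *m _]trmxK trmx_mul trmxK uA trmx0 mulmx0 mxE ltxx.
Qed.

Lemma psd_inv (p : nat) (A : 'M[R]_p) :
  psdmx A -> A \in unitmx -> psdmx (invmx A).
Proof.
move=> [As Ap] Au; split; first by rewrite trmx_inv As.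
move=> u; have := Ap (invmx A *m u).
by rewrite trmx_mul trmx_inv As -!mulmxA mulKVmx.
Qed.

Lemma psd_congr (p q : nat) (K : 'M[R]_(q, p)) (A : 'M[R]_p) :
  psdmx A -> psdmx (K *m A *m K^T).
Proof.
move=> [As Ap]; split; first by rewrite !trmx_mul trmxK As mulmxA.
by move=> u; have := Ap (K^T *m u); rewrite trmx_mul trmxK !mulmxA.
Qed.

Lemma psdD (p : nat) (A B : 'M[R]_p) : psdmx A -> psdmx B -> psdmx (A + B).
Proof.
move=> [As Ap] [Bs Bp]; split; first by rewrite linearD /= As Bs.
by move=> u; rewrite mulmxDr mulmxDl mxE addr_ge0.
Qed.

Lemma psd1 (p : nat) : psdmx (1%:M : 'M[R]_p).
Proof.
split; first by rewrite trmx1.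
by move=> u; rewrite mulmx1 form_sq sumr_ge0// => i _; exact: sqr_ge0.
Qed.

Lemma psdZ (p : nat) (a : R) (A : 'M[R]_p) : 0 <= a -> psdmx A -> psdmx (a *: A).
Proof.
move=> a0 [As Ap]; split; first by rewrite linearZ /= As.
by move=> u; rewrite -scalemxAr -scalemxAl mxE mulr_ge0.
Qed.

Lemma psd_diag_ge0 (p : nat) (A : 'M[R]_p) i : psdmx A -> 0 <= A i i.
Proof. by move=> [_ Ap]; rewrite -form_delta. Qed.

Lemma psd_trace_ge0 (p : nat) (A : 'M[R]_p) : psdmx A -> 0 <= \tr A.
Proof. by move=> Ap; apply: sumr_ge0 => i _; exact: psd_diag_ge0. Qed.

(** Nonnegativity of a principal 2 x 2 minor, obtained by minimising the form along e_i + t e_j. If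
    A_jj = 0 there is no minimiser, but then the whole column j vanishes. *)
Lemma psd_entry_sq (p : nat) (A : 'M[R]_p) i j :
  psdmx A -> A i j ^+ 2 <= A i i * A j j.
Proof.
move=> Apsd; have [As Ap] := Apsd.
have quad t : 0 <= A i i + 2 * t * A i j + t ^+ 2 * A j j.
  by have := Ap (delta_mx i 0 + t *: delta_mx j 0); rewrite form_addZ// !form_delta.
have i0 := psd_diag_ge0 i Apsd; have j0 := psd_diag_ge0 j Apsd.
have [Aj0|Aj0] := eqVneq (A j j) 0.
  have := psd_form_eq0 Apsd (x := delta_mx j 0); rewrite form_delta => /(_ Aj0).
  by rewrite -colE => /matrixP/(_ i 0); rewrite !mxE => ->; rewrite expr0n Aj0 mulr0.
have Aj : 0 < A j j by rewrite lt_neqAle eq_sym Aj0.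
have := quad (- A i j / A j j).
have -> : A i i + 2 * (- A i j / A j j) * A i j + (- A i j / A j j) ^+ 2 * A j j =
   (A i i * A j j - A i j ^+ 2) / A j j by field.
by rewrite pmulr_lge0 ?invr_gt0// subr_ge0.
Qed.

Lemma psd_entry_le (p : nat) (A : 'M[R]_p) i j : psdmx A -> `|A i j| <= \tr A.
Proof.
move=> Ap; have dle k : A k k <= \tr A.
  by rewrite /mxtrace (bigD1 k)//= lerDl sumr_ge0// => l _; exact: psd_diag_ge0.
rewrite -(@ler_pXn2r _ 2) ?nnegrE ?psd_trace_ge0// real_normK ?num_real//.
apply: le_trans (psd_entry_sq i j Ap) _; rewrite expr2.
by rewrite ler_pM ?psd_diag_ge0.
Qed.

End Psd.

Section Resolvent.
Context {R : realType} (r : nat).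
Variables (W : 'M[R]_r) (e : R).
Hypotheses (Wp : psdmx W) (e0 : 0 < e).

Definition resolvent (W : 'M[R]_r) (e : R) : 'M[R]_r := invmx (W + e%:M).

Let G := resolvent W e.

Lemma psd_shift : psdmx (W + e%:M).
Proof.
rewrite -[e%:M]mulmx1 mul_scalar_mx; apply: psdD => //.
by apply: psdZ; [exact: ltW|exact: psd1].
Qed.

Lemma shift_unitmx : W + e%:M \in unitmx.
Proof.
apply: gt0_unitmx => x x0.
rewrite mulmxDr mulmxDl mxE ltr_wpDl//; first by case: Wp.
rewrite mul_mx_scalar -scalemxAl mxE mulr_gt0// form_sq.
rewrite lt_neqAle sumr_ge0 ?andbT => [|i _]; last exact: sqr_ge0.
rewrite eq_sym; apply: contra_neq x0 => /eqP.
rewrite psumr_eq0 => [/allP h|i _]; last exact: sqr_ge0.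
apply/colP => i; rewrite mxE.
by have := h i; rewrite mem_index_enum sqrf_eq0 => /(_ isT)/eqP.
Qed.

Lemma resolvent_psd : psdmx G.
Proof. by apply: psd_inv; [exact: psd_shift|exact: shift_unitmx]. Qed.

Lemma resolvent_tr : G^T = G.
Proof. by have [] := resolvent_psd. Qed.

Lemma resolvent_sym i j : G i j = G j i.
Proof. by rewrite -[in LHS]resolvent_tr mxE. Qed.

Lemma mul_resolvent : W *m G = 1%:M - e *: G.
Proof.
have := mulmxV shift_unitmx; rewrite mulmxDl mul_scalar_mx => <-.
by rewrite addrK.
Qed.

Lemma resolvent_mul : G *m W = 1%:M - e *: G.
Proof.
have := mulVmx shift_unitmx; rewrite mulmxDr mul_mx_scalar => <-.
by rewrite addrK.
Qed.

(** With y = G x the right-hand side is y^T (W + e) y, and the term in W is nonnegative. *)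
Lemma resolvent_form_ge0 (x : 'cV[R]_r) :
  e * \sum_i (G *m x) i 0 ^+ 2 <= (x^T *m G *m x) 0 0.
Proof.
rewrite -form_sq; set y := G *m x.
have -> : x^T *m G *m x = y^T *m (W + e%:M) *m y.
  by rewrite -mulmxA -/y /y trmx_mul resolvent_tr -(mulmxA x^T) mulVmx ?shift_unitmx ?mulmx1.
rewrite mulmxDr mulmxDl [leRHS]mxE mul_mx_scalar -scalemxAl [X in _ + X]mxE lerDr.
by have [_ Wx] := Wp.
Qed.

Lemma resolvent_sq_diag k : e * (G *m G) k k <= G k k.
Proof.
have := resolvent_form_ge0 (delta_mx k 0); rewrite form_delta.
congr (_ * _ <= _); rewrite mxE; apply: eq_bigr => i _.
by rewrite -colE [X in X ^+ 2]mxE [X in _ = X * _]resolvent_sym expr2.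
Qed.

(** Since G_kk^2 is one of the squares that sum to (G^2)_kk, e G_kk^2 <= e (G^2)_kk <= G_kk; then
    G_kk is cancelled. *)
Lemma resolvent_diag_le k : e * G k k <= 1.
Proof.
have G0 := psd_diag_ge0 k resolvent_psd.
have [->|Gk] := eqVneq (G k k) 0; first by rewrite mulr0.
have Gk0 : 0 < G k k by rewrite lt_neqAle eq_sym Gk.
rewrite -(ler_pM2r Gk0) mul1r; apply: le_trans (resolvent_sq_diag k).
rewrite -mulrA ler_pM2l// mxE (bigD1 k)//= lerDl sumr_ge0// => i _.
by rewrite [X in X * _]resolvent_sym -expr2 sqr_ge0.
Qed.

Lemma resolvent_entry_le i j : e * `|G i j| <= 1.
Proof.
rewrite -[X in X * _](gtr0_norm e0) -normrM.
rewrite -(@ler_pXn2r _ 2) ?nnegrE// real_normK ?num_real// expr1n exprMn.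
apply: le_trans (_ : (e * G i i) * (e * G j j) <= _).
  have := psd_entry_sq i j resolvent_psd; rewrite -/G => h.
  by rewrite [leRHS]mulrACA -[e * e]expr2 ler_pM2l// exprn_gt0.
have ge k : 0 <= e * G k k by rewrite mulr_ge0 ?(ltW e0)//; apply: psd_diag_ge0;
  exact: resolvent_psd.
by rewrite mulr_ile1// resolvent_diag_le.
Qed.

Lemma sandwich_resolvent : G *m W *m G = G - e *: (G *m G).
Proof. by rewrite resolvent_mul mulmxBl mul1mx scalemxAl. Qed.

(** A kernel vector of W is an eigenvector of G for 1 / e. Reading G u = u / e at the largest entry
    of u bounds 1 / e by a sum of r entries of G, each at most its trace. Singularity of W thus
    makes tr G explode as e tends to 0. *)
Lemma psd_singular_trace : W \notin unitmx -> e^-1 <= r%:R * \tr G.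
Proof.
rewrite -unitmx_tr -row_free_unit -kermx_eq0 => K0.
have [u Wu u0] : exists2 u : 'cV[R]_r, W *m u = 0 & u != 0.
  have /rowV0Pn [v vK v0] := K0.
  exists v^T; last by rewrite trmx_eq0.
  by apply: trmx_inj; rewrite trmx_mul trmxK trmx0; exact/sub_kermxP.
have Gu : G *m u = e^-1 *: u.
  have : G *m (W + e%:M) *m u = u by rewrite mulVmx ?shift_unitmx// mul1mx.
  rewrite -mulmxA mulmxDl Wu add0r mul_scalar_mx -scalemxAr => h.
  by rewrite -[in RHS]h scalerA mulVf ?gt_eqF// scale1r.
have [i0 _] : exists i0 : 'I_r, u i0 0 != 0.
  apply/existsP; rewrite -negb_forall; apply: contra u0 => /forallP h.
  by apply/eqP/colP => i; rewrite mxE; apply/eqP; exact: h.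
have [k _ kmax] := @arg_maxP _ _ _ i0 xpredT (fun i => `|u i 0|) isT.
have uk0 : 0 < `|u k 0|.
  rewrite lt_neqAle normr_ge0 andbT eq_sym; apply: contra_neq u0 => uk.
  apply/colP => i; rewrite mxE; apply/eqP; rewrite -normr_le0.
  by apply: le_trans (kmax i isT) _; rewrite uk.
rewrite -(ler_pM2r uk0).
have -> : e^-1 * `|u k 0| = `|(G *m u) k 0|.
  by rewrite Gu mxE normrM gtr0_norm// invr_gt0.
rewrite mxE; apply: le_trans (ler_norm_sum _ _ _) _.
apply: (@le_trans _ _ (\sum_(j < r) \tr G * `|u k 0|)); last first.
  by rewrite sumr_const card_ord mulr_natl mulrnAl.
apply: ler_sum => j _; rewrite normrM.
by apply: ler_pM => //; [exact: psd_entry_le resolvent_psd|exact: kmax].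
Qed.

End Resolvent.

(** * Integration *)

Section Integration.
Context {R : realType} {d : measure_display} {T : measurableType d}.

Lemma bounded_integrable (P : probability T R) (f : T -> R) (K : R) :
  measurable_fun [set: T] f -> (forall x, `|f x| <= K) ->
  P.-integrable [set: T] (EFin \o f).
Proof.
move=> mf fK; apply: (@le_integrable _ _ _ P _ measurableT _ (EFin \o cst K)).
- exact/measurable_EFinP.
- by move=> x _ /=; rewrite lee_fin (le_trans (fK x)) ?ler_norm.
- exact: finite_measure_integrable_cst.
Qed.

Lemma Rintegral_prob_cst (P : probability T R) (r : R) : \int[P]_x r = r.
Proof.
rewrite Rintegral_cst//; transitivity (r * fine (1%E : \bar R)); last exact: mulr1.
by congr (_ * fine _); exact: probability_setT.
Qed.

Lemma Rintegral_dominated (mu : {measure set T -> \bar R})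
    (F : nat -> T -> R) (f g : T -> R) :
  (forall n, measurable_fun [set: T] (F n)) -> measurable_fun [set: T] f ->
  mu.-integrable [set: T] (EFin \o g) ->
  (forall n x, `|F n x| <= g x) ->
  {ae mu, forall x, F ^~ x @ \oo --> f x} ->
  mu.-integrable [set: T] (EFin \o f) /\
  (\int[mu]_x F n x) @[n --> \oo] --> \int[mu]_x f x.
Proof.
move=> mF mf ig Fg Ff.
have Ff' : {ae mu, forall x, [set: T] x -> (F n x)%:E @[n --> \oo] --> (f x)%:E}.
  by apply: filterS Ff => x Fx _; apply: cvg_EFin; [exact: nearW|].
have Fg' : {ae mu, forall x n, [set: T] x -> (`|(F n x)%:E| <= (g x)%:E)%E}.
  by apply: aeW => x n _; rewrite lee_fin.
have [intf _ cvgF] := @dominated_convergence _ _ _ mu _ measurableT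
  (fun n x => (F n x)%:E) (EFin \o f) (EFin \o g)
  (fun n => (measurable_EFinP _ _).2 (mF n)) ((measurable_EFinP _ _).2 mf)
  Ff' ig Fg'.
split => //; apply: fine_cvg.
rewrite fineK//; last exact: integrable_fin_num.
Qed.

Lemma measurable_fun_limR (F : nat -> T -> R) (f : T -> R) :
  (forall n, measurable_fun [set: T] (F n)) ->
  (forall x, F ^~ x @ \oo --> f x) -> measurable_fun [set: T] f.
Proof.
move=> mF Ff; apply: (@measurable_fun_cvg _ _ _ _ F f) => [n|x _]; [exact: mF|exact: Ff].
Qed.

End Integration.

(** * Product probabilities and Fubini's theorem *)

Section ProductProbability.
Context {R : realType} {d1 d2 : measure_display}.
Context {T1 : measurableType d1} {T2 : measurableType d2}.
Variables (P : probability T1 R) (Q : probability T2 R).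

Let prod := (P \x Q)%E.

HB.instance Definition _ := Measure.on prod.

Let prod_setT : prod setT = 1%E.
Proof.
rewrite -setXTT [LHS]product_measure1E//.
by rewrite -[RHS]mule1; congr (_ * _)%E; exact: probability_setT.
Qed.

HB.instance Definition _ := Measure_isProbability.Build _ _ _ prod prod_setT.

Definition product_probability : probability (T1 * T2)%type R := prod.

Lemma Rintegral_prod1 (f : T1 * T2 -> R) :
  product_probability.-integrable [set: T1 * T2] (EFin \o f) ->
  (forall x, Q.-integrable [set: T2] (fun y => (f (x, y))%:E)) ->
  \int[product_probability]_z f z = \int[P]_x \int[Q]_y f (x, y).
Proof.
move=> intf intQ; have FE := integral12_prod_meas1 intf.
rewrite /Rintegral; congr fine.
rewrite (_ : integral product_probability _ _ =
  (\int[(P \x Q)%E]_z (EFin \o f) z)%E)// -FE.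
by apply: eq_integral => x _; rewrite fineK//; exact: integrable_fin_num.
Qed.

Lemma Rintegral_prod2 (f : T1 * T2 -> R) :
  product_probability.-integrable [set: T1 * T2] (EFin \o f) ->
  (forall y, P.-integrable [set: T1] (fun x => (f (x, y))%:E)) ->
  \int[product_probability]_z f z = \int[Q]_y \int[P]_x f (x, y).
Proof.
move=> intf intP; have FE := integral21_prod_meas1 intf.
rewrite /Rintegral; congr fine.
rewrite (_ : integral product_probability _ _ =
  (\int[(P \x Q)%E]_z (EFin \o f) z)%E)// -FE.
by apply: eq_integral => x _; rewrite fineK//; exact: integrable_fin_num.
Qed.

Lemma bounded_Rintegral_prod1 (f : T1 * T2 -> R) (K : R) :
  measurable_fun [set: T1 * T2] f -> (forall z, `|f z| <= K) ->
  \int[product_probability]_z f z = \int[P]_x \int[Q]_y f (x, y).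
Proof.
move=> mf fK; apply: Rintegral_prod1; first exact: bounded_integrable fK.
move=> x; apply: (@bounded_integrable _ _ _ Q (fun y => f (x, y)) K) => //.
exact: measurableT_comp.
Qed.

Lemma bounded_Rintegral_prod2 (f : T1 * T2 -> R) (K : R) :
  measurable_fun [set: T1 * T2] f -> (forall z, `|f z| <= K) ->
  \int[product_probability]_z f z = \int[Q]_y \int[P]_x f (x, y).
Proof.
move=> mf fK; apply: Rintegral_prod2; first exact: bounded_integrable fK.
move=> y; apply: (@bounded_integrable _ _ _ P (fun x => f (x, y)) K) => //.
exact: measurableT_comp.
Qed.

Lemma bounded_Fubini (f : T1 -> T2 -> R) (K : R) :
  measurable_fun [set: T1 * T2] (fun z => f z.1 z.2) ->
  (forall x y, `|f x y| <= K) ->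
  \int[P]_x \int[Q]_y f x y = \int[Q]_y \int[P]_x f x y.
Proof.
move=> mf fK; rewrite -(@bounded_Rintegral_prod1 (fun z => f z.1 z.2) K)//.
exact: (@bounded_Rintegral_prod2 _ K).
Qed.

End ProductProbability.

(** * Integration against the normal density *)

Section NormalDensity.
Context {R : realType}.
Local Notation mu := (@lebesgue_measure R).
Variables (m s : R).
Hypothesis s0 : s != 0.

Let normal_domin : normal_prob m s `<< mu := normal_prob_dominates m s.

(** Densities with the same integral over every measurable set agree almost everywhere. This
    identifies the abstract Radon-Nikodym derivative of the normal law with [normal_pdf]. *)
Let ae_RN_pdf (g : R -> \bar R) : mu.-integrable [set: R] g ->
  (forall A, measurable A -> normal_prob m s A = (\int[mu]_(x in A) g x)%E) ->
  ae_eq mu [set: R] g (EFin \o normal_pdf m s).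
Proof.
move=> ig gE; apply: integral_ae_eq => //.
- by apply/measurable_EFinP; exact: measurable_normal_pdf.
- by move=> A _ mA; rewrite -gE.
Qed.

Lemma ge0_integral_normal_prob (f : R -> R) :
  measurable_fun [set: R] f -> (forall x, 0 <= f x) ->
  (\int[normal_prob m s]_x (f x)%:E =
   \int[mu]_x (f x * normal_pdf m s x)%:E)%E.
Proof.
move=> mf f0.
rewrite -(Radon_Nikodym_SigmaFinite.change_of_variables normal_domin)//; first last.
- exact/measurable_EFinP.
apply: ae_eq_integral => //.
- apply: emeasurable_funM; first exact/measurable_EFinP.
  apply: (measurable_int mu).
  exact: Radon_Nikodym_SigmaFinite.f_integrable.
- apply/measurable_EFinP; apply: measurable_funM => //.
  exact: measurable_normal_pdf.
- apply: (@ae_eqe_mul2l _ _ _ mu [set: R] _ (EFin \o normal_pdf m s) (EFin \o f)).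
  apply: ae_RN_pdf; first exact: Radon_Nikodym_SigmaFinite.f_integrable.
  by move=> A mA; rewrite -Radon_Nikodym_SigmaFinite.f_integral.
Qed.

Lemma integrable_normal_prob (f : R -> R) :
  measurable_fun [set: R] f ->
  mu.-integrable [set: R] (fun x => (f x * normal_pdf m s x)%:E) ->
  (normal_prob m s).-integrable [set: R] (EFin \o f).
Proof.
move=> mf /integrableP[_ ifp]; apply/integrableP; split.
  exact/measurable_EFinP.
rewrite /= (ge0_integral_normal_prob (f := fun x => `|f x|))//; last first.
  exact: measurableT_comp.
apply: le_lt_trans ifp; rewrite le_eqVlt; apply/orP; left; apply/eqP.
by apply: eq_integral => x _ /=; rewrite normrM (ger0_norm (normal_pdf_ge0 _ _ _)).
Qed.

Lemma Rintegral_normal_prob (f : R -> R) :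
  measurable_fun [set: R] f ->
  mu.-integrable [set: R] (fun x => (f x * normal_pdf m s x)%:E) ->
  \int[normal_prob m s]_x f x = \int[mu]_x (f x * normal_pdf m s x).
Proof.
move=> mf ifp; have intf := integrable_normal_prob mf ifp.
rewrite /Rintegral; congr fine.
rewrite -(Radon_Nikodym_change_of_variables normal_domin)//=.
apply: ae_eq_integral => //.
- apply: emeasurable_funM; first exact/measurable_EFinP.
  by apply: (measurable_int mu); exact: Radon_Nikodym_integrable.
- apply/measurable_EFinP; apply: measurable_funM => //.
  exact: measurable_normal_pdf.
- apply: (@ae_eqe_mul2l _ _ _ mu [set: R] _ (EFin \o normal_pdf m s) (EFin \o f)).
  apply: ae_RN_pdf; first exact: Radon_Nikodym_integrable.
  by move=> A mA; rewrite -Radon_Nikodym_integral.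
Qed.

End NormalDensity.

(** * Stein's lemma and characteristic function of the normal law *)

Lemma derivable_continuous (R : realType) (f f' : R -> R) :
  (forall x : R, is_derive x (1 : R) f (f' x)) -> continuous f.
Proof.
move=> df x; apply: differentiable_continuous; apply/derivable1_diffP.
by have [] := df x.
Qed.

Lemma Rintegral_FTC_line (R : realType) (F h : R -> R) :
  (forall x : R, is_derive x (1 : R) F (h x)) -> continuous h ->
  (@lebesgue_measure R).-integrable [set: R] (EFin \o h) ->
  F n%:R @[n --> \oo] --> 0 -> F (- n%:R) @[n --> \oo] --> 0 ->
  \int[@lebesgue_measure R]_x h x = 0.
Proof.
move=> dF ch ih F0 FN0; set mu := @lebesgue_measure R.
have mh : measurable_fun [set: R] h by exact: continuous_measurable_fun.
(* The successor keeps the interval nondegenerate for the fundamental theorem of calculus; the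
   limits of F are shifted accordingly at the end. *)
pose J n := `[- n.+1%:R, (n.+1%:R : R)]%classic.
have mJ n : measurable (J n) by exact: measurable_itv.
have HE n : \int[mu]_x (h \_ (J n)) x = F n.+1%:R - F (- n.+1%:R).
  rewrite -Rintegral_mkcond /Rintegral (@continuous_FTC2 _ h F)//.
  - by rewrite -subr_gt0 opprK addr_gt0.
  - exact: continuous_subspaceT.
  - have cF := derivable_continuous dF.
    split; first by move=> x _; have [] := dF x.
    + exact/cvg_at_right_filter/cF.
    + exact/cvg_at_left_filter/cF.
  - by move=> x _; rewrite derive1E; have [_ ->] := dF x.
have nh : mu.-integrable [set: R] (EFin \o (fun x => `|h x|)).
  by have := integrable_abse ih.
have [|||_] := @Rintegral_dominated R _ _ mu (fun n => h \_ (J n)) h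
  (fun x => `|h x|) _ mh nh.
- move=> n; apply/(measurable_restrictT _ (mJ n)).
  exact: measurable_funTS.
- by move=> n x; rewrite patchE; case: ifP => // _; rewrite normr0.
- apply: aeW => x; apply: cvg_near_cst.
  near=> n; rewrite patchE mem_set// /J /= in_itv/= -ler_norml.
  near: n; exists (Num.trunc `|x|) => // n /= xn.
  by rewrite ltW// (lt_le_trans (truncnS_gt _))// ler_nat ltnS.
move=> /cvg_lim <-//; apply/cvg_lim => //.
under eq_fun do rewrite HE.
rewrite -[0]subr0; apply: cvgB.
  by rewrite -(cvg_shiftS (fun n => F n%:R)) in F0.
by rewrite -(cvg_shiftS (fun n => F (- n%:R))) in FN0.
Unshelve. all: end_near. Qed.

Section NormalStein.
Context {R : realType}.
Local Notation mu := (@lebesgue_measure R).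
Variables (m s : R).
Hypothesis s0 : s != 0.
Local Notation pdf := (normal_pdf m s).

Lemma is_derive_normal_pdf (x : R) :
  is_derive x (1 : R) pdf (- ((x - m) / s ^+ 2) * pdf x).
Proof.
rewrite normal_pdfE// /normal_fun.
have dE : is_derive x (1 : R) (fun x => - (x - m) ^+ 2 / (s ^+ 2 *+ 2))
    (- ((x - m) / s ^+ 2)).
  apply: is_derive_eq; rewrite /GRing.scale /=; field.
  exact: s0.
have dexp : is_derive x (1 : R) (fun x => expR (- (x - m) ^+ 2 / (s ^+ 2 *+ 2)))
    (expR (- (x - m) ^+ 2 / (s ^+ 2 *+ 2)) * (- ((x - m) / s ^+ 2))).
  exact: (@is_derive1_comp _ expR).
apply: is_derive_eq; rewrite /GRing.scale /=; ring.
Qed.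

(** With y = (x - m)^2 / (4 s^2), half of the Gaussian exponent absorbs the linear factor: |x - m|
    <= 1 + 4 s^2 y <= (1 + 4 s^2) e^y. What remains is the normal density of variance 2 s^2. The
    bound yields both an integrable majorant and the decay of the density at infinity. *)
Lemma norm_normal_pdf_bound (x : R) :
  `|x - m| * pdf x <= (1 + 4 * s ^+ 2) * normal_peak s / normal_peak (s * Num.sqrt 2)
    * normal_pdf m (s * Num.sqrt 2) x.
Proof.
have s20 : s * Num.sqrt 2 != 0 by rewrite mulf_neq0// gt_eqF// sqrtr_gt0.
rewrite !normal_pdfE//.
set p2 := normal_peak (s * _); have p20 : 0 < p2 by exact: normal_peak_gt0.
rewrite -!mulrA mulKf ?gt_eqF//.
rewrite mulrCA [leRHS]mulrCA ler_pM2l ?normal_peak_gt0//.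
rewrite /normal_fun; set y := (x - m) ^+ 2 / (4 * s ^+ 2).
have s2 : 0 < s ^+ 2 by rewrite exprn_even_gt0.
have -> : - (x - m) ^+ 2 / (s ^+ 2 *+ 2) = - y - y.
  by rewrite /y; field; rewrite s0.
have -> : - (x - m) ^+ 2 / ((s * Num.sqrt 2) ^+ 2 *+ 2) = - y.
  by rewrite exprMn sqr_sqrtr// /y; field; rewrite s0.
rewrite expRD mulrA ler_pM2r ?expR_gt0// -ler_pdivlMr ?expR_gt0//.
rewrite expRN invrK.
have xE : (x - m) ^+ 2 = 4 * s ^+ 2 * y.
  by rewrite /y mulrC divfK// gt_eqF// mulr_gt0.
have : `|x - m| <= 1 + (x - m) ^+ 2.
  by rewrite -(real_normK (num_real (x - m))); have := normr_ge0 (x - m); nra.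
move=> /le_trans; apply; rewrite xE.
have y0 : 0 <= y by rewrite /y divr_ge0 ?sqr_ge0// mulr_ge0// ltW.
have := expR_ge1Dx y; nra.
Qed.

Lemma integrable_center_mul_pdf (f : R -> R) (K : R) :
  measurable_fun [set: R] f -> (forall x, `|f x| <= K) ->
  mu.-integrable [set: R] (fun x => ((x - m) * f x * pdf x)%:E).
Proof.
move=> mf fK; have K0 : 0 <= K by apply: le_trans (fK 0).
set c := (1 + 4 * s ^+ 2) * normal_peak s / normal_peak (s * Num.sqrt 2).
have mxm : measurable_fun [set: R] (fun x : R => x - m) by exact: measurable_funB.
apply: (@le_integrable _ _ _ mu _ measurableT _
  (EFin \o (fun x => K * c * normal_pdf m (s * Num.sqrt 2) x))).
- apply/measurable_EFinP; apply: measurable_funM; last exact: measurable_normal_pdf.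
  exact: measurable_funM.
- move=> x _ /=; rewrite lee_fin (le_trans _ (ler_norm _))//.
  rewrite !normrM (ger0_norm (normal_pdf_ge0 _ _ x)) mulrAC mulrC -mulrA.
  by apply: ler_pM => //; [rewrite mulr_ge0 ?normal_pdf_ge0|exact: norm_normal_pdf_bound].
- rewrite /comp; under eq_fun do rewrite EFinM.
  apply: integrableZl => //; exact: integrable_normal_pdf.
Qed.

Lemma integrable_center_mul (f : R -> R) (K : R) :
  measurable_fun [set: R] f -> (forall x, `|f x| <= K) ->
  (normal_prob m s).-integrable [set: R] (fun x => ((x - m) * f x)%:E).
Proof.
move=> mf fK; apply: (@integrable_normal_prob _ m s (fun x => (x - m) * f x)).
  by apply: measurable_funM => //; exact: measurable_funB.
exact: integrable_center_mul_pdf fK.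
Qed.

Lemma normal_pdf_cvg0 (u : nat -> R) : `|u n - m| @[n --> \oo] --> +oo ->
  pdf (u n) @[n --> \oo] --> 0.
Proof.
move=> uoo; set c := (1 + 4 * s ^+ 2) * normal_peak s / normal_peak (s * Num.sqrt 2).
have s20 : s * Num.sqrt 2 != 0 by rewrite mulf_neq0// gt_eqF// sqrtr_gt0.
apply: (@squeeze_cvgr _ _ _ _ (cst 0) (fun n => c * normal_peak (s * Num.sqrt 2) * `|u n - m|^-1)).
- have : \forall n \near \oo, 0 < `|u n - m| by move/cvgryPgt : uoo; exact.
  apply: filterS => n un0; rewrite normal_pdf_ge0/=.
  rewrite ler_pdivlMr// mulrC (le_trans (norm_normal_pdf_bound _))//.
  rewrite ler_pM2l ?normal_pdf_ub// /c divr_gt0 ?normal_peak_gt0//.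
  by rewrite mulr_gt0 ?normal_peak_gt0// ltr_pwDl// mulr_ge0// sqr_ge0.
- exact: cvg_cst.
- rewrite -(mulr0 (c * normal_peak (s * Num.sqrt 2))).
  apply: cvgMr; apply/gtr0_cvgV0 => //.
  by move/cvgryPgt : uoo; exact.
Qed.

(** The derivative of f times the density is f' pdf - (x - m) / s^2 f pdf. It is integrable, and its
    primitive vanishes at both ends because f is bounded, so its integral is 0. *)
Lemma normal_stein (f f' : R -> R) (K : R) :
  (forall x : R, is_derive x (1 : R) f (f' x)) -> continuous f' ->
  (forall x, `|f x| <= K) -> (forall x, `|f' x| <= K) ->
  \int[normal_prob m s]_x ((x - m) * f x) = s ^+ 2 * \int[normal_prob m s]_x f' x.
Proof.
move=> df cf' fK f'K; have cf := derivable_continuous df.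
have mf : measurable_fun [set: R] f by exact: continuous_measurable_fun.
have mf' : measurable_fun [set: R] f' by exact: continuous_measurable_fun.
have mxm : measurable_fun [set: R] (fun x : R => x - m) by exact: measurable_funB.
have if' : mu.-integrable [set: R] (fun x => (f' x * pdf x)%:E).
  apply: (@le_integrable _ _ _ mu _ measurableT _ (fun x => (K * pdf x)%:E)).
  - apply/measurable_EFinP; apply: measurable_funM => //.
    exact: measurable_normal_pdf.
  - move=> x _ /=; rewrite lee_fin !normrM ler_wpM2r//.
    exact: le_trans (f'K x) (ler_norm _).
  - under eq_fun do rewrite EFinM.
    apply: integrableZl => //; exact: integrable_normal_pdf.
have ifx := integrable_center_mul_pdf mf fK.
rewrite !Rintegral_normal_prob//; last exact: measurable_funM.
rewrite -RintegralZl//; apply/eqP; rewrite -subr_eq0; apply/eqP.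
rewrite -RintegralB//; last first.
  by rewrite /comp; under eq_fun do rewrite EFinM; exact: integrableZl.
have s2 : s ^+ 2 != 0 by rewrite expf_neq0.
pose h x := f' x * pdf x - (s ^+ 2)^-1 * ((x - m) * f x * pdf x).
transitivity (\int[mu]_x (- s ^+ 2 * h x)).
  apply: eq_Rintegral => x _; rewrite /h; field; exact: s0.
have ih : mu.-integrable [set: R] (EFin \o h).
  rewrite /h /comp; under eq_fun do rewrite EFinB.
  apply: integrableB => //.
  by under eq_fun do rewrite EFinM; exact: integrableZl.
have cvg0 (u : nat -> R) : `|u n - m| @[n --> \oo] --> +oo ->
    f (u n) * pdf (u n) @[n --> \oo] --> 0.
  move=> /normal_pdf_cvg0 p0; apply: norm_cvg0.
  apply: (@squeeze_cvgr _ _ _ _ (cst 0) (fun n => K * pdf (u n))).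
  - near=> n; rewrite normr_ge0 normrM (ger0_norm (normal_pdf_ge0 _ _ _)) /=.
    by rewrite ler_wpM2r ?normal_pdf_ge0.
  - exact: cvg_cst.
  - by rewrite -(mulr0 K); exact: cvgMr.
rewrite RintegralZl//; apply/eqP; rewrite mulf_eq0; apply/orP; right; apply/eqP.
apply: (@Rintegral_FTC_line _ (fun x => f x * pdf x) h) => //.
- move=> x; have dp := is_derive_normal_pdf x; have dfx := df x.
  by apply: is_derive_eq; rewrite /h /GRing.scale /=; field; exact: s0.
- have cpdf := @continuous_normal_pdf _ m s s0.
  move=> x; apply: cvgB; first by apply: cvgM; [exact: cf'|exact: cpdf].
  apply: cvgM; first exact: cvg_cst.
  apply: cvgM; last exact: cpdf.
  by apply: cvgM; [apply: cvgB; [exact: cvg_id|exact: cvg_cst]|exact: cf].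
- apply: cvg0; apply/cvgryPge => A; exists (Num.trunc (`|A| + `|m|)).+1 => // k /= kn.
  have := truncnS_gt (`|A| + `|m|); move: kn; rewrite -(ler_nat R).
  have := ler_norm A; have := ler_norm m; have := ler_norm (k%:R - m); lra.
- apply: cvg0; apply/cvgryPge => A; exists (Num.trunc (`|A| + `|m|)).+1 => // k /= kn.
  have := truncnS_gt (`|A| + `|m|); move: kn; rewrite -(ler_nat R).
  have := ler_norm A; have := ler_norm (- m); have := ler_norm (- (- k%:R - m)).
  by rewrite !normrN; lra.
Unshelve. all: end_near. Qed.

End NormalStein.

Section NormalCharacteristic.
Context {R : realType}.
Variables (m s : R).
Hypothesis s0 : s != 0.
Local Notation N := (normal_prob m s).

(** Differentiating under the integral and applying Stein's identity to the sine gives Phi' = - u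
    s^2 Phi. The phase theta makes a single real formula carry both the real and the imaginary part
    of the characteristic function. *)
Lemma Rintegral_normal_cos (theta u : R) :
  \int[N]_x cos (u * (x - m) + theta) = expR (- (u ^+ 2 * s ^+ 2) / 2) * cos theta.
Proof.
pose f u x := cos (u * (x - m) + theta).
pose Phi u := \int[N]_x f u x.
have maff v : measurable_fun [set: R] (fun x : R => v * (x - m) + theta).
  by apply: measurable_funD => //; apply: measurable_funM => //; exact: measurable_funB.
have mf v : measurable_fun [set: R] (f v).
  by apply: measurableT_comp => //; apply: continuous_measurable_fun; exact: continuous_cos.
have ff v : N.-integrable [set: R] (EFin \o f v).
  by apply: (@bounded_integrable _ _ _ N (f v) 1) => [|x]; [exact: mf|exact: cos_max].
have dfu v x : is_derive v (1 : R) (f ^~ x) (- (x - m) * sin (v * (x - m) + theta)).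
  have daff : is_derive v (1 : R) (fun v => v * (x - m) + theta) (x - m).
    by apply: is_derive_eq; rewrite /GRing.scale /=; ring.
  have dcos := is_derive_cos (v * (x - m) + theta).
  have := @is_derive1_comp _ (@cos R) (fun v => v * (x - m) + theta) v _ _ dcos daff.
  by move=> h; apply: (is_derive_eq h); ring.
have sin_stein v : \int[N]_x (- (x - m) * sin (v * (x - m) + theta)) =
    - (v * s ^+ 2) * Phi v.
  have dsin x : is_derive x (1 : R) (fun x => sin (v * (x - m) + theta))
      (v * cos (v * (x - m) + theta)).
    have daff : is_derive x (1 : R) (fun x => v * (x - m) + theta) v.
      by apply: is_derive_eq; rewrite /GRing.scale /=; ring.
    have := @is_derive1_comp _ (@sin R) (fun x => v * (x - m) + theta) x _ _
      (is_derive_sin _) daff.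
    by move=> h; apply: (is_derive_eq h); ring.
  have := @normal_stein _ _ _ s0 _ _ (1 + `|v|) dsin.
  move=> /(_ m) E.
  have msin : measurable_fun [set: R] (fun x => sin (v * (x - m) + theta)).
    apply: (@measurableT_comp _ _ _ _ _ _ (@sin R)); last exact: maff.
    by apply: continuous_measurable_fun; exact: continuous_sin.
  have isin := @integrable_center_mul _ m _ s0 _ 1 msin (fun x => sin_max _).
  transitivity (\int[N]_x (-1 * ((x - m) * sin (v * (x - m) + theta)))).
    by apply: eq_Rintegral => x _; ring.
  rewrite RintegralZl// E.
  - by rewrite RintegralZl//; [rewrite /Phi /f; ring|exact: ff].
  - move=> x; apply: cvgM; first exact: cvg_cst.
    apply: (@continuous_comp _ _ _ (fun x => v * (x - m) + theta) (@cos R));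
      last exact: continuous_cos.
    apply: cvgD; last exact: cvg_cst.
    by apply: cvgM; [exact: cvg_cst|apply: cvgB; [exact: cvg_id|exact: cvg_cst]].
  - by move=> x; rewrite (le_trans (sin_max _))// lerDl.
  - move=> x; rewrite normrM (le_trans (ler_wpM2l _ (cos_max _)))// mulr1 lerDr//.
have dPhi v : is_derive v (1 : R) Phi (- (v * s ^+ 2) * Phi v).
  (* Any open interval around v would do, since the majorant |y - m| of the partial derivative is
     independent of the frequency. *)
  have vI : `]v - 1, v + 1[%classic v by rewrite /= in_itv/= ltrBlDr !ltrDl ltr01.
  have d1E w x : partial1of2 f w x = - (x - m) * sin (w * (x - m) + theta).
    by rewrite partial1of2E; have [_ ->] := dfu w x.
  have der w y : derivable (f ^~ y) w 1 by have [] := dfu w y.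
  have iG : N.-integrable [set: R] (EFin \o (fun y => `|y - m|)).
    have := @integrable_center_mul _ m s s0 (cst 1) 1 (measurable_cst _).
    under eq_fun do rewrite mulr1.
    by move=> h; apply: (integrable_abse (h _)) => x; rewrite normr1.
  have bG w y : `|partial1of2 f w y| <= `|y - m|.
    rewrite d1E normrM normrN ler_piMr//; exact: sin_max.
  apply: DeriveDef.
    exact: (@derivable_under_integral R _ _ N f setT measurableT v (v - 1)
      (v + 1) vI (fun x _ => ff x) (fun x y _ _ => der x y)
      (fun y => `|y - m|) (fun _ => normr_ge0 _) iG (fun x y _ _ => bG x y)).
  rewrite -derive1E (@differentiation_under_integral R _ _ N f setT measurableT v (v - 1)
      (v + 1) vI (fun x _ => ff x) (fun x y _ _ => der x y)
      (fun y => `|y - m|) (fun _ => normr_ge0 _) iG (fun x y _ _ => bG x y)).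
  by rewrite -sin_stein; apply: eq_Rintegral => x _; rewrite d1E.
(* Integrating factor of the differential equation: Psi is constant. *)
pose Psi v := expR (v ^+ 2 * s ^+ 2 / 2) * Phi v.
have dPsi v : is_derive v (1 : R) Psi 0.
  have dq : is_derive v (1 : R) (fun v => v ^+ 2 * s ^+ 2 / 2) (v * s ^+ 2).
    by apply: is_derive_eq; rewrite /GRing.scale /=; field.
  have de := @is_derive1_comp _ _ (fun v => v ^+ 2 * s ^+ 2 / 2) v _ _ (is_derive_expR _) dq.
  have dP := dPhi v.
  by apply: is_derive_eq; rewrite /GRing.scale /=; ring.
have PsiE : Psi u = Psi 0 by exact: is_derive_0_is_cst.
have Psi0 : Psi 0 = cos theta.
  rewrite /Psi expr0n /= !mul0r expR0 mul1r /Phi /f.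
  under eq_Rintegral do rewrite mul0r add0r.
  exact: (Rintegral_prob_cst N (cos theta)).
rewrite -Psi0 -PsiE /Psi mulrA -expRD mulNr.
rewrite (_ : - _ + _ = 0) ?expR0 ?mul1r//; ring.
Qed.

End NormalCharacteristic.

(** * Uniqueness of multivariate laws *)

Section BumpTransform.
Context {R : realType} {d : measure_display} {T : measurableType d}.
Variables (P : probability T R) (z g : T -> R).
Hypotheses (mz : measurable_fun [set: T] z) (mg : measurable_fun [set: T] g).
Hypothesis (g1 : forall w, `|g w| <= 1).

Lemma gaussian_bumpE (u : R) :
  expR (- u ^+ 2 / 2) = \int[normal_prob 0 1]_t cos (t * u).
Proof.
have := @Rintegral_normal_cos _ 0 1 (oner_neq0 _) 0 u.
rewrite expr1n mulr1 cos0 mulr1 => <-.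
by apply: eq_Rintegral => t _; rewrite subr0 addr0 mulrC.
Qed.

(** The Gaussian is its own Fourier transform, so a bump in z is an average of cosines of z. After
    exchanging the integrals, the expectation of a bump weighted by g depends only on the g-weighted
    characteristic function of z. *)
Lemma Rintegral_bump (l y : R) :
  \int[P]_w (expR (- (l * (z w - y)) ^+ 2 / 2) * g w) =
  \int[normal_prob 0 1]_t \int[P]_w (cos (t * l * z w + - (t * l * y)) * g w).
Proof.
have mt : measurable_fun [set: T * R] (fun p : T * R => p.2 * (l * (z p.1 - y))).
  apply: measurable_funM; first exact: measurable_snd.
  apply: measurable_funM => //; apply: measurable_funB => //.
  exact: measurableT_comp.
have mc : measurable_fun [set: T * R] (fun p : T * R => cos (p.2 * (l * (z p.1 - y))) * g p.1).
  apply: measurable_funM; last exact: measurableT_comp.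
  apply: (@measurableT_comp _ _ _ _ _ _ (@cos R)) => //.
  by apply: continuous_measurable_fun; exact: continuous_cos.
transitivity (\int[P]_w \int[normal_prob 0 1]_t (cos (t * (l * (z w - y))) * g w)).
  apply: eq_Rintegral => w _; rewrite gaussian_bumpE RintegralZr//.
  apply: (@bounded_integrable _ _ _ (normal_prob 0 1) _ 1) => [|t]; last exact: cos_max.
  apply: (@measurableT_comp _ _ _ _ _ _ (@cos R)) => //.
    by apply: continuous_measurable_fun; exact: continuous_cos.
  exact: measurable_funM.
rewrite (@bounded_Fubini _ _ _ _ _ P (normal_prob 0 1)
  (fun w t => cos (t * (l * (z w - y))) * g w) 1); last 2 first.
- exact: mc.
- by move=> w t; rewrite normrM mulr_ile1// cos_max.
by apply: eq_Rintegral => t _; apply: eq_Rintegral => w _; congr (cos _ * _); ring.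
Qed.

End BumpTransform.

(** * Half-line indicators as limits of combinations of Gaussian bumps *)

Section RayApproximation.
Context {R : realType}.

Let N (n : nat) : nat := (Num.trunc (n%:R * expR (n%:R ^+ 3 / 2) : R)).+1.
Let b (a : R) (n : nat) (x : R) : R := expR (- n%:R * (x - (a + n%:R)) ^+ 2 / 2).

(* Tends to the indicator of x < a: b is a Gaussian bump centred at a + n, and
   N b ~ n e^(n^3/2 - n(x - a - n)^2/2) tends to 0 for x < a and to +oo for x >= a.
   Its powers expand into bumps, whose expectations are integrals of characteristic
   functions. *)
Definition ray_approx (a : R) (n : nat) (x : R) : R := (1 - b a n x) ^+ N n.

Let b_gt0 a n x : 0 < b a n x. Proof. exact: expR_gt0. Qed.

Let b_le1 a n x : b a n x <= 1.
Proof.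
rewrite -expR0 ler_expR mulNr mulNr oppr_le0.
by rewrite divr_ge0// mulr_ge0// sqr_ge0.
Qed.

Lemma ray_approx_ge0 a n x : 0 <= ray_approx a n x.
Proof. by rewrite exprn_ge0// subr_ge0. Qed.

Lemma ray_approx_le1 a n x : ray_approx a n x <= 1.
Proof. by rewrite exprn_ile1 ?subr_ge0// lerBlDr lerDl ltW. Qed.

(** Binomial expansion: the k-th power of the bump is again a bump with the same centre and
    precision k n. *)
Lemma ray_approxE a n : exists M (c : nat -> R), forall x,
  ray_approx a n x = \sum_(k < M) c k *
    expR (- (Num.sqrt (k%:R * n%:R) * (x - (a + n%:R))) ^+ 2 / 2).
Proof.
exists (N n).+1, (fun k => (-1) ^+ k *+ 'C(N n, k)) => x.
rewrite /ray_approx exprBn; apply: eq_bigr => k _.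
rewrite expr1n mulr1 -mulrnAl; congr (_ * _).
rewrite /b -expRM_natl exprMn sqr_sqrtr ?mulr_ge0//; congr expR; ring.
Qed.

(** For x >= a, N b >= n as soon as n > x - a, hence (1 - b)^N <= e^(- N b) <= 1 / (n + 1). For x <
    a, Bernoulli's inequality gives (1 - b)^N >= 1 - N b, and the factor e^(n^3/2) in N cancels
    against b, leaving N b <= (n + 1) e^(- n^2 (a - x)) <= 2 / ((a - x) n). *)
Lemma ray_approx_cvg (a x : R) : (fun n => ray_approx a n x) @ \oo --> ((x < a)%R%:R : R).
Proof.
have [xa|ax] := ltP x a; last first.
  apply: (@squeeze_cvgr _ _ _ _ (cst 0) (fun n => n.+1%:R^-1)).
  - exists (Num.trunc (x - a)).+1 => // n /= xn.
    rewrite ray_approx_ge0/= /ray_approx.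
    have bN : n%:R <= (N n)%:R * b a n x.
      have e0 := expR_gt0 (n%:R ^+ 3 / 2 : R).
      apply: (@le_trans _ _ (n%:R * expR (n%:R ^+ 3 / 2) * b a n x)).
        rewrite -mulrA -expRD ler_peMr// -[leLHS]expR0 ler_expR.
        have n0 : 0 <= n%:R :> R by [].
        have xn' : x - a < n%:R.
          by rewrite (lt_le_trans (truncnS_gt _))// ler_nat.
        have -> : n%:R ^+ 3 / 2 + - n%:R * (x - (a + n%:R)) ^+ 2 / 2 =
          n%:R * ((x - a) * (2 * n%:R - (x - a))) / 2 :> R by field.
        rewrite divr_ge0// mulr_ge0// mulr_ge0 ?subr_ge0//; lra.
      by rewrite ler_wpM2r ?(ltW (b_gt0 _ _ _))// ltW// truncnS_gt.
    apply: (@le_trans _ _ (expR (- b a n x) ^+ N n)).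
      rewrite lerXn2r ?nnegrE ?subr_ge0 ?expR_ge0//.
      by have := expR_ge1Dx (- b a n x); rewrite addrC.
    rewrite -expRM_natl mulrN expRN lef_pV2 ?posrE ?expR_gt0//.
    rewrite (le_trans _ (expR_ge1Dx _))// -natr1 addrC lerD2l//.
  - exact: cvg_cst.
  - exact: cvg_harmonic.
have d0 : 0 < a - x by rewrite subr_gt0.
apply: (@squeeze_cvgr _ _ _ _ (fun n => 1 - 2 / (a - x) * n%:R^-1) (cst 1)).
- exists 1 => // n /= n1; rewrite ray_approx_le1 andbT /ray_approx.
  have n0 : 0 < n%:R :> R by rewrite ltr0n.
  have bern (y : R) k : 0 <= y <= 1 -> 1 - k%:R * y <= (1 - y) ^+ k.
    move=> /andP[y0 y1]; elim: k => [|k IH]; first by rewrite mul0r subr0 expr0.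
    rewrite exprS; have : 0 <= (k%:R : R) by [].
    have := ler_wpM2l (_ : 0 <= 1 - y) IH; rewrite subr_ge0 => /(_ y1).
    rewrite -natr1; nra.
  apply: le_trans (bern _ _ _); last by rewrite ltW ?b_gt0//= b_le1.
  rewrite lerB//.
  have Nle : (N n)%:R <= n%:R * expR (n%:R ^+ 3 / 2) + 1 :> R.
    rewrite /N -natr1 lerD2r truncn_le// mulr_ge0// ?expR_ge0//.
  have bE : b a n x <= expR (- (n%:R ^+ 3 / 2)) * expR (- (n%:R ^+ 2 * (a - x))).
    rewrite -expRD ler_expR.
    have -> : - n%:R * (x - (a + n%:R)) ^+ 2 / 2 = - (n%:R ^+ 3 / 2) +
      - (n%:R ^+ 2 * (a - x)) - n%:R * (a - x) ^+ 2 / 2 :> R by field.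
    by rewrite gerBl divr_ge0// mulr_ge0// ?sqr_ge0.
  set e := expR (n%:R ^+ 3 / 2) in Nle; set e' := expR (- (n%:R ^+ 3 / 2)) in bE.
  set q := expR (- (n%:R ^+ 2 * (a - x))) in bE.
  have ee' : e * e' = 1 by rewrite /e /e' -expRD subrr expR0.
  have e'1 : e' <= 1 by rewrite /e' -[leRHS]expR0 ler_expR oppr_le0 divr_ge0.
  have e'0 : 0 < e' by exact: expR_gt0.
  have q0 : 0 < q by exact: expR_gt0.
  have Nb : (N n)%:R * b a n x <= (n%:R + 1) * q.
    apply: le_trans (ler_wpM2l _ bE) _ => //.
    apply: le_trans (ler_wpM2r _ Nle) _; first by rewrite mulr_ge0 ?ltW.
    rewrite mulrDl mulrA -(mulrA _ e) ee' mulr1 mul1r mulrDl mul1r.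
    by rewrite lerD2l ler_piMl// ltW.
  apply: le_trans Nb _.
  have q1 : q * (n%:R ^+ 2 * (a - x)) <= 1.
    rewrite -ler_pdivlMl// mulr1 /q expRN invrK.
    by apply: le_trans (expR_ge1Dx _); rewrite lerDr.
  have n1' : 1 <= n%:R :> R by rewrite ler1n.
  rewrite ler_pdivlMr// mulrAC ler_pdivlMr//.
  have : 0 <= (n%:R - 1) * (q * n%:R * (a - x)) by rewrite !mulr_ge0 ?subr_ge0// ltW.
  nra.
- rewrite -[X in _ --> X]subr0; apply: cvgB; first exact: cvg_cst.
  rewrite -(mulr0 (2 / (a - x))); apply: cvgMr.
  by apply/gtr0_cvgV0; [exists 1 => // n /= ?; rewrite ltr0n|exact: cvgr_idn].
- exact: cvg_cst.
Qed.

End RayApproximation.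

Lemma Rintegral_sum {R : realType} {d} {T : measurableType d}
    (mu : {measure set T -> \bar R}) (I : Type) (s : seq I) (Q : pred I)
    (F : I -> T -> R) :
  (forall i, Q i -> mu.-integrable [set: T] (EFin \o F i)) ->
  \int[mu]_x (\sum_(i <- s | Q i) F i x) = \sum_(i <- s | Q i) \int[mu]_x F i x.
Proof.
move=> iF.
have iS s' : mu.-integrable [set: T] (fun x => (\sum_(i <- s' | Q i) F i x)%:E).
  by under eq_fun do rewrite -sumEFin; exact: integrable_sum.
elim: s => [|i s IH].
  by under eq_Rintegral do rewrite big_nil; rewrite big_nil /Rintegral integral0.
rewrite big_cons; have [Qi|Qi] := boolP (Q i).
  under eq_Rintegral do rewrite big_cons Qi.
  by rewrite RintegralD//; [rewrite IH|exact: iF|exact: iS].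
by under eq_Rintegral do rewrite big_cons (negbTE Qi).
Qed.

Section RayTransform.
Context {R : realType}.

Lemma measurable_ray_approx (a : R) n : measurable_fun [set: R] (ray_approx a n).
Proof.
apply: measurable_funX; apply: measurable_funB => //.
apply: measurableT_comp => //; apply: measurable_funM => //.
apply: measurable_funM => //; apply: measurable_funX; exact: measurable_funB.
Qed.

Lemma measurable_ray {d} {T : measurableType d} (z : T -> R) (a : R) :
  measurable_fun [set: T] z ->
  measurable_fun [set: T] (fun w => ((z w < a)%R%:R : R)).
Proof.
move=> mz; have := @measurable_fun_limR R d T
  (fun n w => ray_approx a n (z w)) (fun w => ((z w < a)%R%:R : R)).
apply=> [n|w]; last exact: ray_approx_cvg.
by apply: measurableT_comp => //; exact: measurable_ray_approx.
Qed.

Lemma Rintegral_ray_cvg {d} {T : measurableType d} (P : probability T R)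
    (z g : T -> R) (a : R) :
  measurable_fun [set: T] z -> measurable_fun [set: T] g ->
  (forall w, `|g w| <= 1) ->
  (fun n => \int[P]_w (ray_approx a n (z w) * g w)) @ \oo -->
    \int[P]_w ((z w < a)%R%:R * g w).
Proof.
move=> mz mg g1.
refine (proj2 (@Rintegral_dominated R d T P _ _ (cst 1) _ _ _ _ _)).
- move=> n; apply: measurable_funM => //; apply: measurableT_comp => //.
  exact: measurable_ray_approx.
- apply: measurable_funM => //; exact: measurable_ray.
- exact: finite_measure_integrable_cst.
- move=> n w; rewrite normrM mulr_ile1//.
  by rewrite ger0_norm ?ray_approx_ge0 ?ray_approx_le1.
- by apply: aeW => w; apply: cvgM; [exact: ray_approx_cvg|exact: cvg_cst].
Qed.

(** The weights g1 and g2 carry the other coordinates, which allows the coordinates of a vector to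
    be treated one at a time. For fixed n both sides of the approximation are the same combination
    of weighted cosines; then n tends to infinity. *)
Lemma ray_transform {d1 d2} {T1 : measurableType d1} {T2 : measurableType d2}
    (P1 : probability T1 R) (P2 : probability T2 R)
    (z1 g1 : T1 -> R) (z2 g2 : T2 -> R) :
  measurable_fun [set: T1] z1 -> measurable_fun [set: T1] g1 ->
  measurable_fun [set: T2] z2 -> measurable_fun [set: T2] g2 ->
  (forall w, `|g1 w| <= 1) -> (forall w, `|g2 w| <= 1) ->
  (forall u theta, \int[P1]_w (cos (u * z1 w + theta) * g1 w) =
                   \int[P2]_w (cos (u * z2 w + theta) * g2 w)) ->
  forall a, \int[P1]_w ((z1 w < a)%R%:R * g1 w) =
            \int[P2]_w ((z2 w < a)%R%:R * g2 w).
Proof.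
move=> mz1 mg1 mz2 mg2 g11 g21 H a.
have cvg1 := @Rintegral_ray_cvg _ _ P1 _ _ a mz1 mg1 g11.
have cvg2 := @Rintegral_ray_cvg _ _ P2 _ _ a mz2 mg2 g21.
apply: (cvg_unique _ cvg1); first exact: norm_hausdorff.
rewrite (_ : (fun n => _) = fun n => \int[P2]_w (ray_approx a n (z2 w) * g2 w))//.
apply/funext => n; have [N [c cE]] := ray_approxE a n.
suff main d (T : measurableType d) (P : probability T R) (z g : T -> R) :
    measurable_fun [set: T] z -> measurable_fun [set: T] g ->
    (forall w, `|g w| <= 1) ->
    \int[P]_w (ray_approx a n (z w) * g w) = \sum_(k < N) c k *
      \int[P]_w (expR (- (Num.sqrt (k%:R * n%:R) * (z w - (a + n%:R))) ^+ 2 / 2) * g w).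
  rewrite !main//; apply: eq_bigr => k _; rewrite !Rintegral_bump//.
  by congr (_ * _); apply: eq_Rintegral => t _; exact: H.
move=> mz mg gle1.
have bi (k : 'I_N) : P.-integrable [set: T] (EFin \o (fun w =>
    expR (- (Num.sqrt (k%:R * n%:R) * (z w - (a + n%:R))) ^+ 2 / 2) * g w)).
  apply: (@bounded_integrable _ _ _ P _ 1) => [|w].
    apply: measurable_funM => //; apply: measurableT_comp => //.
    apply: measurable_funM => //; apply: measurableT_comp => //.
    by apply: measurable_funX; apply: measurable_funM => //; exact: measurable_funB.
  rewrite normrM mulr_ile1// ger0_norm ?expR_ge0// -[leRHS]expR0 ler_expR.
  by rewrite mulNr oppr_le0 divr_ge0// sqr_ge0.
transitivity (\int[P]_w (\sum_(k < N) c k *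
   (expR (- (Num.sqrt (k%:R * n%:R) * (z w - (a + n%:R))) ^+ 2 / 2) * g w))).
  by apply: eq_Rintegral => w _; rewrite cE mulr_suml; apply: eq_bigr => k _; rewrite mulrA.
rewrite (@Rintegral_sum _ _ _ P _ _ xpredT (fun (k : 'I_N) w => c k *
   (expR (- (Num.sqrt (k%:R * n%:R) * (z w - (a + n%:R))) ^+ 2 / 2) * g w))).
  by apply: eq_bigr => k _; rewrite RintegralZl.
move=> k _; rewrite /comp; under eq_fun do rewrite EFinM.
apply: integrableZl => //.
exact: bi.
Qed.

End RayTransform.

(** * From characteristic functions to orthant probabilities *)

Section CramerWold.
Context {R : realType} (r : nat).

(** Together with [lin_from] this interpolates between the characteristic function (k = 0) and the
    orthant probability (k = r): half-line indicators for the coordinates before k, frequencies for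
    those from k on. *)
Definition below_upto {T : Type} (z : 'I_r -> T -> R) (a : 'I_r -> R) (k : nat) (w : T) : R :=
  \prod_(i < r | (i < k)%N) (z i w < a i)%R%:R.

Definition lin_from {T : Type} (z : 'I_r -> T -> R) (u : 'I_r -> R) (k : nat) (w : T) : R :=
  \sum_(i < r | (k <= i)%N) u i * z i w.

Lemma measurable_prodR {d} {T : measurableType d} (I : Type) (s : seq I)
    (Q : pred I) (h : I -> T -> R) :
  (forall i, measurable_fun [set: T] (h i)) ->
  measurable_fun [set: T] (fun w => \prod_(i <- s | Q i) h i w).
Proof.
move=> mh; elim: s => [|i s IH].
  by under eq_fun do rewrite big_nil; exact: measurable_cst.
under eq_fun do rewrite big_cons; case: (Q i) => //; exact: measurable_funM.
Qed.

Lemma measurable_sumR {d} {T : measurableType d} (I : Type) (s : seq I)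
    (Q : pred I) (h : I -> T -> R) :
  (forall i, measurable_fun [set: T] (h i)) ->
  measurable_fun [set: T] (fun w => \sum_(i <- s | Q i) h i w).
Proof.
move=> mh; elim: s => [|i s IH].
  by under eq_fun do rewrite big_nil; exact: measurable_cst.
under eq_fun do rewrite big_cons; case: (Q i) => //; exact: measurable_funD.
Qed.

Lemma below_upto_le1 {T : Type} (z : 'I_r -> T -> R) a k w :
  `|below_upto z a k w| <= 1.
Proof.
rewrite /below_upto; elim/big_ind: _ => [|x y x1 y1|i _]; first by rewrite normr1.
  by rewrite normrM mulr_ile1.
by rewrite normr_nat; case: (_ < _)%R.
Qed.

Lemma measurable_below_upto {d} {T : measurableType d} (z : 'I_r -> T -> R) a k :
  (forall i, measurable_fun [set: T] (z i)) ->
  measurable_fun [set: T] (below_upto z a k).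
Proof. by move=> mz; apply: measurable_prodR => i; exact: measurable_ray. Qed.

Lemma measurable_cos_lin {d} {T : measurableType d} (z : 'I_r -> T -> R) u k theta :
  (forall i, measurable_fun [set: T] (z i)) ->
  measurable_fun [set: T] (fun w => cos (lin_from z u k w + theta)).
Proof.
move=> mz; apply: (@measurableT_comp _ _ _ _ _ _ (@cos R)).
  by apply: continuous_measurable_fun; exact: continuous_cos.
apply: measurable_funD => //; apply: measurable_sumR => i; exact: measurable_funM.
Qed.

Section TwoSpaces.
Context {d1 d2 : measure_display} {T1 : measurableType d1} {T2 : measurableType d2}.
Variables (P1 : probability T1 R) (P2 : probability T2 R).
Variables (z1 : 'I_r -> T1 -> R) (z2 : 'I_r -> T2 -> R).
Hypotheses (mz1 : forall i, measurable_fun [set: T1] (z1 i)).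
Hypotheses (mz2 : forall i, measurable_fun [set: T2] (z2 i)).
Hypothesis cosE : forall (u : 'I_r -> R) theta,
  \int[P1]_w cos (\sum_i u i * z1 i w + theta) =
  \int[P2]_w cos (\sum_i u i * z2 i w + theta).
Variable a : 'I_r -> R.

(** Product-to-sum formula. A cosine in coordinate i0, weighted by a cosine in the later
    coordinates, is the mean of two cosines in the coordinates from i0 on, with the later
    frequencies multiplied by 1 and by -1. This puts the hypothesis of [ray_transform] within reach
    of the induction. *)
Let cos_prod {d} {T : measurableType d} (P : probability T R) (z : 'I_r -> T -> R)
    (mz : forall i, measurable_fun [set: T] (z i)) (i0 : 'I_r) u theta s t :
  let v e i := if i == i0 then s else e * u i in
  \int[P]_w (cos (s * z i0 w + t) *
     (below_upto z a i0 w * cos (lin_from z u i0.+1 w + theta))) =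
  (\int[P]_w (below_upto z a i0 w * cos (lin_from z (v 1) i0 w + (t + theta))) +
   \int[P]_w (below_upto z a i0 w * cos (lin_from z (v (-1)) i0 w + (t - theta)))) / 2.
Proof.
move=> v.
have ib e tt : P.-integrable [set: T] (EFin \o (fun w =>
    below_upto z a i0 w * cos (lin_from z (v e) i0 w + tt))).
  apply: (@bounded_integrable _ _ _ P _ 1) => [|w].
    by apply: measurable_funM; [exact: measurable_below_upto|exact: measurable_cos_lin].
  by rewrite normrM mulr_ile1 ?below_upto_le1 ?cos_max.
have linE e w : lin_from z (v e) i0 w = s * z i0 w + e * lin_from z u i0.+1 w.
  rewrite /lin_from (bigD1 i0)//= /v eqxx; congr (_ + _); rewrite mulr_sumr.
  apply: eq_big => [i|i /andP[_ /negbTE ->]]; last by rewrite mulrA.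
  by rewrite ltn_neqAle andbC eq_sym.
rewrite -RintegralD// mulrC -RintegralZl//; last first.
  rewrite /comp; under eq_fun do rewrite EFinD; apply: integrableD => //; exact: ib.
apply: eq_Rintegral => w _; rewrite !linE mul1r mulN1r.
set L := lin_from z u _ w; set b := below_upto _ _ _ _.
have -> : s * z i0 w + L + (t + theta) = (s * z i0 w + t) + (L + theta) by ring.
have -> : s * z i0 w - L + (t - theta) = (s * z i0 w + t) - (L + theta) by ring.
set A := s * _ + t; set B := L + theta.
by rewrite (cosD A B) (cosB A B); field.
Qed.

(* Passing from k to k + 1 trades one cosine frequency for one half-line indicator. *)
Let peel (k : nat) : (k <= r)%N -> forall u theta,
  \int[P1]_w (below_upto z1 a k w * cos (lin_from z1 u k w + theta)) =
  \int[P2]_w (below_upto z2 a k w * cos (lin_from z2 u k w + theta)).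
Proof.
elim: k => [_ u theta|k IH kr u theta].
  have E d (T : measurableType d) (P : probability T R) (z : 'I_r -> T -> R) :
      \int[P]_w (below_upto z a 0 w * cos (lin_from z u 0 w + theta)) =
      \int[P]_w cos (\sum_i u i * z i w + theta).
    by apply: eq_Rintegral => w _; rewrite /below_upto big1 ?mul1r//; case.
  by rewrite !E cosE.
pose i0 := Ordinal kr.
have E d (T : measurableType d) (P : probability T R) (z : 'I_r -> T -> R) :
    \int[P]_w (below_upto z a k.+1 w * cos (lin_from z u k.+1 w + theta)) =
    \int[P]_w ((z i0 w < a i0)%R%:R *
      (below_upto z a i0 w * cos (lin_from z u i0.+1 w + theta))).
  apply: eq_Rintegral => w _; rewrite mulrA; congr (_ * _).
  rewrite /below_upto (bigD1 i0) ?ltnS//=; congr (_ * _); apply: eq_bigl => i.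
  by rewrite ltnS [RHS]ltn_neqAle andbC.
rewrite !E; apply: ray_transform => //.
- by apply: measurable_funM; [exact: measurable_below_upto|exact: measurable_cos_lin].
- by apply: measurable_funM; [exact: measurable_below_upto|exact: measurable_cos_lin].
- by move=> w; rewrite normrM mulr_ile1 ?below_upto_le1 ?cos_max.
- by move=> w; rewrite normrM mulr_ile1 ?below_upto_le1 ?cos_max.
by move=> s t; rewrite !cos_prod// !IH// ltnW.
Qed.

Lemma cramer_wold_orthant :
  \int[P1]_w (\prod_i (z1 i w < a i)%R%:R) = \int[P2]_w (\prod_i (z2 i w < a i)%R%:R).
Proof.
have := peel (leqnn r) (fun=> 0) 0.
have E d (T : measurableType d) (P : probability T R) (z : 'I_r -> T -> R) :
    \int[P]_w (below_upto z a r w * cos (lin_from z (fun=> 0) r w + 0)) =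
    \int[P]_w (\prod_i (z i w < a i)%R%:R).
  apply: eq_Rintegral => w _; rewrite addr0 /lin_from big1 => [|i _]; last by rewrite mul0r.
  by rewrite cos0 mulr1; apply: eq_bigl => i; rewrite ltn_ord.
by rewrite !E.
Qed.

End TwoSpaces.
End CramerWold.

(** * Laws of random matrices *)

Section MatrixLaw.
Context {R : realType} (p n : nat).

Definition orthant (A : 'M[R]_(p, n)) : set 'M[R]_(p, n) :=
  [set M | forall i j, M i j < A i j].

(** Generated by a family closed under intersection, so that two laws on it coincide as soon as they
    agree on orthants. *)
Definition orthant_mx := g_sigma_algebraType (range orthant).

Lemma orthantI (A B : 'M[R]_(p, n)) :
  orthant A `&` orthant B = orthant (\matrix_(i, j) Num.min (A i j) (B i j)).
Proof.
apply/seteqP; split => [M [MA MB] i j|M MAB]; first by rewrite mxE lt_min MA MB.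
by split=> i j; have := MAB i j; rewrite mxE lt_min => /andP[].
Qed.

Lemma measurable_orthant (A : 'M[R]_(p, n)) :
  measurable (orthant A : set orthant_mx).
Proof. by apply: sub_sigma_algebra; exists A. Qed.

Lemma measurable_entry (i : 'I_p) (j : 'I_n) :
  measurable_fun [set: orthant_mx] (fun M : orthant_mx => (M : 'M[R]_(p, n)) i j).
Proof.
apply: (measurability _ (RGenInftyO.measurableE R)) => _ [_ [a ->] <-].
(* A condition on one entry is the increasing union of orthants whose other bounds k tend to
   infinity. *)
rewrite setTI (_ : _ @^-1` _ = \bigcup_k (orthant
    (\matrix_(i', j') if (i' == i) && (j' == j) then a else k%:R))).
  by apply: bigcup_measurable => k _; exact: measurable_orthant.
apply/seteqP; split => M /=.
  rewrite in_itv/= => Ma; pose K := \sum_i \sum_j `|M i j|.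
  exists (Num.trunc K).+1 => // i' j'; rewrite mxE.
  case: ifP => [/andP[/eqP -> /eqP ->]//|_].
  apply: le_lt_trans (truncnS_gt _); apply: le_trans (ler_norm _) _.
  rewrite /K (bigD1 i')//= (bigD1 j')//= -addrA lerDl addr_ge0// ?sumr_ge0// => k _.
  by rewrite sumr_ge0.
by move=> [k _ /(_ i j)]; rewrite mxE !eqxx in_itv.
Qed.

Lemma measurable_fun_mx {d} {T : measurableType d} (Y : T -> 'M[R]_(p, n)) :
  (forall i j, measurable_fun [set: T] (fun w => Y w i j)) ->
  measurable_fun [set: T] (Y : T -> orthant_mx).
Proof.
move=> mY; apply: (@measurability _ _ T orthant_mx setT Y (range orthant)) => //.
move=> _ [_ [A _ <-] <-]; rewrite setTI.
rewrite (_ : _ @^-1` _ = \bigcap_(i in [set: 'I_p]) \bigcap_(j in [set: 'I_n])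
    ((fun w => Y w i j) @^-1` `]-oo, A i j[%classic)).
  apply: fin_bigcap_measurable => // i _; apply: fin_bigcap_measurable => // j _.
  by rewrite -[X in measurable X]setTI; apply: mY => //; exact: measurable_itv.
apply/seteqP; split => w /=.
  by move=> wA i _ j _ /=; rewrite in_itv/=; exact: wA.
by move=> wA i j; have := wA i I j I; rewrite /= in_itv.
Qed.

Section TwoSpaces.
Context {d1 d2 : measure_display} {T1 : measurableType d1} {T2 : measurableType d2}.
Variables (P1 : probability T1 R) (P2 : probability T2 R).
Variables (Y1 : T1 -> 'M[R]_(p, n)) (Y2 : T2 -> 'M[R]_(p, n)).
Hypothesis mY1 : measurable_fun [set: T1] (Y1 : T1 -> orthant_mx).
Hypothesis mY2 : measurable_fun [set: T2] (Y2 : T2 -> orthant_mx).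
Hypothesis orthantE : forall A, P1 (Y1 @^-1` orthant A) = P2 (Y2 @^-1` orthant A).

Lemma orthant_law_unique (B : set orthant_mx) : measurable B ->
  pushforward P1 (Y1 : T1 -> orthant_mx) B = pushforward P2 (Y2 : T2 -> orthant_mx) B.
Proof.
move=> mB; apply: (@g_sigma_algebra_measure_unique _ R orthant_mx (range orthant) _
  (fun k => orthant (const_mx k%:R))) => //.
- by move=> _ [A _ <-]; exact: measurable_orthant.
- rewrite -subTset => M _; pose K := \sum_i \sum_j `|M i j|.
  exists (Num.trunc K).+1 => // i j; rewrite mxE.
  apply: le_lt_trans (truncnS_gt _); apply: le_trans (ler_norm _) _.
  rewrite /K (bigD1 i)//= (bigD1 j)//= -addrA lerDl addr_ge0// ?sumr_ge0// => k _.
  by rewrite sumr_ge0.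
- by move=> _ _ [A _ <-] [B' _ <-]; rewrite orthantI;
    exists (\matrix_(i, j) Num.min (A i j) (B' i j)).
- by move=> _ [A _ <-]; exact: orthantE.
- move=> k; apply: (@le_lt_trans _ _ 1%E); last exact: ltry.
  apply: probability_le1; rewrite -[X in measurable X]setTI.
  by apply: mY1 => //; exact: measurable_orthant.
Qed.

Lemma orthant_law_Rintegral (f : 'M[R]_(p, n) -> R) :
  measurable_fun [set: orthant_mx] (f : orthant_mx -> R) ->
  P1.-integrable [set: T1] (EFin \o (f \o Y1)) ->
  P2.-integrable [set: T2] (EFin \o (f \o Y2)) ->
  \int[P1]_w f (Y1 w) = \int[P2]_w f (Y2 w).
Proof.
move=> mf i1 i2; rewrite /Rintegral; congr fine.
have mf' : measurable_fun [set: orthant_mx] (EFin \o (f : orthant_mx -> R)).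
  exact/measurable_EFinP.
have := @integral_pushforward _ _ T1 orthant_mx R Y1 mY1 P1 setT (EFin \o f) mf' i1 measurableT.
have := @integral_pushforward _ _ T2 orthant_mx R Y2 mY2 P2 setT (EFin \o f) mf' i2 measurableT.
rewrite !preimage_setT /comp => <- <-.
by apply: eq_measure_integral => B mB _; exact: orthant_law_unique.
Qed.

(** Integrability has to be transported along with the integral, because that of the Stein integrand
    is visible only after resampling. *)
Lemma orthant_law_integrable (f : 'M[R]_(p, n) -> R) :
  measurable_fun [set: orthant_mx] (f : orthant_mx -> R) ->
  P2.-integrable [set: T2] (EFin \o (f \o Y2)) ->
  P1.-integrable [set: T1] (EFin \o (f \o Y1)).
Proof.
move=> mf /integrableP[_ i2]; apply/integrableP; split.
  by apply/measurable_EFinP; exact: (measurableT_comp (f := (f : orthant_mx -> R)) mf mY1).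
have mf' : measurable_fun [set: orthant_mx] (fun M : orthant_mx => `|(f M)%:E|%E).
  by apply: measurableT_comp => //; exact/measurable_EFinP.
apply: le_lt_trans i2; rewrite le_eqVlt; apply/orP; left; apply/eqP.
have := @ge0_integral_pushforward _ _ T1 orthant_mx R Y1 mY1 P1 setT
  (fun M => `|(f M)%:E|%E) measurableT mf' (fun M _ => abse_ge0 _).
have := @ge0_integral_pushforward _ _ T2 orthant_mx R Y2 mY2 P2 setT
  (fun M => `|(f M)%:E|%E) measurableT mf' (fun M _ => abse_ge0 _).
rewrite !preimage_setT /comp => <- <-.
by apply: eq_measure_integral => B mB _; exact: orthant_law_unique.
Qed.

End TwoSpaces.
End MatrixLaw.

Section Transfer.
Context {R : realType} {d1 d2 : measure_display}.
Context {T1 : measurableType d1} {T2 : measurableType d2}.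

Lemma Rintegral_law (P : probability T1 R) (m : {measure set T2 -> \bar R})
    (phi : T1 -> T2) (f : T2 -> R) :
  measurable_fun [set: T1] phi -> measurable_fun [set: T2] f ->
  (forall B, measurable B -> P (phi @^-1` B) = m B) ->
  P.-integrable [set: T1] (EFin \o (fun w => f (phi w))) ->
  \int[P]_w f (phi w) = \int[m]_x f x.
Proof.
move=> mphi mf Pm i; rewrite /Rintegral; congr fine.
have mf' : measurable_fun [set: T2] (EFin \o f) by exact/measurable_EFinP.
have := @integral_pushforward _ _ T1 T2 R phi mphi P setT _ mf' i measurableT.
rewrite preimage_setT /comp => <-.
by apply: eq_measure_integral => B mB _; exact: Pm.
Qed.

End Transfer.

(** * Linear images and characteristic functions of normal vectors *)

Section MultinormalImage.
Context {R : realType}.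

Lemma continuous_sumR {T : topologicalType} (I : Type) (s : seq I) (F : I -> T -> R) :
  (forall i, continuous (F i)) -> continuous (fun x => \sum_(i <- s) F i x).
Proof.
move=> cF; elim: s => [|i s IH] x.
  by under eq_fun do rewrite big_nil; exact: cvg_cst.
under eq_fun do rewrite big_cons.
by apply: cvgD; [exact: cF|exact: IH].
Qed.

Lemma continuous_mx {T : topologicalType} (m n : nat) (F : T -> 'M[R]_(m, n)) :
  (forall i j, continuous (fun x => F x i j)) -> continuous F.
Proof.
move=> cF x A [B Bx BA]; apply: filterS BA _ => //=.
have : \near x, forall i j, B i j (F x i j).
  apply: filter_forall => i; apply: filter_forall => j.
  exact: (cF i j x _ (Bx i j)).
exact.
Qed.

Lemma continuous_mulmx_entry (q p n : nat) (K : 'M[R]_(q, p)) i j :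
  continuous (fun x : 'M[R]_(p, n) => (K *m x) i j).
Proof.
under eq_fun do rewrite mxE; apply: continuous_sumR => k x.
by apply: cvgMr; [exact: (nbhs_filter x)|exact: coord_continuous].
Qed.

Lemma measurable_open_borel (p : nat) (A : set 'cV[R]_p) :
  open A -> measurable (A : set (borel_vec p)).
Proof. by move=> oA; exact: sub_sigma_algebra. Qed.

Lemma measurable_mulmx (q p : nat) (K : 'M[R]_(q, p)) :
  measurable_fun [set: borel_vec p] (mulmx K : borel_vec p -> borel_vec q).
Proof.
apply: (@measurability _ _ _ (borel_vec q) setT _ (@open 'cV[R]_q)) => //.
move=> _ [A oA <-]; rewrite setTI; apply: measurable_open_borel.
apply: open_comp => // x _; apply: continuous_mx => i j.
exact: continuous_mulmx_entry.
Qed.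

Context {d : measure_display} {T : measurableType d} (P : probability T R).

Lemma multinormal_mulmx (q p : nat) (K : 'M[R]_(q, p)) (X : T -> 'cV[R]_p) mu Sigma :
  multinormal P X mu Sigma ->
  multinormal P (fun w => K *m X w) (K *m mu) (K *m Sigma *m K^T).
Proof.
move=> [mX XN]; split.
  exact: (measurableT_comp (f := mulmx K : borel_vec p -> borel_vec q)
    (measurable_mulmx K) mX).
move=> u B mB; have := XN (K^T *m u) B mB.
rewrite trmx_mul trmxK !mulmxA => <-; congr (P (_ @^-1` B)).
by apply/funext => w; rewrite mulmxA.
Qed.

Lemma iid_normal_mulmx (n q p : nat) (K : 'M[R]_(q, p)) (X : 'I_n -> T -> 'cV[R]_p)
    mu Sigma :
  iid_normal P X mu Sigma ->
  iid_normal P (fun i w => K *m X i w) (K *m mu) (K *m Sigma *m K^T).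
Proof.
move=> [XN Xind]; split=> [i|J B mB]; first exact: multinormal_mulmx.
apply: (Xind J (fun i => (mulmx K : borel_vec p -> borel_vec q) @^-1` B i)) => i.
by rewrite -[X in measurable X]setTI; exact: measurable_mulmx.
Qed.

Lemma multinormal_measurable_form (p : nat) (X : T -> 'cV[R]_p) mu Sigma (u : 'cV[R]_p) :
  multinormal P X mu Sigma -> measurable_fun [set: T] (fun w => (u^T *m X w) 0 0).
Proof.
move=> [mX _].
apply: (measurableT_comp (f := fun x : borel_vec p => (u^T *m x) 0 0) _ mX).
apply: (measurability _ (RGenInftyO.measurableE R)) => _ [_ [a ->] <-].
rewrite setTI; apply: measurable_open_borel.
apply: open_comp => [x _|]; first exact: continuous_mulmx_entry.
exact: open_lt.
Qed.

Lemma multinormal_measurable_entry (p : nat) (X : T -> 'cV[R]_p) mu Sigma i :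
  multinormal P X mu Sigma -> measurable_fun [set: T] (fun w => X w i 0).
Proof.
move=> /multinormal_measurable_form -/(_ (delta_mx i 0)).
congr (measurable_fun _ _); apply/funext => w.
by rewrite trmx_delta -rowE mxE.
Qed.

Lemma multinormal_cos (p : nat) (X : T -> 'cV[R]_p) mu Sigma (u : 'cV[R]_p) theta :
  psdmx Sigma -> multinormal P X mu Sigma ->
  \int[P]_w cos ((u^T *m X w) 0 0 + theta) =
  expR (- (u^T *m Sigma *m u) 0 0 / 2) * cos ((u^T *m mu) 0 0 + theta).
Proof.
move=> [_ Spsd] XN; have mu' := multinormal_measurable_form u XN.
have [_ /(_ u) XNu] := XN.
set v := (u^T *m Sigma *m u) 0 0 in XNu *; set m := (u^T *m mu) 0 0 in XNu *.
have v0 : 0 <= v by exact: Spsd.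
have mc : measurable_fun [set: R] (fun x : R => cos (x + theta)).
  apply: (@measurableT_comp _ _ _ _ _ _ (@cos R)); last exact: measurable_funD.
  by apply: continuous_measurable_fun; exact: continuous_cos.
have ic : P.-integrable [set: T] (EFin \o (fun w => cos ((u^T *m X w) 0 0 + theta))).
  apply: (@bounded_integrable _ _ _ P _ 1) => [|w]; last exact: cos_max.
  exact: (measurableT_comp mc mu').
have law (mm : {measure set (measurableTypeR R) -> \bar R}) :
    (forall B, measurable B -> P ((fun w => (u^T *m X w) 0 0) @^-1` B) = mm B) ->
    \int[P]_w cos ((u^T *m X w) 0 0 + theta) = \int[mm]_x cos (x + theta).
  by move=> H; exact: (@Rintegral_law _ _ _ T (measurableTypeR R) P mm
    (fun w => (u^T *m X w) 0 0) (fun x => cos (x + theta)) mu' mc H ic).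
(* A functional of zero variance has a Dirac law, and the formula reduces to the cosine at the
   mean. *)
have [vE|vN0] := eqVneq v 0.
  rewrite vE oppr0 mul0r expR0 mul1r.
  rewrite (law (@dirac _ (measurableTypeR R) m R)) => [|B mB];
    last by rewrite XNu// /normal_law vE eqxx.
  rewrite /Rintegral integral_dirac//; first by rewrite diracT mul1e.
  exact/measurable_EFinP.
have s0 : Num.sqrt v != 0 by rewrite sqrtr_eq0 -ltNge lt_neqAle eq_sym vN0.
have := @Rintegral_normal_cos _ m _ s0 (m + theta) 1.
rewrite expr1n mul1r sqr_sqrtr// => <-.
rewrite (law (normal_prob m (Num.sqrt v))) => [|B mB].
  by apply: eq_Rintegral => x _; congr cos; ring.
by rewrite XNu// /normal_law (negbTE vN0).
Qed.

End MultinormalImage.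

(** * Resampling and the multivariate Stein identity *)

Section Stein.
Context {R : realType} {d : measure_display} {T : measurableType d}.
Context {n p : nat}.
Variables (P : probability T R) (X : 'I_n -> T -> 'cV[R]_p).
Variables (mu : 'cV[R]_p) (Sigma : 'M[R]_p).
Hypotheses (XN : iid_normal P X mu Sigma) (Sp : psdmx Sigma) (Su : Sigma \in unitmx).

Definition data_mx (x : 'I_n -> 'cV[R]_p) : 'M[R]_(p, n) := \matrix_(i, j) x j i 0.

Let Y (w : T) := data_mx (fun j => X j w).
Let N := @normal_prob R 0 1.
Let PN := product_probability N P.

Variables (k : 'I_p) (j : 'I_n).

(** Since Sigma u = e_k, the functional x -> u^T x has variance s2 under N(mu, Sigma) and covariance
    vector e_k with X_j. Hence X_j - (xi / s) e_k is uncorrelated with xi. *)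
Let u : 'cV[R]_p := invmx Sigma *m delta_mx k 0.
Let s2 := (invmx Sigma) k k.
Let s := Num.sqrt s2.
Let form (x : 'cV[R]_p) : R := (u^T *m x) 0 0.
Let xi (w : T) : R := form (X j w - mu) / s.
(* xi is standard normal and independent of X_j - (xi / s) e_k; Y' replaces it by an
   independent copy. *)
Let Y' (z : measurableTypeR R * T) : 'M[R]_(p, n) :=
  Y z.2 + ((z.1 - xi z.2) / s) *: delta_mx k j.

Let s2_gt0 : 0 < s2.
Proof.
rewrite /s2 -form_delta; apply: psd_unit_gt0.
- exact: psd_inv.
- by rewrite unitmx_inv.
- by apply/eqP => /matrixP/(_ k 0)/eqP; rewrite !mxE !eqxx oner_eq0.
Qed.

Let s_gt0 : 0 < s. Proof. by rewrite sqrtr_gt0. Qed.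

Let sE : s ^+ 2 = s2. Proof. by rewrite sqr_sqrtr// ltW. Qed.

Let Sigma_u : Sigma *m u = delta_mx k 0.
Proof. by rewrite /u mulKVmx. Qed.

Let form_k : form (delta_mx k 0) = s2.
Proof.
have [Ss _] := Sp.
by rewrite /form /u trmx_mul trmx_inv Ss form_delta.
Qed.

Let formB x y : form (x - y) = form x - form y.
Proof. by rewrite /form mulmxBr !mxE. Qed.

Let formDZ x y t : form (x + t *: y) = form x + t * form y.
Proof. by rewrite /form mulmxDr -scalemxAr !mxE. Qed.

Let measurable_X i l : measurable_fun [set: T] (fun w => X i w l 0).
Proof. by have [/(_ i) + _] := XN; exact: multinormal_measurable_entry. Qed.

Let measurable_xi : measurable_fun [set: T] xi.
Proof.
have [/(_ j) XNj _] := XN.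
have mf := multinormal_measurable_form u XNj.
apply: measurable_funM => //.
under eq_fun do rewrite formB.
exact: measurable_funB.
Qed.

Let measurable_Y : measurable_fun [set: T] (Y : T -> orthant_mx p n).
Proof.
apply: measurable_fun_mx => i l; rewrite /Y /data_mx.
by under eq_fun do rewrite mxE; exact: measurable_X.
Qed.

Let measurable_shift :
  measurable_fun [set: measurableTypeR R * T] (fun z => (z.1 - xi z.2) / s : R).
Proof.
apply: measurable_funM => //; apply: measurable_funB => //.
exact: measurableT_comp.
Qed.

Let measurable_Y' :
  measurable_fun [set: measurableTypeR R * T] (Y' : measurableTypeR R * T -> orthant_mx p n).
Proof.
apply: measurable_fun_mx => i l; rewrite /Y'.
under eq_fun do rewrite !mxE; apply: measurable_funD.
  by apply: (measurableT_comp (measurable_X l i)); exact: measurable_snd.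
exact: measurable_funM.
Qed.

Let prob_independent (B : 'I_n -> set 'cV[R]_p) : (forall i, open (B i)) ->
  P [set w | forall i, B i (X i w)] = (\prod_i P (X i @^-1` B i))%E.
Proof.
move=> oB; have [_ /(_ [set: 'I_n]%SET B)] := XN.
move=> /(_ (fun i => measurable_open_borel (oB i))).
under eq_bigl do rewrite finset.in_setT.
move=> <-; congr (P _); apply/seteqP; split => w /=; first by move=> wB i _; exact: wB.
by move=> wB i; apply: wB; rewrite /= finset.in_setT.
Qed.

Let below (a : 'I_p -> R) : set 'cV[R]_p := [set x | forall l, x l 0 < a l].

Let open_affine_below (a : 'I_p -> R) (F : 'cV[R]_p -> 'cV[R]_p) :
  (forall l, continuous (fun x => F x l 0)) -> open (F @^-1` below a).
Proof.
move=> cF.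
rewrite openE => x xa; have : \near x, forall l, F x l 0 < a l; last exact.
apply: (@filter_forall _ _ _ _ (nbhs_filter x)) => l.
have h : nbhs (F x l 0) [set y | y < a l].
  by apply: open_nbhs_nbhs; split; [exact: open_lt|exact: xa].
exact: (cF l x _ h).
Qed.

Let measurable_below {d'} {T' : measurableType d'} (z : 'I_p -> T' -> R) (a : 'I_p -> R) :
  (forall l, measurable_fun [set: T'] (z l)) -> measurable [set w | forall l, z l w < a l].
Proof.
move=> mz.
rewrite (_ : [set w | _] = \bigcap_(l in [set: 'I_p]) ((z l) @^-1` `]-oo, a l[%classic)).
  apply: fin_bigcap_measurable => // l _.
  by rewrite -[X in measurable X]setTI; apply: mz => //; exact: measurable_itv.
apply/seteqP; split => w /= h l; first by move=> _; rewrite /= in_itv; exact: h.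
by have := h l I; rewrite /= in_itv.
Qed.

Let prob_below {d'} {T' : measurableType d'} (Q : probability T' R)
    (z : 'I_p -> T' -> R) (a : 'I_p -> R) :
  (forall l, measurable_fun [set: T'] (z l)) ->
  Q [set w | forall l, z l w < a l] = (\int[Q]_w (\prod_l (z l w < a l)%R%:R))%:E.
Proof.
move=> mz; have mS := measurable_below a mz.
have iQ : Q.-integrable [set: T'] (EFin \o (fun w => \prod_l (z l w < a l)%R%:R)).
  apply: (@bounded_integrable _ _ _ Q _ 1) => [|w].
    by apply: measurable_prodR => l; exact: measurable_ray.
  elim/big_ind: _ => [|x y x1 y1|l _]; first by rewrite normr1.
    by rewrite normrM mulr_ile1.
  by rewrite normr_nat; case: (_ < _)%R.
rewrite /Rintegral fineK; last exact: integrable_fin_num.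
have := integral_indic Q measurableT mS; rewrite setIT => <-.
apply: eq_integral => w _; congr (_%:E); rewrite indicE.
have [/set_mem/= h|/negP h] := boolP (w \in [set w | forall l, z l w < a l]).
  by rewrite big1// => l _; rewrite h.
have [l hl] : exists l, ~~ (z l w < a l).
  apply/existsP; rewrite -negb_forall; apply/negP => /forallP hw.
  by apply: h; rewrite inE.
by rewrite (bigD1 l)//= (negbTE hl) mul0r.
Qed.

(** The functional c of the resampled column splits as c' of X_j plus (c_k / s) times the fresh
    variable plus a constant. The variance of c' falls short of that of c by (c_k / s)^2, and the
    fresh variable restores exactly this amount. *)
Let cos_resample (c : 'cV[R]_p) theta :
  \int[PN]_z cos (\sum_l c l 0 * Y' z l j + theta) =
  \int[P]_w cos (\sum_l c l 0 * X j w l 0 + theta).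
Proof.
have [/(_ j) XNj _] := XN.
have lin w : \sum_l c l 0 * X j w l 0 = (c^T *m X j w) 0 0.
  by rewrite mxE; apply: eq_bigr => l _; rewrite mxE.
under [RHS]eq_Rintegral do rewrite lin.
rewrite (multinormal_cos _ _ Sp XNj).
(* This t removes xi from the functional: c' and u are orthogonal for Sigma. *)
pose t := - (c k 0 / s2); pose c' := c + t *: u.
have linY z : \sum_l c l 0 * Y' z l j =
    (c'^T *m X j z.2) 0 0 + (c k 0 / s * z.1 - t * form mu).
  transitivity ((c^T *m X j z.2) 0 0 + c k 0 * ((z.1 - xi z.2) / s)).
    rewrite -lin [in X in _ = _ + X](_ : c k 0 = \sum_l c l 0 * (l == k)%:R); last first.
      by rewrite (bigD1 k)//= eqxx mulr1 big1 ?addr0// => l /negbTE ->; rewrite mulr0.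
    rewrite mulr_suml -big_split; apply: eq_bigr => l _ /=.
    by rewrite /Y' /Y !mxE eqxx andbT; ring.
  have -> : (c'^T *m X j z.2) 0 0 = (c^T *m X j z.2) 0 0 + t * form (X j z.2).
    by rewrite /c' linearD /= [(t *: u)^T]linearZ /= mulmxDl -scalemxAl [LHS]mxE [X in _ +
      X = _]mxE.
  rewrite /xi formB /t -sE; field.
  by rewrite gt_eqF.
under eq_Rintegral do rewrite linY.
pose A (w : T) := (c'^T *m X j w) 0 0.
pose B (x : R) := c k 0 / s * x - t * form mu + theta.
have mA : measurable_fun [set: T] A by exact: multinormal_measurable_form XNj.
have mB : measurable_fun [set: R] B.
  by apply: measurable_funD => //; apply: measurable_funB => //; exact: measurable_funM.
transitivity (\int[PN]_z cos (A z.2 + B z.1)).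
  by apply: eq_Rintegral => z _; congr cos; rewrite /A /B -!addrA.
transitivity (\int[N]_x \int[P]_w cos (A w + B x)).
  apply: (@bounded_Rintegral_prod1 _ _ _ (measurableTypeR R) T N P
    (fun z => cos (A z.2 + B z.1)) 1); last by move=> z; exact: cos_max.
  apply: (@measurableT_comp _ _ _ _ _ _ (@cos R)).
    by apply: continuous_measurable_fun; exact: continuous_cos.
  apply: measurable_funD; first by apply: (measurableT_comp mA); exact: measurable_snd.
  by apply: (measurableT_comp mB); exact: measurable_fst.
set q := (c^T *m Sigma *m c) 0 0.
have qE : (c'^T *m Sigma *m c') 0 0 = q - (c k 0 / s) ^+ 2.
  have [Ss _] := Sp.
  rewrite /c' form_addZ// -/q -!mulmxA !Sigma_u.
  have -> : (c^T *m (delta_mx k 0 : 'cV[R]_p)) 0 0 = c k 0 by rewrite -colE !mxE.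
  have -> : (u^T *m (delta_mx k 0 : 'cV[R]_p)) 0 0 = s2 by exact: form_k.
  rewrite /t -sE; field.
  by rewrite gt_eqF.
transitivity (\int[N]_x (expR (- (c'^T *m Sigma *m c') 0 0 / 2) *
    cos (c k 0 / s * (x - 0) + ((c^T *m mu) 0 0 + theta)))).
  apply: eq_Rintegral => x _.
  rewrite (multinormal_cos _ _ Sp XNj); congr (_ * cos _).
  have -> : (c'^T *m mu) 0 0 = (c^T *m mu) 0 0 + t * form mu.
    by rewrite /c' linearD /= [(t *: u)^T]linearZ /= mulmxDl -scalemxAl [LHS]mxE [X in _ +
      X = _]mxE.
  by rewrite /B /=; ring.
rewrite RintegralZl//; last first.
  apply: (@bounded_integrable _ _ _ N _ 1) => [|x]; last exact: cos_max.
  apply: (@measurableT_comp _ _ _ _ _ _ (@cos R)).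
    by apply: continuous_measurable_fun; exact: continuous_cos.
  by apply: measurable_funD => //; apply: measurable_funM => //; exact: measurable_funB.
rewrite (Rintegral_normal_cos _ (oner_neq0 _)) expr1n mulr1 mulrA -expRD qE.
by congr (expR _ * _); ring.
Qed.

(** Only column j is modified. For a fixed fresh value x the orthant event factors over the
    independent columns, so the claim reduces to the marginal law of column j, where the Cramer-Wold
    argument applies to [cos_resample]. *)
Let resample_law (A : 'M[R]_(p, n)) :
  P (Y @^-1` orthant A) = PN (Y' @^-1` orthant A).
Proof.
pose H i := below (fun l => A l i).
have oH i : open (H i).
  by apply: (@open_affine_below _ id) => l; exact: coord_continuous.
pose C := (\prod_(i | i != j) P (X i @^-1` H i))%E.
have PY : P (Y @^-1` orthant A) = (P (X j @^-1` H j) * C)%E.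
  transitivity (\prod_i P (X i @^-1` H i))%E; last by rewrite (bigD1 j).
  rewrite -prob_independent//; congr (P _).
  apply/seteqP; split => w /= h.
    by move=> i l; have := h l i; rewrite mxE.
  by move=> l i; rewrite mxE; exact: h.
(* The columns y that land in the orthant once their xi is replaced by x. *)
pose Bx (x : R) : set 'cV[R]_p :=
  (fun y => y + ((x - form (y - mu) / s) / s) *: delta_mx k 0) @^-1` H j.
have oBx x : open (Bx x).
  apply: open_affine_below => l y.
  have -> : (fun y : 'cV[R]_p => (y + ((x - form (y - mu) / s) / s) *: delta_mx k 0) l 0) =
      (fun y : 'cV[R]_p => y l 0 + ((x - (form y - form mu) / s) / s) * (delta_mx k 0 :
        'cV[R]_p) l 0).
    by apply/funext => y'; rewrite formB [LHS]mxE [X in _ + X = _]mxE.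
  have Fy := nbhs_filter y.
  apply: cvgD; first exact: coord_continuous.
  apply: cvgMl; apply: cvgMl; apply: cvgB; first exact: cvg_cst.
  apply: cvgMl; apply: cvgB; last exact: cvg_cst.
  exact: continuous_mulmx_entry.
have secE x w : Y' (x, w) = \matrix_(l, i) (if i == j then
    (X j w + ((x - form (X j w - mu) / s) / s) *: delta_mx k 0) l 0 else X i w l 0).
  apply/matrixP => l i; rewrite /Y' /Y !mxE eqxx andbT /= -/(xi w).
  by have [->|ij] := eqVneq i j; rewrite ?andbT// andbF mulr0 addr0.
have PY' x : P (xsection (Y' @^-1` orthant A) x) = (P (X j @^-1` Bx x) * C)%E.
  transitivity (\prod_i P (X i @^-1` (if i == j then Bx x else H i)))%E.
    rewrite -prob_independent; last by move=> i; case: ifP.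
    congr (P _); apply/seteqP; split => w.
      rewrite /xsection /= inE /= secE => h i.
      by case: ifP => [/eqP -> l|ij l]; have := h l; [move=> /(_ j)|move=> /(_ i)];
        rewrite mxE ?eqxx ?ij.
    rewrite /xsection /= inE /= secE => h l i; rewrite mxE.
    by have := h i; case: ifP => [/eqP ->|_]; exact.
  rewrite (bigD1 j)//= eqxx; congr (_ * _)%E.
  by apply: eq_bigr => i /negbTE ->.
have mY'j l : measurable_fun [set: measurableTypeR R * T] (fun z => Y' z l j).
  exact: (measurableT_comp (measurable_entry l j) measurable_Y').
have mS := measurable_below (fun l => A l j) mY'j.
have PNj : PN [set z | forall l, Y' z l j < A l j] = P (X j @^-1` H j).
  rewrite (prob_below PN (fun l => A l j) mY'j).
  transitivity (P [set w | forall l, X j w l 0 < A l j]) => //.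
  rewrite (prob_below P (fun l => A l j) (measurable_X j)); congr (_%:E).
  apply: (@cramer_wold_orthant R p _ _ _ _ PN P (fun l z => Y' z l j)
    (fun l w => X j w l 0) mY'j (measurable_X j)) => c theta.
  have := cos_resample (\col_l c l) theta.
  by under eq_Rintegral do under eq_bigr do rewrite mxE;
     under [RHS]eq_Rintegral do under eq_bigr do rewrite mxE.
rewrite PY -PNj.
transitivity (\int[N]_x (P (X j @^-1` Bx x) * C))%E; last first.
  by apply: eq_integral => x _; exact/esym/PY'.
have secj x : P (xsection [set z | forall l, Y' z l j < A l j] x) = P (X j @^-1` Bx x).
  congr (P _); apply/seteqP; split => w; rewrite /xsection /= inE /= secE => h l.
    by have := h l; rewrite mxE eqxx.
  by rewrite mxE eqxx; exact: h.
rewrite ge0_integralZr//.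
- by congr (_ * _)%E; apply: eq_integral => x _; exact: secj.
- have := measurable_fun_xsection P mS; congr (measurable_fun _ _).
  by apply/funext => x; exact: secj.
- by apply: prode_ge0 => i _.
Qed.

Variables (f g : 'M[R]_(p, n) -> R) (K : R).
Hypotheses (mf : measurable_fun [set: orthant_mx p n] (f : orthant_mx p n -> R)).
Hypotheses (mg : measurable_fun [set: orthant_mx p n] (g : orthant_mx p n -> R)).
Hypotheses (fK : forall M, `|f M| <= K) (gK : forall M, `|g M| <= K).
Hypothesis (dfg : forall M (t : R), is_derive t (1 : R)
  (fun t : R => f (M + t *: delta_mx k j)) (g (M + t *: delta_mx k j))).
Hypothesis (cg : forall M, continuous (fun t : R => g (M + t *: delta_mx k j))).

Let score (M : 'M[R]_(p, n)) : R := form (col j M - mu).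

(** The old xi cancels, so the score of the resampled data depends on the fresh variable alone. *)
Let scoreY' z : score (Y' z) = s * z.1.
Proof.
rewrite /score /Y' linearD /= [col j (_ *: _)]linearZ /=.
have -> : col j (delta_mx k j) = delta_mx k 0 :> 'cV[R]_p.
  by apply/matrixP => a b; rewrite !mxE !ord1 !eqxx !andbT.
have -> : col j (Y z.2) = X j z.2 by apply/colP => a; rewrite !mxE.
rewrite addrAC formDZ form_k -sE /xi; field.
by rewrite gt_eqF.
Qed.

Let measurable_score_f :
  measurable_fun [set: orthant_mx p n] (fun M : orthant_mx p n => score M * f M).
Proof.
apply: measurable_funM => //.
rewrite (_ : score =
    (fun M : orthant_mx p n => \sum_l u l 0 * (M : 'M[R]_(p, n)) l j - form mu)).
  apply: measurable_funB => //; apply: measurable_sumR => l.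
  by apply: measurable_funM => //; exact: measurable_entry.
apply/funext => M; rewrite /score formB; congr (_ - _).
by rewrite /form mxE; apply: eq_bigr => l _; rewrite !mxE.
Qed.

Let integrable_score_f_resampled :
  PN.-integrable [set: measurableTypeR R * T] (EFin \o (fun z => score (Y' z) * f (Y' z))).
Proof.
have mz : measurable_fun [set: measurableTypeR R * T] (fun z => s * z.1).
  by apply: measurable_funM => //; exact: measurable_fst.
have i1 : N.-integrable [set: measurableTypeR R] (EFin \o (fun x => `|x| : R)).
  have one1 (x : R) : `|cst 1 x| <= (1 : R) by rewrite normr1.
  have := integrable_abse (@integrable_center_mul R 0 1 (oner_neq0 _) (cst 1) 1
    (measurable_cst _) one1).
  by congr integrable; apply/funext => x /=; rewrite subr0 mulr1.
apply: (@le_integrable _ _ _ PN _ measurableT _ (EFin \o (fun z => s * K * `|z.1|))).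
- apply/measurable_EFinP; apply: measurable_funM.
    by under eq_fun do rewrite scoreY'.
  exact: (measurableT_comp mf measurable_Y').
- move=> z _ /=; rewrite lee_fin scoreY' !normrM normr_id (gtr0_norm s_gt0).
  rewrite mulrAC ler_wpM2r// ler_wpM2l ?(ltW s_gt0)//.
  by rewrite (le_trans (fK _))// ler_norm.
- rewrite /comp; under eq_fun do rewrite EFinM; apply: integrableZl => //.
  apply/(integrable12ltyP N P).
    apply/measurable_EFinP; apply: measurableT_comp => //; exact: measurable_fst.
  have /integrableP[_] := i1; congr (_ < _)%E; apply: eq_integral => x _ /=.
  by rewrite -[LHS]mule1 -(@probability_setT _ _ _ P) -(integral_cst P measurableT).
Qed.

(** After resampling, fix w: as x varies, Y'(x, w) moves along the direction (k, j) at speed 1 / s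
    while the score is s x. The univariate identity in x produces the factor 1 / s, which cancels
    s. *)
Lemma iid_normal_stein :
  P.-integrable [set: T] (EFin \o (fun w => ((invmx Sigma *m (X j w - mu)) k 0 * f (Y w)))) /\
  \int[P]_w ((invmx Sigma *m (X j w - mu)) k 0 * f (Y w)) = \int[P]_w g (Y w).
Proof.
have scoreY w : (invmx Sigma *m (X j w - mu)) k 0 = score (Y w).
  rewrite /score (_ : col j (Y w) = X j w); last by apply/colP => a; rewrite !mxE.
  have [Ss _] := Sp.
  by rewrite /form /u trmx_mul trmx_inv Ss trmx_delta -mulmxA -rowE [RHS]mxE.
under eq_Rintegral do rewrite scoreY.
rewrite (_ : (fun w => _) = (fun w => score (Y w) * f (Y w))); last first.
  by apply/funext => w; rewrite scoreY.
have iP := @orthant_law_integrable R p n _ _ _ _ P PN Y Y' measurable_Y measurable_Y'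
  resample_law (fun M => score M * f M) measurable_score_f integrable_score_f_resampled.
split => //.
rewrite (@orthant_law_Rintegral R p n _ _ _ _ P PN Y Y' measurable_Y measurable_Y'
  resample_law (fun M => score M * f M) measurable_score_f iP integrable_score_f_resampled).
have igY : P.-integrable [set: T] (EFin \o (g \o Y)).
  apply: (@bounded_integrable _ _ _ P _ K) => [|w]; last exact: gK.
  exact: (measurableT_comp mg measurable_Y).
have mgY' : measurable_fun [set: measurableTypeR R * T] (g \o Y').
  exact: (measurableT_comp mg measurable_Y').
have igY' : PN.-integrable [set: measurableTypeR R * T] (EFin \o (g \o Y')).
  by apply: (@bounded_integrable _ _ _ PN _ K) => // z; exact: gK.
rewrite (@orthant_law_Rintegral R p n _ _ _ _ P PN Y Y' measurable_Y measurable_Y'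
  resample_law g mg igY igY').
pose F w (x : R) := f (Y' (x, w)).
have mF w : measurable_fun [set: R] (F w).
  have mfY' : measurable_fun [set: measurableTypeR R * T] (fun z => f (Y' z)).
    exact: (measurableT_comp mf measurable_Y').
  exact: (measurableT_comp mfY' (measurable_pair2 w)).
have iF w : N.-integrable [set: R] (fun x => ((x - 0) * F w x)%:E).
  exact: (@integrable_center_mul R 0 1 (oner_neq0 _) (F w) K (mF w) (fun x => fK _)).
rewrite (@Rintegral_prod2 _ _ _ (measurableTypeR R) T N P); first last.
- move=> w; rewrite (_ : (fun x => _) = (fun x => (s%:E * ((x - 0) * F w x)%:E)%E)).
    by apply: integrableZl => //; exact: iF.
  by apply/funext => x; rewrite scoreY' -EFinM subr0 mulrA.
- exact: integrable_score_f_resampled.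
rewrite (@bounded_Rintegral_prod2 _ _ _ (measurableTypeR R) T N P (g \o Y') K mgY'
  (fun z => gK _)).
apply: eq_Rintegral => w _.
have dF x : is_derive x (1 : R) (F w) (s^-1 * g (Y' (x, w))).
  have dt : is_derive x (1 : R) (fun x : R => (x - xi w) / s) s^-1.
    by apply: is_derive_eq; rewrite /GRing.scale /=; ring.
  have := @is_derive1_comp _ (fun t => f (Y w + t *: delta_mx k j))
    (fun x : R => (x - xi w) / s) x _ _ (dfg _ _) dt.
  by move=> h; apply: (is_derive_eq h); rewrite mulrC.
have cF' : continuous (fun x => s^-1 * g (Y' (x, w))).
  move=> x; apply: cvgMr.
  apply: (@continuous_comp _ _ _ (fun x : R => (x - xi w) / s)
    (fun t => g (Y w + t *: delta_mx k j))); last exact: cg.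
  by apply: cvgMl; apply: cvgB; [exact: cvg_id|exact: cvg_cst].
transitivity (\int[N]_x (s * ((x - 0) * F w x))).
  by apply: eq_Rintegral => x _; rewrite scoreY' subr0 mulrA.
rewrite RintegralZl//; last exact: iF.
(* A single constant has to bound the function and its derivative, which carries the factor 1 /
   s. *)
rewrite (@normal_stein _ 0 1 (oner_neq0 _) _ _ (Num.max K (s^-1 * K)) dF cF').
- rewrite expr1n mul1r RintegralZl//; first by rewrite mulrA divff ?mul1r// gt_eqF.
  apply: (@bounded_integrable _ _ _ N _ K) => [|x]; last exact: gK.
  exact: (measurableT_comp mgY' (measurable_pair2 w)).
- by move=> x; rewrite le_max fK.
- move=> x; rewrite le_max normrM gtr0_norm ?invr_gt0// ler_pM2l ?invr_gt0//.
  by rewrite gK orbT.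
Qed.

End Stein.

(** * Entrywise calculus of matrix functions *)

Section EntrywiseCvg.
Context {R : realType} {T : Type} (F : set_system T) {FF : Filter F}.

(** Entrywise and along an arbitrary filter: products and traces reduce to real limits, and one set
    of rules serves sequences, neighbourhoods and the punctured neighbourhoods of difference
    quotients. *)
Definition mxcvg {m n} (A_ : T -> 'M[R]_(m, n)) (A : 'M[R]_(m, n)) :=
  forall i j, A_ t i j @[t --> F] --> A i j.

Lemma mxcvg_cst m n (A : 'M[R]_(m, n)) : mxcvg (fun=> A) A.
Proof. by move=> i j; exact: cvg_cst. Qed.

Lemma cvg_sumR (I : Type) (s : seq I) (f : I -> T -> R) (l : I -> R) :
  (forall i, f i t @[t --> F] --> l i) ->
  \sum_(i <- s) f i t @[t --> F] --> \sum_(i <- s) l i.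
Proof.
move=> fl; elim: s => [|i s IH].
  by rewrite big_nil; under eq_fun do rewrite big_nil; exact: cvg_cst.
by rewrite big_cons; under eq_fun do rewrite big_cons; exact: cvgD.
Qed.

Lemma mxcvgM m n q (A_ : T -> 'M[R]_(m, n)) (B_ : T -> 'M[R]_(n, q)) A B :
  mxcvg A_ A -> mxcvg B_ B -> mxcvg (fun t => A_ t *m B_ t) (A *m B).
Proof.
move=> cA cB i j; rewrite mxE; under eq_fun do rewrite mxE.
by apply: cvg_sumR => k; exact: cvgM.
Qed.

Lemma mxcvgD m n (A_ B_ : T -> 'M[R]_(m, n)) A B :
  mxcvg A_ A -> mxcvg B_ B -> mxcvg (fun t => A_ t + B_ t) (A + B).
Proof.
by move=> cA cB i j; rewrite mxE; under eq_fun do rewrite mxE; exact: cvgD.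
Qed.

Lemma mxcvgN m n (A_ : T -> 'M[R]_(m, n)) A :
  mxcvg A_ A -> mxcvg (fun t => - A_ t) (- A).
Proof.
by move=> cA i j; rewrite mxE; under eq_fun do rewrite mxE; exact: cvgN.
Qed.

Lemma mxcvgZ m n (a_ : T -> R) (A_ : T -> 'M[R]_(m, n)) (a : R) A :
  a_ t @[t --> F] --> a -> mxcvg A_ A -> mxcvg (fun t => a_ t *: A_ t) (a *: A).
Proof.
by move=> ca cA i j; rewrite mxE; under eq_fun do rewrite mxE; exact: cvgM.
Qed.

Lemma mxcvg_tr m n (A_ : T -> 'M[R]_(m, n)) A :
  mxcvg A_ A -> mxcvg (fun t => (A_ t)^T) A^T.
Proof. by move=> cA i j; rewrite mxE; under eq_fun do rewrite mxE; exact: cA. Qed.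

Lemma mxcvg_trace n (A_ : T -> 'M[R]_n) A :
  mxcvg A_ A -> \tr (A_ t) @[t --> F] --> \tr A.
Proof. by move=> cA; apply: cvg_sumR => i; exact: cA. Qed.

Lemma invmxB n (A B : 'M[R]_n) : A \in unitmx -> B \in unitmx ->
  invmx A - invmx B = - (invmx A *m (A - B) *m invmx B).
Proof.
move=> Au Bu; rewrite mulmxBr mulmxBl mulVmx// mul1mx -mulmxA mulmxV// mulmx1.
by rewrite opprB.
Qed.

(** From A_t^-1 - A^-1 = - A_t^-1 (A_t - A) A^-1: the first factor is bounded by K and the rest
    tends to 0. *)
Lemma mxcvg_inv n (A_ : T -> 'M[R]_n) A (K : R) :
  mxcvg A_ A -> (forall t, A_ t \in unitmx) -> A \in unitmx ->
  (forall t i j, `|invmx (A_ t) i j| <= K) ->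
  mxcvg (fun t => invmx (A_ t)) (invmx A).
Proof.
move=> cA Au_ Au AK i j; apply/subr_cvg0.
pose B t := (A_ t - A) *m invmx A.
have cB : mxcvg B 0.
  rewrite -(mul0mx _ (invmx A)); apply: mxcvgM; last exact: mxcvg_cst.
  by rewrite -(subrr A); apply: mxcvgD => //; exact: mxcvg_cst.
have -> : (fun t => invmx (A_ t) i j - invmx A i j) =
    (fun t => - \sum_k invmx (A_ t) i k * B t k j).
  apply/funext => t.
  have := congr1 (fun M : 'M[R]_n => M i j) (invmxB (Au_ t) Au).
  by rewrite -mulmxA !mxE => ->; congr (- _); rewrite mxE.
rewrite -[X in _ --> X]oppr0; apply: cvgN.
have z0 : \sum_(k < n) (0 : R) = 0 by rewrite big1.
rewrite -[X in _ --> X]z0; apply: (@cvg_sumR _ _ (fun k t =>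
  invmx (A_ t) i k * B t k j) (fun=> 0)) => k.
apply: norm_cvg0.
apply: (@squeeze_cvgr _ _ _ _ (cst 0) (fun t => K * `|B t k j|)).
- by apply: nearW => t; rewrite normr_ge0 normrM ler_wpM2r.
- exact: cvg_cst.
- rewrite -(mulr0 K); apply: cvgMr; rewrite -(normr0 R).
  by apply: cvg_norm; have := cB k j; rewrite mxE.
Qed.

End EntrywiseCvg.

Section EntrywiseDerive.
Context {R : realType}.

Lemma cvg_is_derive (f : R -> R) (t f' : R) :
  h^-1 * (f (h + t) - f t) @[h --> 0^'] --> f' <-> is_derive t (1 : R) f f'.
Proof.
have E : (fun h : R => h^-1 *: (f (h *: (1 : R) + t) - f t)) =
    (fun h => h^-1 * (f (h + t) - f t)).
  by apply/funext => h; rewrite [h *: _]mulr1.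
split=> [cf|[df <-]].
  have cf' : (fun h : R => h^-1 *: (f (h *: (1 : R) + t) - f t)) @ 0^' --> f' by rewrite E.
  apply: DeriveDef; first by apply/cvg_ex; exists f'.
  by apply/cvg_lim.
by have := df; rewrite /derivable /derive /= E.
Qed.

Definition mxderive {m n} (F : R -> 'M[R]_(m, n)) (t : R) (F' : 'M[R]_(m, n)) :=
  forall i j, is_derive t (1 : R) (fun t => F t i j) (F' i j).

Lemma mxderiveP m n (F : R -> 'M[R]_(m, n)) t F' :
  mxderive F t F' <-> mxcvg (0^' : set_system R) (fun h : R => h^-1 *: (F (h + t) - F t)) F'.
Proof.
have E i j : (fun h : R => (h^-1 *: (F (h + t) - F t)) i j) =
    (fun h : R => h^-1 * (F (h + t) i j - F t i j)).
  by apply/funext => h; rewrite !mxE.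
split=> dF i j.
  by rewrite E; exact: (cvg_is_derive (fun t => F t i j) t (F' i j)).2 (dF i j).
apply: (cvg_is_derive (fun t => F t i j) t (F' i j)).1.
by rewrite -E; exact: dF.
Qed.

Lemma mxderive_cvg m n (F : R -> 'M[R]_(m, n)) t F' : mxderive F t F' ->
  mxcvg (nbhs t) F (F t).
Proof.
move=> dF i j; apply: differentiable_continuous; apply/derivable1_diffP.
by have [] := dF i j.
Qed.

Lemma mxderive_cst m n (A : 'M[R]_(m, n)) t : mxderive (fun=> A) t 0.
Proof. by move=> i j; rewrite mxE; exact: is_derive_cst. Qed.

Lemma mxderive_line m n (A D : 'M[R]_(m, n)) t : mxderive (fun t => A + t *: D) t D.
Proof.
move=> i j; rewrite (_ : (fun t => _) = (fun t => A i j + t * D i j)).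
  by apply: is_derive_eq; rewrite /GRing.scale /=; ring.
by apply/funext => u; rewrite !mxE.
Qed.

Lemma mxderiveD m n (F G : R -> 'M[R]_(m, n)) t F' G' :
  mxderive F t F' -> mxderive G t G' -> mxderive (fun t => F t + G t) t (F' + G').
Proof.
move=> dF dG i j; rewrite mxE (_ : (fun t => _) = (fun t => F t i j + G t i j)).
  have := dF i j; have := dG i j => ? ?; exact: is_deriveD.
by apply/funext => u; rewrite mxE.
Qed.

Lemma mxderive_tr m n (F : R -> 'M[R]_(m, n)) t F' :
  mxderive F t F' -> mxderive (fun t => (F t)^T) t F'^T.
Proof.
move=> dF i j; rewrite mxE (_ : (fun t => _) = (fun t => F t j i)); first exact: dF.
by apply/funext => u; rewrite mxE.
Qed.

Lemma mxderiveM m n q (F : R -> 'M[R]_(m, n)) (G : R -> 'M[R]_(n, q)) t F' G' :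
  mxderive F t F' -> mxderive G t G' ->
  mxderive (fun t => F t *m G t) t (F' *m G t + F t *m G').
Proof.
move=> dF dG i j.
rewrite (_ : (fun t => _) = \sum_(k < n) (fun t => F t i k * G t k j)); last first.
  by apply/funext => u; rewrite fct_sumE mxE.
have dk (k : 'I_n) : is_derive t (1 : R) (fun t => F t i k * G t k j)
    (F t i k * G' k j + G t k j * F' i k).
  by have ? := dF i k; have ? := dG k j; apply: is_derive_eq.
apply: (is_derive_eq (is_derive_sum dk)).
rewrite !mxE -big_split; apply: eq_bigr => k _ /=; ring.
Qed.

(** The same difference formula applied to the difference quotient, with [mxcvg_inv] for the first
    factor. *)
Lemma mxderive_inv n (F : R -> 'M[R]_n) t F' (K : R) :
  mxderive F t F' -> (forall t, F t \in unitmx) ->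
  (forall t i j, `|invmx (F t) i j| <= K) ->
  mxderive (fun t => invmx (F t)) t (- (invmx (F t) *m F' *m invmx (F t))).
Proof.
move=> dF Fu FK; apply/mxderiveP.
have -> : (fun h : R => h^-1 *: (invmx (F (h + t)) - invmx (F t))) =
    (fun h : R => - (invmx (F (h + t)) *m (h^-1 *: (F (h + t) - F t)) *m invmx (F t))).
  by apply/funext => h; rewrite invmxB// scalerN -scalemxAr -scalemxAl.
have ht : (fun h : R => h + t) @ (0^' : set_system R) --> t.
  have : (fun h : R => h + t) @ (0^' : set_system R) --> 0 + t.
    by apply: cvgD; [apply: cvg_within_filter; exact: cvg_id|exact: cvg_cst].
  by rewrite add0r.
apply: mxcvgN; apply: mxcvgM; last exact: mxcvg_cst.
apply: mxcvgM; last exact/mxderiveP.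
apply: (mxcvg_inv _ _ _ (fun h => FK (h + t))) => // i j.
apply: (@cvg_comp _ _ _ (fun h : R => h + t) (fun s => F s i j)); first exact: ht.
exact: (mxderive_cvg dF).
Qed.

End EntrywiseDerive.

(** * Uniformly bounded and measurable families of matrices *)

Section BoundedFamilies.
Context {R : realType} {S : Type}.

Definition mxbounded {m n} (F : S -> 'M[R]_(m, n)) := exists K, forall s i j, `|F s i j| <= K.

Lemma mxbounded_cst m n (A : 'M[R]_(m, n)) : mxbounded (fun=> A).
Proof.
exists (\sum_i \sum_j `|A i j|) => _ i j.
rewrite (bigD1 i)//= (bigD1 j)//= -addrA lerDl addr_ge0// ?sumr_ge0// => k _.
by rewrite sumr_ge0.
Qed.

Lemma mxboundedM m n q (F : S -> 'M[R]_(m, n)) (G : S -> 'M[R]_(n, q)) :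
  mxbounded F -> mxbounded G -> mxbounded (fun s => F s *m G s).
Proof.
move=> [K FK] [L GL]; exists (\sum_(k < n) (K * L)) => s i j; rewrite mxE.
apply: le_trans (ler_norm_sum _ _ _) _; apply: ler_sum => k _.
by rewrite normrM ler_pM.
Qed.

Lemma mxboundedD m n (F G : S -> 'M[R]_(m, n)) :
  mxbounded F -> mxbounded G -> mxbounded (fun s => F s + G s).
Proof.
move=> [K FK] [L GL]; exists (K + L) => s i j; rewrite mxE.
by apply: le_trans (ler_normD _ _) _; rewrite lerD.
Qed.

Lemma mxboundedN m n (F : S -> 'M[R]_(m, n)) :
  mxbounded F -> mxbounded (fun s => - F s).
Proof. by move=> [K FK]; exists K => s i j; rewrite mxE normrN. Qed.

Lemma mxbounded_tr m n (F : S -> 'M[R]_(m, n)) :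
  mxbounded F -> mxbounded (fun s => (F s)^T).
Proof. by move=> [K FK]; exists K => s i j; rewrite mxE. Qed.

Lemma mxbounded_trace n (F : S -> 'M[R]_n) :
  mxbounded F -> exists K, forall s, `|\tr (F s)| <= K.
Proof.
move=> [K FK]; exists (\sum_(i < n) K) => s.
by apply: le_trans (ler_norm_sum _ _ _) _; apply: ler_sum.
Qed.

End BoundedFamilies.

Section MeasurableFamilies.
Context {R : realType} {d : measure_display} {T : measurableType d}.

Definition mxmeasurable {m n} (F : T -> 'M[R]_(m, n)) :=
  forall i j, measurable_fun [set: T] (fun w => F w i j).

Lemma mxmeasurable_cst m n (A : 'M[R]_(m, n)) : mxmeasurable (fun=> A).
Proof. by move=> i j; exact: measurable_cst. Qed.

Lemma mxmeasurableM m n q (F : T -> 'M[R]_(m, n)) (G : T -> 'M[R]_(n, q)) :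
  mxmeasurable F -> mxmeasurable G -> mxmeasurable (fun w => F w *m G w).
Proof.
move=> mF mG i j; under eq_fun do rewrite mxE.
by apply: measurable_sumR => k; exact: measurable_funM.
Qed.

Lemma mxmeasurableD m n (F G : T -> 'M[R]_(m, n)) :
  mxmeasurable F -> mxmeasurable G -> mxmeasurable (fun w => F w + G w).
Proof. by move=> mF mG i j; under eq_fun do rewrite mxE; exact: measurable_funD. Qed.

Lemma mxmeasurableN m n (F : T -> 'M[R]_(m, n)) :
  mxmeasurable F -> mxmeasurable (fun w => - F w).
Proof. by move=> mF i j; under eq_fun do rewrite mxE; exact: measurableT_comp. Qed.

Lemma mxmeasurableZ m n (a : R) (F : T -> 'M[R]_(m, n)) :
  mxmeasurable F -> mxmeasurable (fun w => a *: F w).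
Proof. by move=> mF i j; under eq_fun do rewrite mxE; exact: measurable_funM. Qed.

Lemma mxmeasurable_tr m n (F : T -> 'M[R]_(m, n)) :
  mxmeasurable F -> mxmeasurable (fun w => (F w)^T).
Proof. by move=> mF i j; under eq_fun do rewrite mxE; exact: mF. Qed.

Lemma measurable_trace n (F : T -> 'M[R]_n) :
  mxmeasurable F -> measurable_fun [set: T] (fun w => \tr (F w)).
Proof. by move=> mF; apply: measurable_sumR => i; exact: mF. Qed.

Lemma measurable_det n (F : T -> 'M[R]_n) :
  mxmeasurable F -> measurable_fun [set: T] (fun w => \det (F w)).
Proof.
move=> mF; apply: measurable_sumR => s; apply: measurable_funM => //.
by apply: measurable_prodR => i; exact: mF.
Qed.

(** The inverse is the pointwise limit of the continuous functions x / (x^2 + 1 / (n + 1)), which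
    vanish at 0 in agreement with the convention that the inverse of 0 is 0. *)
Lemma measurable_invr (f : T -> R) :
  measurable_fun [set: T] f -> measurable_fun [set: T] (fun w => (f w)^-1).
Proof.
move=> mf; apply: (@measurableT_comp _ _ _ _ _ _ (fun x : R => x^-1)) => //.
apply: (@measurable_fun_limR R _ _ (fun (n : nat) (x : R) => x * (x ^+ 2 + n.+1%:R^-1)^-1)
  (fun x : R => x^-1)) => [n|x].
  apply: continuous_measurable_fun => x.
  apply: cvgM; first exact: cvg_id.
  apply: cvgV; first by rewrite gt_eqF// ltr_wpDl ?sqr_ge0.
  by apply: cvgD; [exact: exprn_continuous|exact: cvg_cst].
have [->|x0] := eqVneq x 0.
  by rewrite invr0; under eq_fun do rewrite mul0r; exact: cvg_cst.
have -> : x^-1 = x * (x ^+ 2 + 0)^-1 by rewrite addr0; field.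
apply: cvgM; first exact: cvg_cst.
apply: cvgV; first by rewrite addr0 expf_neq0.
by apply: cvgD; [exact: cvg_cst|exact: cvg_harmonic].
Qed.

Lemma mxmeasurable_inv n (F : T -> 'M[R]_n) :
  mxmeasurable F -> (forall w, F w \in unitmx) -> mxmeasurable (fun w => invmx (F w)).
Proof.
move=> mF Fu i j.
have -> : (fun w => invmx (F w) i j) = (fun w => (\det (F w))^-1 *
    ((-1) ^+ (j + i) * \det (row' j (col' i (F w))))).
  by apply/funext => w; rewrite /invmx Fu !mxE.
apply: measurable_funM; first by apply: measurable_invr; exact: measurable_det.
apply: measurable_funM => //; apply: measurable_det => a b.
by under eq_fun do rewrite !mxE; exact: mF.
Qed.

End MeasurableFamilies.

Section DivergenceSums.
Context {R : realType}.

(** The divergence of a field whose differential is D -> A D B; [sum_delta_tr] is the analogue for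
    the transpose of D. The differential of the Wishart field consists of terms of these two
    kinds. *)
Lemma sum_delta (r n : nat) (A : 'M[R]_r) (B : 'M[R]_n) :
  \sum_k \sum_j (A *m delta_mx k j *m B) k j = \tr A * \tr B.
Proof.
rewrite /mxtrace mulr_suml; apply: eq_bigr => k _.
rewrite mulr_sumr; apply: eq_bigr => j _.
rewrite mxE (bigD1 j)//= big1 ?addr0 => [|l lj]; last first.
  rewrite mxE big1 ?mul0r// => a _; rewrite mxE (negbTE lj) andbF mulr0.
  by [].
rewrite mxE (bigD1 k)//= big1 ?addr0 => [|a ak]; last first.
  by rewrite mxE (negbTE ak) mulr0.
by rewrite mxE !eqxx mulr1.
Qed.

Lemma sum_delta_tr (r n : nat) (A B : 'M[R]_(r, n)) :
  \sum_k \sum_j (A *m (delta_mx k j)^T *m B) k j = \tr (A *m B^T).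
Proof.
rewrite /mxtrace; apply: eq_bigr => k _; rewrite [RHS]mxE; apply: eq_bigr => j _.
rewrite trmx_delta mxE (bigD1 k)//= big1 ?addr0 => [|l lk]; last first.
  rewrite mxE big1 ?mul0r// => a _; rewrite mxE (negbTE lk) andbF mulr0.
  by [].
rewrite mxE (bigD1 j)//= big1 ?addr0 => [|a aj]; last first.
  by rewrite mxE (negbTE aj) mulr0.
by rewrite !mxE !eqxx mulr1.
Qed.

End DivergenceSums.

(** * The divergence of the Wishart field *)

Lemma entry_sq_le_gram {R : realType} {m n : nat} (B : 'M[R]_(m, n)) i j :
  B i j ^+ 2 <= (B *m B^T) i i.
Proof.
rewrite mxE (bigD1 j)//= [B^T j i]mxE -expr2 lerDl sumr_ge0// => l _.
by rewrite mxE -expr2 sqr_ge0.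
Qed.

Section WishartField.
Context {R : realType} {r n : nat}.
Variables (C : 'M[R]_n) (A : 'M[R]_r) (e : R).
Hypotheses (As : A^T = A) (Cs : C^T = C) (Ci : C *m C = C) (e0 : 0 < e).

Definition scatter (C : 'M[R]_n) (Y : 'M[R]_(r, n)) : 'M[R]_r := Y *m C *m Y^T.

Lemma scatter_psd Y : psdmx (scatter C Y).
Proof.
rewrite /scatter -(mulmx1 (Y *m C)) -(mulmx1 (Y *m C *m _)).
have := psd_congr (Y *m C) (psd1 (R := R) n).
by rewrite trmx_mul Cs !mulmx1 mulmxA -(mulmxA Y) Ci.
Qed.

Local Notation G Y := (resolvent (scatter C Y) e).
Local Notation U Y := (G Y *m Y *m C).

Definition field (Y : 'M[R]_(r, n)) : 'M[R]_(r, n) := A *m G Y *m A *m U Y.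

Definition dresolvent (Y D : 'M[R]_(r, n)) : 'M[R]_r :=
  - (G Y *m (D *m C *m Y^T + Y *m C *m D^T) *m G Y).

Definition dfield (Y D : 'M[R]_(r, n)) : 'M[R]_(r, n) :=
  A *m dresolvent Y D *m A *m U Y +
  A *m G Y *m A *m ((dresolvent Y D *m Y + G Y *m D) *m C).

Let Gs Y : (G Y)^T = G Y.
Proof. by apply: resolvent_tr => //; exact: scatter_psd. Qed.

Lemma resolvent_bounded S (Y : S -> 'M[R]_(r, n)) : mxbounded (fun s => G (Y s)).
Proof.
exists e^-1 => s i j; rewrite -(ler_pM2l e0) mulfV ?gt_eqF//.
by apply: resolvent_entry_le => //; exact: scatter_psd.
Qed.

Let UUT Y : U Y *m (U Y)^T = G Y - e *: (G Y *m G Y).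
Proof.
rewrite -sandwich_resolvent//; last exact: scatter_psd.
by rewrite !trmx_mul Cs Gs /scatter !mulmxA -(mulmxA _ C C) Ci.
Qed.

(** Because C is idempotent, the Gram matrix of U is G W G = G - e G^2, whose diagonal is at most 1
    / e; an entry x with x^2 <= 1 / e satisfies |x| <= 1 + 1 / e. *)
Lemma U_bounded S (Y : S -> 'M[R]_(r, n)) : mxbounded (fun s => U (Y s)).
Proof.
exists (1 + e^-1) => s i j; set y := Y s.
have Gp := resolvent_psd (scatter_psd y) e0.
have : U y i j ^+ 2 <= e^-1.
  apply: le_trans (entry_sq_le_gram _ _ _) _.
  apply: (@le_trans _ _ (G y i i)).
    rewrite UUT mxE [X in _ + X]mxE [X in _ - X]mxE gerBl mulr_ge0 ?(ltW e0)//.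
    rewrite mxE sumr_ge0// => l _.
    by rewrite (resolvent_sym (scatter_psd y) e0) -expr2 sqr_ge0.
  rewrite -(ler_pM2l e0) mulfV ?gt_eqF//.
  by apply: resolvent_diag_le => //; exact: scatter_psd.
have := sqr_ge0 (`|U y i j| - 1); rewrite -(real_normK (num_real (U y i j))).
have := normr_ge0 (U y i j); nra.
Qed.

Let V Y := C *m Y^T *m G Y *m Y *m C.

Let trV Y : \tr (V Y) = r%:R - e * \tr (G Y).
Proof.
rewrite /V mxtrace_mulC !mulmxA Ci mxtrace_mulC !mulmxA.
rewrite -[Y *m C *m Y^T]/(scatter C Y).
rewrite mul_resolvent//; last exact: scatter_psd.
by rewrite linearB linearZ /= mxtrace1.
Qed.

(** V is positive semidefinite with trace tr(W G) = r - e tr G, and the trace bounds every entry. *)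
Lemma V_bounded S (Y : S -> 'M[R]_(r, n)) : mxbounded (fun s => V (Y s)).
Proof.
exists r%:R => s i j.
have Vp : psdmx (V (Y s)).
  have := psd_congr (C *m (Y s)^T) (resolvent_psd (scatter_psd (Y s)) e0).
  by rewrite trmx_mul trmxK Cs !mulmxA.
apply: le_trans (psd_entry_le i j Vp) _; rewrite trV gerBl mulr_ge0 ?(ltW e0)//.
by apply: psd_trace_ge0; apply: resolvent_psd => //; exact: scatter_psd.
Qed.

Lemma field_bounded S (Y : S -> 'M[R]_(r, n)) : mxbounded (fun s => field (Y s)).
Proof.
apply: mxboundedM; last exact: U_bounded.
apply: mxboundedM; last exact: mxbounded_cst.
by apply: mxboundedM; [exact: mxbounded_cst|exact: resolvent_bounded].
Qed.

(** Every Y is absorbed into U or V, which are bounded although Y is not. Each term moreover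
    contains D or its transpose exactly once between two fixed matrices, so the divergence can be
    read off. *)
Lemma dfieldE Y D : dfield Y D =
  - (A *m G Y *m D *m ((U Y)^T *m A *m U Y))
  - (A *m U Y *m D^T *m (G Y *m A *m U Y))
  - (A *m G Y *m A *m G Y *m D *m V Y)
  - (A *m G Y *m A *m U Y *m D^T *m U Y)
  + A *m G Y *m A *m G Y *m D *m C.
Proof.
have dE : dresolvent Y D = - (G Y *m D *m (U Y)^T) - U Y *m D^T *m G Y.
  by rewrite /dresolvent !trmx_mul Cs Gs mulmxDr mulmxDl opprD !mulmxA.
have UY : (U Y)^T *m Y *m C = V Y by rewrite !trmx_mul Cs Gs !mulmxA.
rewrite /dfield dE -UY; set g := G Y; set u := U Y.
have E1 : A *m (- (g *m D *m u^T) - u *m D^T *m g) *m A *m u =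
   - (A *m g *m D *m (u^T *m A *m u)) - A *m u *m D^T *m (g *m A *m u).
  by rewrite mulmxBr mulmxN !mulmxBl !mulNmx !mulmxA.
have E2 : A *m g *m A *m (((- (g *m D *m u^T) - u *m D^T *m g) *m Y + g *m D) *m C) =
   - (A *m g *m A *m g *m D *m (u^T *m Y *m C)) - A *m g *m A *m u *m D^T *m u +
   A *m g *m A *m g *m D *m C.
  have -> : u = g *m Y *m C by [].
  by rewrite !(mulmxDl, mulNmx, mulmxDr, mulmxN) !mulmxA.
by rewrite E1 E2 !addrA.
Qed.

(** The coefficient collects tr C from the term ending in C, - r from the one in V, and - 1 from
    each of two terms in the transpose of D. The remaining term gives the squared trace. All
    corrections in e come from U U^T = G - e G^2 and tr V = r - e tr G. *)
Lemma divergence_field Y :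
  \sum_k \sum_j dfield Y (delta_mx k j) k j =
  (\tr C - r%:R - 2) * \tr (A *m G Y *m A *m G Y) - \tr (A *m G Y) ^+ 2
  + e * (\tr (A *m G Y) * \tr (A *m (G Y *m G Y)) + 2 * \tr (A *m (G Y *m G Y) *m A *m G Y)
         + \tr (A *m G Y *m A *m G Y) * \tr (G Y)).
Proof.
have E k j : dfield Y (delta_mx k j) k j =
  - (A *m G Y *m delta_mx k j *m ((U Y)^T *m A *m U Y)) k j
  - (A *m U Y *m (delta_mx k j)^T *m (G Y *m A *m U Y)) k j
  - (A *m G Y *m A *m G Y *m delta_mx k j *m V Y) k j
  - (A *m G Y *m A *m U Y *m (delta_mx k j)^T *m U Y) k j
  + (A *m G Y *m A *m G Y *m delta_mx k j *m C) k j.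
  rewrite dfieldE.
  have D (M N : 'M[R]_(r, n)) : (M + N) k j = M k j + N k j by rewrite mxE.
  have O (M : 'M[R]_(r, n)) : (- M) k j = - M k j by rewrite mxE.
  by rewrite !D !O.
under eq_bigr do under eq_bigr do rewrite E.
under eq_bigr do rewrite !big_split /= !sumrN.
rewrite !big_split /= !sumrN !sum_delta !sum_delta_tr trV.
set g := G Y.
have T1 : \tr ((U Y)^T *m A *m U Y) = \tr (A *m g) - e * \tr (A *m (g *m g)).
  rewrite -(mulmxA _ A (U Y)) mxtrace_mulC -(mulmxA A (U Y)) UUT mulmxBr -scalemxAr.
  by rewrite linearB linearZ.
have T2 : \tr (A *m U Y *m (g *m A *m U Y)^T) =
    \tr (A *m g *m A *m g) - e * \tr (A *m (g *m g) *m A *m g).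
  rewrite trmx_mul (trmx_mul g A) As Gs -(mulmxA A (U Y)) (mulmxA (U Y)) UUT.
  rewrite mulmxBl mulmxBr -scalemxAl -scalemxAr linearB linearZ /=.
  by rewrite !mulmxA.
have T4 : \tr (A *m g *m A *m U Y *m (U Y)^T) =
    \tr (A *m g *m A *m g) - e * \tr (A *m (g *m g) *m A *m g).
  rewrite -(mulmxA (A *m g *m A) (U Y)) UUT mulmxBr -scalemxAr linearB linearZ /=.
  by congr (_ - e * _); rewrite -(mulmxA (A *m g) A) mxtrace_mulC (mulmxA _ A g).
rewrite T1 T2 T4; ring.
Qed.


Lemma dfield_bounded S (Y : S -> 'M[R]_(r, n)) (D : 'M[R]_(r, n)) :
  mxbounded (fun s => dfield (Y s) D).
Proof.
have cst m q (M : 'M[R]_(m, q)) : mxbounded (fun _ : S => M) by exact: mxbounded_cst.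
have bG := resolvent_bounded Y; have bU := U_bounded Y; have bV := V_bounded Y.
have bUT := mxbounded_tr bU.
have -> : (fun s => dfield (Y s) D) = (fun s =>
  - (A *m G (Y s) *m D *m ((U (Y s))^T *m A *m U (Y s)))
  - (A *m U (Y s) *m D^T *m (G (Y s) *m A *m U (Y s)))
  - (A *m G (Y s) *m A *m G (Y s) *m D *m V (Y s))
  - (A *m G (Y s) *m A *m U (Y s) *m D^T *m U (Y s))
  + A *m G (Y s) *m A *m G (Y s) *m D *m C).
  by apply/funext => s; exact: dfieldE.
have bAG := mxboundedM (cst _ _ A) bG; have bAGA := mxboundedM bAG (cst _ _ A).
have bAGAGD := mxboundedM (mxboundedM bAGA bG) (cst _ _ D).
have b1 := mxboundedM (mxboundedM bAG (cst _ _ D)) (mxboundedM (mxboundedM bUT (cst _ _ A)) bU).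
have b2 := mxboundedM (mxboundedM (mxboundedM (cst _ _ A) bU) (cst _ _ D^T))
  (mxboundedM (mxboundedM bG (cst _ _ A)) bU).
have b3 := mxboundedM bAGAGD bV.
have b4 := mxboundedM (mxboundedM (mxboundedM bAGA bU) (cst _ _ D^T)) bU.
have b5 := mxboundedM bAGAGD (cst _ _ C).
have := mxboundedD (mxboundedN b1) (mxboundedN b2).
by move=> /mxboundedD /(_ (mxboundedN b3)) /mxboundedD /(_ (mxboundedN b4)) /mxboundedD /(_ b5).
Qed.

Lemma mxmeasurable_resolvent {d} {T : measurableType d} (Y : T -> 'M[R]_(r, n)) :
  mxmeasurable Y -> mxmeasurable (fun w => G (Y w)).
Proof.
move=> mY; apply: mxmeasurable_inv => [|w]; last first.
  by apply: shift_unitmx => //; exact: scatter_psd.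
apply: mxmeasurableD; last exact: mxmeasurable_cst.
apply: mxmeasurableM; last exact: mxmeasurable_tr.
by apply: mxmeasurableM => //; exact: mxmeasurable_cst.
Qed.

Lemma mxmeasurable_field {d} {T : measurableType d} (Y : T -> 'M[R]_(r, n)) :
  mxmeasurable Y -> mxmeasurable (fun w => field (Y w)).
Proof.
move=> mY; have mG := mxmeasurable_resolvent mY.
have cst m q (M : 'M[R]_(m, q)) : mxmeasurable (fun _ : T => M) by exact: mxmeasurable_cst.
have mAGA := mxmeasurableM (mxmeasurableM (cst _ _ A) mG) (cst _ _ A).
exact: (mxmeasurableM mAGA (mxmeasurableM (mxmeasurableM mG mY) (cst _ _ C))).
Qed.

Lemma mxmeasurable_dfield {d} {T : measurableType d} (Y : T -> 'M[R]_(r, n)) D :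
  mxmeasurable Y -> mxmeasurable (fun w => dfield (Y w) D).
Proof.
move=> mY; have mG := mxmeasurable_resolvent mY.
have cst m q (M : 'M[R]_(m, q)) : mxmeasurable (fun _ : T => M) by exact: mxmeasurable_cst.
have mS := mxmeasurableD (mxmeasurableM (cst _ _ (D *m C)) (mxmeasurable_tr mY))
  (mxmeasurableM (mxmeasurableM mY (cst _ _ C)) (cst _ _ D^T)).
have mdG := mxmeasurableN (mxmeasurableM (mxmeasurableM mG mS) mG).
have mU := mxmeasurableM (mxmeasurableM mG mY) (cst _ _ C).
have m1 := mxmeasurableM (mxmeasurableM (mxmeasurableM (cst _ _ A) mdG) (cst _ _ A)) mU.
have m2 := mxmeasurableM (mxmeasurableM (mxmeasurableM (cst _ _ A) mG) (cst _ _ A))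
  (mxmeasurableM (mxmeasurableD (mxmeasurableM mdG mY) (mxmeasurableM mG (cst _ _ D))) (cst _ _ C)).
exact: (mxmeasurableD m1 m2).
Qed.

Lemma mxderive_resolvent (M D : 'M[R]_(r, n)) t :
  mxderive (fun t => G (M + t *: D)) t (dresolvent (M + t *: D) D).
Proof.
have [K GK] := resolvent_bounded (fun t => M + t *: D).
have dL := mxderive_line M D t.
apply: (mxderive_inv _ _ GK) => [|u]; last first.
  by apply: shift_unitmx => //; exact: scatter_psd.
have dW := mxderiveM (mxderiveM dL (mxderive_cst C t)) (mxderive_tr dL).
have := mxderiveD dW (mxderive_cst e%:M t).
by rewrite mulmx0 !addr0.
Qed.

Lemma mxderive_field (M D : 'M[R]_(r, n)) t :
  mxderive (fun t => field (M + t *: D)) t (dfield (M + t *: D) D).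
Proof.
have dL := mxderive_line M D t; have dG := mxderive_resolvent M D t.
have dA := mxderive_cst A t.
have dU := mxderiveM (mxderiveM dG dL) (mxderive_cst C t).
have := mxderiveM (mxderiveM (mxderiveM dA dG) dA) dU.
by rewrite !mul0mx !mulmx0 !addr0 !add0r.
Qed.

Lemma continuous_dfield (M D : 'M[R]_(r, n)) i j :
  continuous (fun t : R => dfield (M + t *: D) D i j).
Proof.
move=> t; have FF := nbhs_filter t.
have cL := mxderive_cvg (mxderive_line M D t).
have cG := mxderive_cvg (mxderive_resolvent M D t).
have cst m q (N : 'M[R]_(m, q)) : mxcvg (nbhs t) (fun=> N) N by exact: mxcvg_cst.
have cS := mxcvgD (FF := FF) (mxcvgM (FF := FF) (cst _ _ (D *m C)) (mxcvg_tr cL))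
  (mxcvgM (FF := FF) (mxcvgM (FF := FF) cL (cst _ _ C)) (cst _ _ D^T)).
have cdG := mxcvgN (FF := FF) (mxcvgM (FF := FF) (mxcvgM (FF := FF) cG cS) cG).
have cU := mxcvgM (FF := FF) (mxcvgM (FF := FF) cG cL) (cst _ _ C).
have c1 := mxcvgM (FF := FF) (mxcvgM (FF := FF) (mxcvgM (FF := FF) (cst _ _ A) cdG) (cst _ _ A)) cU.
have c2 := mxcvgM (FF := FF) (mxcvgM (FF := FF) (mxcvgM (FF := FF) (cst _ _ A) cG) (cst _ _ A))
  (mxcvgM (FF := FF) (mxcvgD (FF := FF) (mxcvgM (FF := FF) cdG cL) (mxcvgM (FF :=
    FF) cG (cst _ _ D))) (cst _ _ C)).
exact: (mxcvgD (FF := FF) c1 c2).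
Qed.

End WishartField.

(** * Moments of the inverse Wishart matrix *)

Section Centering.
Context {R : realType} (n : nat).

Definition centering : 'M[R]_n := 1%:M - const_mx n%:R^-1.

Lemma centering_tr : centering^T = centering.
Proof. by rewrite /centering linearB /= trmx1 trmx_const. Qed.

Lemma const_centering m (u : 'cV[R]_m) : (u *m (const_mx 1 : 'rV[R]_n)) *m centering = 0.
Proof.
rewrite mulmxBr mulmx1; apply/eqP; rewrite subr_eq0; apply/eqP/matrixP => i j.
rewrite mxE big_ord1 !mxE mulr1.
rewrite (eq_bigr (fun=> u i 0 * n%:R^-1)) => [|k _]; last first.
  by rewrite !mxE big_ord1 !mxE mulr1.
have n0 : n%:R != 0 :> R by rewrite pnatr_eq0 -lt0n; case: n j => [[]//|].
by rewrite sumr_const card_ord -[RHS]mulr_natr mulfVK.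
Qed.

Lemma centering_idem : centering *m centering = centering.
Proof.
have cE : (const_mx n%:R^-1 : 'M[R]_n) = const_mx n%:R^-1 *m (const_mx 1 : 'rV[R]_n).
  by apply/matrixP => i j; rewrite !mxE big_ord1 !mxE mulr1.
by rewrite {1}/centering mulmxBl mul1mx cE const_centering subr0.
Qed.

Lemma trace_centering : (0 < n)%N -> \tr centering = n%:R - 1.
Proof.
move=> n0; rewrite linearB /= mxtrace1; congr (_ - _).
rewrite /mxtrace; under eq_bigr do rewrite mxE.
by rewrite sumr_const card_ord -[LHS]mulr_natr mulVf// pnatr_eq0 -lt0n.
Qed.

Lemma scatter_gram m (F : 'M[R]_(m, n)) :
  scatter centering F = (F *m centering) *m (F *m centering)^T.
Proof.
by rewrite /scatter trmx_mul centering_tr mulmxA -(mulmxA _ centering centering) centering_idem.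
Qed.

End Centering.

Section WishartExpectation.
Context {R : realType} {d : measure_display} {T : measurableType d}.
Context {n r : nat}.
Variables (P : probability T R) (X : 'I_n -> T -> 'cV[R]_r).
Variables (mu : 'cV[R]_r) (Sigma : 'M[R]_r).
Hypotheses (XN : iid_normal P X mu Sigma) (Sp : psdmx Sigma) (Su : Sigma \in unitmx).
Hypothesis n0 : (0 < n)%N.

Local Notation C := (centering n : 'M[R]_n).
Let Cs : C^T = C := centering_tr n.
Let Ci : C *m C = C := centering_idem n.
Let Y (w : T) := data_mx (fun j => X j w).
Local Notation W w := (scatter C (Y w)).
Local Notation G e w := (resolvent (scatter C (Y w)) e).

Lemma mxmeasurable_data : mxmeasurable Y.
Proof.
move=> i j; rewrite /Y /data_mx; under eq_fun do rewrite mxE.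
by have [/(_ j) + _] := XN; exact: multinormal_measurable_entry.
Qed.

Let mxmeasurable_id : mxmeasurable (fun M : orthant_mx r n => M : 'M[R]_(r, n)).
Proof. by move=> i j; exact: measurable_entry. Qed.

(** Stein's identity summed over all entries of the field. The scores assemble into Sigma^-1 (Y - mu
    1^T), and the mean disappears because the field ends in C, which annihilates constant rows. *)
Lemma stein_haff (A : 'M[R]_r) (e : R) : A^T = A -> 0 < e ->
  \int[P]_w ((n%:R - r%:R - 3) * \tr (A *m G e w *m A *m G e w) - \tr (A *m G e w) ^+ 2
    + e * (\tr (A *m G e w) * \tr (A *m (G e w *m G e w))
           + 2 * \tr (A *m (G e w *m G e w) *m A *m G e w)
           + \tr (A *m G e w *m A *m G e w) * \tr (G e w))
    - \tr (A *m G e w *m A *m G e w *m W w *m invmx Sigma)) = 0.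
Proof.
move=> As e0.
have [K fK] := field_bounded A Cs Ci e0 (fun M : 'M[R]_(r, n) => M).
have st k j : P.-integrable [set: T] (EFin \o (fun w =>
    (invmx Sigma *m (X j w - mu)) k 0 * field C A e (Y w) k j)) /\
    \int[P]_w ((invmx Sigma *m (X j w - mu)) k 0 * field C A e (Y w) k j) =
    \int[P]_w dfield C A e (Y w) (delta_mx k j) k j.
  have [L gL] := dfield_bounded A Cs Ci e0 (fun M : 'M[R]_(r, n) => M) (delta_mx k j).
  apply: (iid_normal_stein XN Sp Su (f := fun M => field C A e M k j)
    (g := fun M => dfield C A e M (delta_mx k j) k j) (K := Num.max K L)).
  - exact: (mxmeasurable_field A Cs Ci e0 mxmeasurable_id k j).
  - exact: (mxmeasurable_dfield A Cs Ci e0 (delta_mx k j) mxmeasurable_id k j).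
  - by move=> M; rewrite le_max fK.
  - by move=> M; rewrite le_max gL orbT.
  - by move=> M t; exact: (mxderive_field A Cs Ci e0 M (delta_mx k j) t k j).
  - by move=> M; apply: continuous_dfield.
have idf k j : P.-integrable [set: T]
    (EFin \o (fun w => dfield C A e (Y w) (delta_mx k j) k j)).
  have [L gL] := dfield_bounded A Cs Ci e0 Y (delta_mx k j).
  apply: (@bounded_integrable _ _ _ P _ L) => [|w]; last exact: gL.
  exact: (mxmeasurable_dfield A Cs Ci e0 (delta_mx k j) mxmeasurable_data k j).
pose h k j w := dfield C A e (Y w) (delta_mx k j) k j -
  (invmx Sigma *m (X j w - mu)) k 0 * field C A e (Y w) k j.
have ih k j : P.-integrable [set: T] (EFin \o h k j).
  rewrite /h /comp; under eq_fun do rewrite EFinB.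
  by apply: integrableB => //; [exact: idf|have [] := st k j].
have h0 k j : \int[P]_w h k j w = 0.
  have [i1 E1] := st k j.
  by rewrite RintegralB// E1 subrr.
transitivity (\int[P]_w (\sum_(k < r) \sum_(j < n) h k j w)); last first.
  rewrite Rintegral_sum => [|k _].
    by rewrite big1// => k _; rewrite Rintegral_sum ?big1.
  rewrite /comp; under eq_fun do rewrite -sumEFin.
  by apply: integrable_sum => // j _; exact: ih.
apply: eq_Rintegral => w _.
rewrite /h; under [RHS]eq_bigr do rewrite sumrB.
rewrite sumrB divergence_field// trace_centering//; congr (_ - _).
  by congr (_ * _ - _ + _); ring.
pose M := mu *m (const_mx 1 : 'rV[R]_n).
have -> : \sum_(k < r) \sum_(j < n) (invmx Sigma *m (X j w - mu)) k 0 * field C A e (Y w) k j =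
    \tr (field C A e (Y w) *m (invmx Sigma *m (Y w - M))^T).
  rewrite /mxtrace; apply: eq_bigr => k _; rewrite [RHS]mxE; apply: eq_bigr => j _.
  rewrite mulrC; congr (_ * _); rewrite [RHS]mxE !mxE; apply: eq_bigr => l _.
  by congr (_ * _); rewrite !mxE big_ord1 !mxE mulr1.
have Ss : Sigma^T = Sigma by case: Sp.
rewrite trmx_mul trmx_inv Ss /field !mulmxA; congr (\tr (_ *m _)).
have -> : (Y w - M)^T = (Y w)^T - M^T by rewrite linearB.
rewrite (mulmxBr _ (Y w)^T).
have CM : C *m M^T = 0 by rewrite -[C in LHS]Cs -trmx_mul const_centering trmx0.
by rewrite -(mulmxA _ C M^T) CM mulmx0 subr0.
Qed.

End WishartExpectation.

(** * Fatou's lemma and bounded measurable functions *)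

Section Integrals.
Context {R : realType} {d : measure_display} {T : measurableType d}.

Lemma integrable_fatou (mu : {measure set T -> \bar R}) (F : nat -> T -> R) (f : T -> R) (K : R) :
  (forall n, mu.-integrable [set: T] (EFin \o F n)) -> (forall n x, 0 <= F n x) ->
  (forall n, \int[mu]_x F n x <= K) -> (forall x, F ^~ x @ \oo --> f x) ->
  mu.-integrable [set: T] (EFin \o f).
Proof.
move=> iF F0 FK Ff.
have mF n : measurable_fun [set: T] (F n).
  by apply/measurable_EFinP; exact: (measurable_int _ (iF n)).
have f0 x : 0 <= f x.
  by rewrite -(cvg_lim (@Rhausdorff R) (Ff x)); apply: limr_ge; [apply/cvg_ex;
    exists (f x)|exact: nearW].
have mf : measurable_fun [set: T] f by exact: (measurable_fun_limR mF Ff).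
apply/integrableP; split; first exact/measurable_EFinP.
under eq_integral do rewrite /= ger0_norm//.
have Fat := @fatou _ _ _ mu _ measurableT (fun n => EFin \o F n)
  (fun n => proj2 (measurable_EFinP _ _) (mF n)) (fun n x _ => F0 n x).
apply: (@le_lt_trans _ _ K%:E); last exact: ltry.
have -> : (\int[mu]_x (f x)%:E = \int[mu]_x limn_einf (fun n => (F n x)%:E))%E.
  apply: eq_integral => x _; have /cvg_limn_einf_sup [-> _]// : (fun n =>
    (F n x)%:E) @ \oo --> (f x)%:E.
  by apply: cvg_EFin; [exact: nearW|exact: Ff].
apply: (le_trans Fat); rewrite limn_einf_lim.
apply: lime_le; first exact: is_cvg_einfs.
apply: nearW => n; apply: (@le_trans _ _ (\int[mu]_x (F n x)%:E)%E).
  by apply: ereal_inf_lbound; exists n => //=.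
have := FK n; rewrite /Rintegral -lee_fin fineK//.
exact: integrable_fin_num (iF n).
Qed.

Definition bounded_real {S : Type} (f : S -> R) := exists K, forall s, `|f s| <= K.

Lemma bounded_cst S (k : R) : bounded_real (fun _ : S => k).
Proof. by exists `|k|. Qed.

Lemma boundedD S (f g : S -> R) :
  bounded_real f -> bounded_real g -> bounded_real (fun s => f s + g s).
Proof.
move=> [K fK] [L gL]; exists (K + L) => s.
by apply: le_trans (ler_normD _ _) _; rewrite lerD.
Qed.

Lemma boundedN S (f : S -> R) : bounded_real f -> bounded_real (fun s => - f s).
Proof. by move=> [K fK]; exists K => s; rewrite normrN. Qed.

Lemma boundedM S (f g : S -> R) :
  bounded_real f -> bounded_real g -> bounded_real (fun s => f s * g s).
Proof. by move=> [K fK] [L gL]; exists (K * L) => s; rewrite normrM ler_pM. Qed.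

Definition bmeas (f : T -> R) := measurable_fun [set: T] f /\ bounded_real f.

Lemma bmeas_cst k : bmeas (fun=> k).
Proof. by split; [exact: measurable_cst|exact: bounded_cst]. Qed.

Lemma bmeasD f g : bmeas f -> bmeas g -> bmeas (fun w => f w + g w).
Proof. by move=> [mf bf] [mg bg]; split; [exact: measurable_funD|exact: boundedD]. Qed.

Lemma bmeasM f g : bmeas f -> bmeas g -> bmeas (fun w => f w * g w).
Proof. by move=> [mf bf] [mg bg]; split; [exact: measurable_funM|exact: boundedM]. Qed.

Lemma bmeasB f g : bmeas f -> bmeas g -> bmeas (fun w => f w - g w).
Proof.
move=> [mf bf] [mg bg]; split; first exact: measurable_funB.
by apply: boundedD => //; exact: boundedN.
Qed.

Lemma bmeasX f m : bmeas f -> bmeas (fun w => f w ^+ m).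
Proof.
move=> bf; elim: m => [|m IH]; first by under eq_fun do rewrite expr0; exact: bmeas_cst.
by under eq_fun do rewrite exprS; exact: bmeasM.
Qed.

Lemma bmeas_trace m (F : T -> 'M[R]_m) : mxmeasurable F -> mxbounded F ->
  bmeas (fun w => \tr (F w)).
Proof. by move=> mF bF; split; [exact: measurable_trace|exact: mxbounded_trace]. Qed.

Lemma bmeas_integrable (P : probability T R) f : bmeas f -> P.-integrable [set: T] (EFin \o f).
Proof. by move=> [mf [K fK]]; exact: bounded_integrable fK. Qed.

End Integrals.

Section DeltaTrace.
Context {R : realType} {r : nat}.
Implicit Types B D : 'M[R]_r.

Lemma trace_delta k B : \tr (delta_mx k k *m B) = B k k.
Proof.
rewrite -(mul_delta_mx (0 : 'I_1)) -mulmxA mxtrace_mulC -rowE.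
by rewrite trace_mx11 -colE !mxE.
Qed.

Lemma trace_delta2 k B D : \tr (delta_mx k k *m B *m delta_mx k k *m D) = B k k * D k k.
Proof.
rewrite -!mulmxA trace_delta -(mul_delta_mx (0 : 'I_1)) -(mulmxA _ _ D) -rowE mulmxA -colE.
by rewrite mxE big_ord1 !mxE.
Qed.

End DeltaTrace.

Section WishartMoments.
Context {R : realType} {d : measure_display} {T : measurableType d}.
Context {n r : nat}.
Variables (P : probability T R) (X : 'I_n -> T -> 'cV[R]_r).
Variables (mu : 'cV[R]_r) (Sigma : 'M[R]_r).
Hypotheses (XN : iid_normal P X mu Sigma) (Sp : psdmx Sigma) (Su : Sigma \in unitmx).
Hypothesis hrn : (r + 5 <= n)%N.

Local Notation C := (centering n : 'M[R]_n).
Let Cs : C^T = C := centering_tr n.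
Let Ci : C *m C = C := centering_idem n.
Let Y (w : T) := data_mx (fun j => X j w).
Local Notation W w := (scatter C (Y w)).
Local Notation G e w := (resolvent (scatter C (Y w)) e).

Let n0 : (0 < n)%N.
Proof. by apply: leq_trans hrn; rewrite addnS. Qed.

Let nr5 : 5 <= n%:R - r%:R :> R.
Proof. by rewrite lerBrDl -natrD ler_nat. Qed.

Let Wpsd w : psdmx (W w) := scatter_psd Cs Ci (Y w).

Let mG (e : R) : 0 < e -> mxmeasurable (fun w => G e w).
Proof. by move=> e0; apply: mxmeasurable_resolvent => //; exact: mxmeasurable_data XN. Qed.

Let bG (e : R) : 0 < e -> mxbounded (fun w => G e w).
Proof. by move=> e0; exact: resolvent_bounded. Qed.

Let bmG (e : R) k l : 0 < e -> bmeas (fun w => G e w k l).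
Proof.
move=> e0; split; first exact: mG.
by have [K GK] := bG e0; exists K => w.
Qed.

(** Take A = E_kk in [stein_haff]. With g = G_kk and h = ((1 - e G) Sigma^-1)_kk it reads
    E[(n - r - 4) g^2 + (nonnegative) - g h] = 0. Since n - r - 4 >= 1, |h| <= K and g h <= (g^2 +
    K^2) / 2, it follows that E g^2 <= K^2. *)
Lemma resolvent_diag_sq_bound :
  exists K, forall (e : R) k, 0 < e -> \int[P]_w (G e w k k ^+ 2) <= K.
Proof.
(* Indexing the family by e as well as by the sample point makes its bound uniform in e. *)
pose H (s : T * {e : R | 0 < e}) := (1%:M - sval s.2 *: G (sval s.2) s.1) *m invmx Sigma.
have [K HK] : mxbounded H.
  apply: mxboundedM; last exact: mxbounded_cst.
  apply: mxboundedD; first exact: mxbounded_cst.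
  apply: mxboundedN; exists 1 => -[w [e e0]] i j /=.
  by rewrite mxE normrM gtr0_norm// resolvent_entry_le.
exists (K ^+ 2) => e k e0.
have ds : (delta_mx k k : 'M[R]_r)^T = delta_mx k k by rewrite trmx_delta.
have S0 := stein_haff XN Sp Su n0 ds e0.
set F := (F in Rintegral _ _ F) in S0.
have FE w : F w = (n%:R - r%:R - 4) * G e w k k ^+ 2
    + e * (3 * (G e w k k * (G e w *m G e w) k k) + G e w k k ^+ 2 * \tr (G e w))
    - G e w k k * ((1%:M - e *: G e w) *m invmx Sigma) k k.
  rewrite /F !trace_delta !trace_delta2.
  have -> : delta_mx k k *m G e w *m delta_mx k k *m G e w *m W w *m invmx Sigma =
     delta_mx k k *m G e w *m delta_mx k k *m ((1%:M - e *: G e w) *m invmx Sigma).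
    by rewrite -resolvent_mul// !mulmxA.
  by rewrite trace_delta2; ring.
move: (F) FE S0 => {}F FE S0.
have bF : bmeas F.
  have bT := bmeas_trace (mG e0) (bG e0).
  have bg := bmG k k e0.
  have bGG : bmeas (fun w => (G e w *m G e w) k k).
    split; first by apply: mxmeasurableM; exact: mG.
    by have [L GL] := mxboundedM (bG e0) (bG e0); exists L => w.
  have bH : bmeas (fun w => ((1%:M - e *: G e w) *m invmx Sigma) k k).
    split; last by exists K => w; exact: (HK (w, exist _ e e0)).
    apply: mxmeasurableM; last exact: mxmeasurable_cst.
    apply: mxmeasurableD; first exact: mxmeasurable_cst.
    by apply: mxmeasurableN; apply: mxmeasurableZ; exact: mG.
  rewrite (funext FE); apply: bmeasB; last exact: bmeasM.
  apply: bmeasD; first by apply: bmeasM; [exact: bmeas_cst|exact: bmeasX].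
  apply: bmeasM; first exact: bmeas_cst.
  apply: bmeasD; last by apply: bmeasM => //; exact: bmeasX.
  by apply: bmeasM; [exact: bmeas_cst|exact: bmeasM].
have bD : bmeas (fun w => 2^-1 * G e w k k ^+ 2 - 2^-1 * K ^+ 2).
  apply: bmeasB; last exact: bmeas_cst.
  by apply: bmeasM; [exact: bmeas_cst|apply: bmeasX; exact: bmG].
have : \int[P]_w (2^-1 * G e w k k ^+ 2 - 2^-1 * K ^+ 2) <= 0.
  rewrite -S0; apply: le_Rintegral => //; [exact: bmeas_integrable|exact: bmeas_integrable|].
  move=> w _; rewrite FE.
  have Gp := resolvent_psd (Wpsd w) e0.
  have := HK (w, exist _ e e0) k k; rewrite /H /=.
  have := psd_diag_ge0 k Gp; have := psd_trace_ge0 Gp.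
  have : 0 <= (G e w *m G e w) k k.
    rewrite mxE sumr_ge0// => j _; rewrite [X in X * _]resolvent_sym//.
    by rewrite -expr2 sqr_ge0.
  set g := G e w k k; set h := (_ *m invmx Sigma) k k; set q := (G e w *m G e w) k k.
  set t := \tr _ => q0 t0 g0 hK.
  have pos : 0 <= e * (3 * (g * q) + g ^+ 2 * t).
    by rewrite mulr_ge0 ?(ltW e0)// addr_ge0// ?mulr_ge0// sqr_ge0.
  have nr : g ^+ 2 <= (n%:R - r%:R - 4) * g ^+ 2.
    by rewrite ler_peMl ?sqr_ge0//; move: nr5; lra.
  have gh : g * h <= 2^-1 * g ^+ 2 + 2^-1 * K ^+ 2.
    apply: (@le_trans _ _ (g * K)).
      by rewrite ler_wpM2l// (le_trans _ hK)// ler_norm.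
    have := sqr_ge0 (g - K); rewrite sqrrB -mulr_natr; lra.
  lra.
rewrite RintegralB//; last 2 first.
- by apply: bmeas_integrable; apply: bmeasM; [exact: bmeas_cst|apply: bmeasX; exact: bmG].
- by apply: bmeas_integrable; exact: bmeas_cst.
rewrite Rintegral_prob_cst RintegralZl//; last first.
  by apply: bmeas_integrable; apply: bmeasX; exact: bmG.
lra.
Qed.

Lemma resolvent_trace_sq_bound :
  exists K, 0 <= K /\ forall e : R, 0 < e -> \int[P]_w (\tr (G e w) ^+ 2) <= K.
Proof.
have [K GK] := resolvent_diag_sq_bound.
(* The absolute value supplies the nonnegativity that K is not known to have. *)
exists (\sum_(i < r) \sum_(j < r) `|K|); split.
  by apply: sumr_ge0 => i _; exact: sumr_ge0.
move=> e e0.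
have bs k : bmeas (fun w => 2^-1 * G e w k k ^+ 2).
  by apply: bmeasM; [exact: bmeas_cst|apply: bmeasX; exact: bmG].
apply: (@le_trans _ _ (\int[P]_w \sum_(i < r) \sum_(j < r)
    (2^-1 * G e w i i ^+ 2 + 2^-1 * G e w j j ^+ 2))).
  apply: le_Rintegral => //.
  - by apply: bmeas_integrable; apply: bmeasX; apply: bmeas_trace; [exact: mG|exact: bG].
  - rewrite /comp; under eq_fun do rewrite -sumEFin; apply: integrable_sum => // i _.
    under eq_fun do rewrite -sumEFin; apply: integrable_sum => // j _.
    by apply: bmeas_integrable; exact: bmeasD.
  - move=> w _; rewrite /mxtrace expr2 mulr_suml; apply: ler_sum => i _.
    rewrite mulr_sumr; apply: ler_sum => j _.
    by have := sqr_ge0 (G e w i i - G e w j j); rewrite sqrrB -mulr_natr; lra.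
rewrite Rintegral_sum => [|i _]; last first.
  rewrite /comp; under eq_fun do rewrite -sumEFin; apply: integrable_sum => // j _.
  by apply: bmeas_integrable; exact: bmeasD.
apply: ler_sum => i _; rewrite Rintegral_sum => [|j _]; last first.
  by apply: bmeas_integrable; exact: bmeasD.
apply: ler_sum => j _.
rewrite RintegralD//; [|exact: bmeas_integrable|exact: bmeas_integrable].
rewrite !RintegralZl//; try by apply: bmeas_integrable; apply: bmeasX; exact: bmG.
have := GK e i e0; have := GK e j e0; have := ler_norm K; lra.
Qed.

Lemma det_scatter_measurable : measurable_fun [set: T] (fun w => \det (W w)).
Proof.
apply: measurable_det; have mY := mxmeasurable_data XN.
apply: mxmeasurableM; last exact: mxmeasurable_tr.
by apply: mxmeasurableM; [exact: mY|exact: mxmeasurable_cst].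
Qed.

Lemma scatter_unit_measurable : measurable [set w | W w \in unitmx].
Proof.
have -> : [set w | W w \in unitmx] = (fun w => \det (W w)) @^-1` (~` [set 0]).
  by apply/seteqP; split=> w /=; rewrite unitmxE unitfE => /eqP.
rewrite -[X in measurable X]setTI; apply: det_scatter_measurable => //.
by apply: measurableC; exact: measurable_set1.
Qed.

Let e_ N : R := N.+1%:R^-1.
Let e_gt0 N : 0 < e_ N. Proof. by rewrite invr_gt0. Qed.

(** On the singular event r tr G >= 1 / e, while E (tr G)^2 is bounded uniformly in e. With e = 1 /
    (N + 1) this bounds (N + 1)^2 P(S), hence (N + 1) P(S), by r^2 K for every N. *)
Lemma scatter_singular_null : P [set w | W w \notin unitmx] = 0%E.
Proof.
have [K [K0 GK]] := resolvent_trace_sq_bound.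
set S := [set w | W w \notin unitmx].
have mS : measurable S.
  have -> : S = ~` [set w | W w \in unitmx] by apply/seteqP; split=> w /=; [move/negP|move/negP].
  by apply: measurableC; exact: scatter_unit_measurable.
have bS : bmeas (\1_S : T -> R).
  split; first exact: measurable_indic.
  by exists 1 => w; rewrite indicE; case: (_ \in _); rewrite ?normr1 ?normr0.
have PS : \int[P]_w \1_S w = fine (P S).
  by rewrite /Rintegral integral_indic// setIT.
suff : fine (P S) = 0.
  by move=> /eqP; rewrite fine_eq0 ?fin_num_measure// => /eqP.
apply/eqP; rewrite eq_le fine_ge0 ?measure_ge0// andbT leNgt; apply/negP => PS0.
have h N : N.+1%:R * fine (P S) <= r%:R ^+ 2 * K.
  apply: (@le_trans _ _ (N.+1%:R ^+ 2 * fine (P S))).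
    by rewrite ler_pM2r// -natrX ler_nat -[X in (X <= _)%N]expn1 leq_pexp2l.
  rewrite -PS -RintegralZl//; last exact: bmeas_integrable.
  apply: (@le_trans _ _ (\int[P]_w (r%:R ^+ 2 * \tr (G (e_ N) w) ^+ 2))).
    apply: le_Rintegral => //.
    - by apply: bmeas_integrable; apply: bmeasM => //; exact: bmeas_cst.
    - apply: bmeas_integrable; apply: bmeasM; first exact: bmeas_cst.
      by apply: bmeasX; apply: bmeas_trace; [exact: mG|exact: bG].
    move=> w _; rewrite indicE; case: (boolP (w \in S)) => [|_]; last first.
      by rewrite mulr0 mulr_ge0// sqr_ge0.
    rewrite inE mulr1 => /= /(psd_singular_trace (Wpsd w) (e_gt0 N)).
    rewrite invrK => hN; rewrite -exprMn ler_pXn2r ?nnegrE//.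
    by apply: le_trans hN.
  rewrite RintegralZl//; last first.
    by apply: bmeas_integrable; apply: bmeasX; apply: bmeas_trace; [exact: mG|exact: bG].
  by rewrite ler_wpM2l ?sqr_ge0// GK.
have := h (Num.truncn (r%:R ^+ 2 * K / fine (P S))).
rewrite leNgt => /negP; apply.
by rewrite -ltr_pdivrMr// truncnS_gt.
Qed.

Lemma scatter_ae_unit : {ae P, forall w, W w \in unitmx}.
Proof.
exists [set w | W w \notin unitmx]; split; [|exact: scatter_singular_null|].
- rewrite (_ : [set w | _] = ~` [set w | W w \in unitmx]); last by apply/seteqP; split=> w /= /negP.
  by apply: measurableC; exact: scatter_unit_measurable.
- by move=> w /= /negP.
Qed.

End WishartMoments.

(** * The limit of the resolvent at a nonsingular matrix *)

Section ResolventLimit.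
Context {R : realType} {r : nat}.
Variables (W : 'M[R]_r).
Hypotheses (Wp : psdmx W) (Wu : W \in unitmx).

Lemma resolvent_trace_le (e : R) : 0 < e -> \tr (resolvent W e) <= \tr (invmx W).
Proof.
move=> e0; set G := resolvent W e.
have Gs : G^T = G by exact: resolvent_tr.
have Wi := psd_inv Wp Wu.
have D : invmx W - G = e *: (invmx W *m G).
  rewrite invmxB//; last exact: shift_unitmx.
  by rewrite opprD addrA subrr sub0r mulmxN mulNmx opprK mul_mx_scalar scalemxAl.
(* Substituting W^-1 = G + e G W^-1 once displays W^-1 G as a sum of positive semidefinite matrices,
   so that W^-1 - G = e W^-1 G has nonnegative trace. *)
have E : invmx W *m G = G *m 1%:M *m G^T + e *: (G *m invmx W *m G^T).
  have Wd : invmx W = G + e *: (G *m invmx W).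
    have := congr1 (mulmx^~ (invmx W)) (resolvent_mul Wp e0).
    rewrite /= -mulmxA mulmxV// mulmx1 mulmxBl mul1mx -scalemxAl -/G => h.
    by rewrite [X in X + _]h subrK.
  by rewrite {1}Wd mulmxDl -scalemxAl Gs mulmx1.
rewrite -subr_ge0 -raddfB /= D mxtraceZ mulr_ge0 ?(ltW e0)// E mxtraceD addr_ge0//.
  by apply: psd_trace_ge0; apply: psd_congr; exact: psd1.
by rewrite mxtraceZ mulr_ge0 ?(ltW e0)//; apply: psd_trace_ge0; exact: psd_congr.
Qed.

Lemma resolvent_cvg :
  mxcvg (\oo : set_system nat) (fun N => resolvent W N.+1%:R^-1) (invmx W).
Proof.
have e0 N : 0 < N.+1%:R^-1 :> R by rewrite invr_gt0.
apply: (@mxcvg_inv R _ _ _ _ (fun N => W + N.+1%:R^-1%:M) W (\tr (invmx W))) => //.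
- move=> i j; rewrite -[X in _ --> X]addr0 -[X in _ --> _ + X](mul0rn _ (i == j)).
  under eq_fun do rewrite !mxE; apply: cvgD; first exact: cvg_cst.
  case: (i == j); rewrite ?mulr1n ?mulr0n; first exact: cvg_harmonic.
  exact: cvg_cst.
- by move=> N; exact: shift_unitmx.
- move=> N i j; apply: le_trans (resolvent_trace_le (e0 N)).
  by apply: psd_entry_le; exact: resolvent_psd.
Qed.

End ResolventLimit.

Section GramTrace.
Context {R : realType}.

(** For M = L^T Z L the two sides are the sum of all M_ij^2 and the sum of all M_ii M_jj, compared
    entry by entry. *)
Lemma trace_gram_sq_le r q (L : 'M[R]_(r, q)) (Z : 'M[R]_r) : psdmx Z ->
  \tr (L *m L^T *m Z *m (L *m L^T) *m Z) <= \tr (L *m L^T *m Z) ^+ 2.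
Proof.
move=> Zp; pose M := L^T *m Z *m L.
have Mp : psdmx M by have := psd_congr L^T Zp; rewrite trmxK.
have [Ms _] := Mp.
have -> : \tr (L *m L^T *m Z) = \tr M by rewrite -mulmxA mxtrace_mulC.
have -> : \tr (L *m L^T *m Z *m (L *m L^T) *m Z) = \tr (M *m M^T).
  by rewrite Ms /M -!mulmxA [in LHS]mxtrace_mulC !mulmxA.
rewrite {1}/mxtrace [in leRHS]/mxtrace expr2 mulr_suml; apply: ler_sum => i _.
rewrite mxE mulr_sumr; apply: ler_sum => j _.
by rewrite [M^T j i]mxE -expr2; exact: psd_entry_sq.
Qed.

Lemma frobenius_sq_gram p r (L : 'M[R]_(r, p)) (V : 'M[R]_r) : V^T = V ->
  frobenius_sq (L^T *m V *m L) = \tr (L *m L^T *m V *m (L *m L^T) *m V).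
Proof.
move=> Vs; rewrite /frobenius_sq.
transitivity (\tr ((L^T *m V *m L) *m (L^T *m V *m L)^T)); last first.
  by rewrite !trmx_mul trmxK Vs -!mulmxA [in RHS]mxtrace_mulC !mulmxA.
by apply: eq_bigr => i _; rewrite mxE; apply: eq_bigr => j _; rewrite [X in _ * X]mxE -expr2.
Qed.

Lemma trace_sandwich_sq r (A Z V : 'M[R]_r) (x : R) :
  \tr (A *m (x *: Z - V) *m A *m (x *: Z - V)) =
  x ^+ 2 * \tr (A *m Z *m A *m Z) - 2 * x * \tr (A *m Z *m A *m V) + \tr (A *m V *m A *m V).
Proof.
have AU : A *m (x *: Z - V) = x *: (A *m Z) - A *m V by rewrite mulmxBr -scalemxAr.
rewrite -mulmxA AU -!(mulmxA (A *m _)).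
move: (A *m Z) (A *m V) => a b.
rewrite mulmxBl !mulmxBr -!scalemxAl -!scalemxAr scalerA !raddfB /= !mxtraceZ.
rewrite (mxtrace_mulC b a); ring.
Qed.

End GramTrace.

Section WishartInverse.
Context {R : realType} {d : measure_display} {T : measurableType d}.
Context {n r : nat}.
Variables (P : probability T R) (X : 'I_n -> T -> 'cV[R]_r).
Variables (mu : 'cV[R]_r) (Sigma : 'M[R]_r).
Hypotheses (XN : iid_normal P X mu Sigma) (Sp : psdmx Sigma) (Su : Sigma \in unitmx).
Hypothesis hrn : (r + 5 <= n)%N.

Local Notation C := (centering n : 'M[R]_n).
Let Cs : C^T = C := centering_tr n.
Let Ci : C *m C = C := centering_idem n.
Let Y (w : T) := data_mx (fun j => X j w).
Local Notation W w := (scatter C (Y w)).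
Local Notation G e w := (resolvent (scatter C (Y w)) e).

Let n0 : (0 < n)%N.
Proof. by apply: leq_trans hrn; rewrite addnS. Qed.

Let Wpsd w : psdmx (W w) := scatter_psd Cs Ci (Y w).

Let e_ N : R := N.+1%:R^-1.
Let e_gt0 N : 0 < e_ N. Proof. by rewrite invr_gt0. Qed.

Let mG N : mxmeasurable (fun w => G (e_ N) w).
Proof. by apply: mxmeasurable_resolvent => //; exact: mxmeasurable_data XN. Qed.

Let bG N : mxbounded (fun w => G (e_ N) w).
Proof. exact: resolvent_bounded. Qed.

(** The value 0 at singular matrices is the limit of the resolvents multiplied by the indicator of
    invertibility, so convergence holds at every sample point. *)
Definition scatter_inv (M : 'M[R]_r) : 'M[R]_r := if M \in unitmx then invmx M else 0.

Local Notation Z w := (scatter_inv (scatter C (Y w))).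
Local Notation unitW := [set w | W w \in unitmx].

Let Zpsd w : psdmx (Z w).
Proof.
rewrite /scatter_inv; case: ifP => [Wu|_]; first exact: psd_inv.
by rewrite -[0](scale0r 1%:M); apply: psdZ => //; exact: psd1.
Qed.

Let u w : R := \1_unitW w.

Let u_unit w : W w \in unitmx -> u w = 1.
Proof. by move=> Wu; rewrite /u indicE mem_set. Qed.

Let u_sing w : W w \notin unitmx -> u w = 0.
Proof. by move=> Wu; rewrite /u indicE memNset//; exact/negP. Qed.

Let bu : bmeas u.
Proof.
split; first exact: measurable_indic (scatter_unit_measurable XN).
by exists 1 => w; rewrite /u indicE; case: (_ \in _); rewrite ?normr1 ?normr0.
Qed.

Let Gcvg w : mxcvg (\oo : set_system nat) (fun N => u w *: G (e_ N) w) (Z w).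
Proof.
rewrite /scatter_inv; case: ifPn => [Wu|Wu].
  rewrite u_unit//; under eq_fun do rewrite scale1r; exact: resolvent_cvg.
by rewrite u_sing//; under eq_fun do rewrite scale0r; exact: mxcvg_cst.
Qed.

Lemma mxmeasurable_scatter_inv : mxmeasurable (fun w => Z w).
Proof.
move=> i j; apply: (measurable_fun_limR (F := fun N w => (u w *: G (e_ N) w) i j)).
  move=> N; under eq_fun do rewrite mxE; apply: measurable_funM; first by case: bu.
  exact: mG.
by move=> w; exact: Gcvg.
Qed.

Let tau_ge0 w : 0 <= \tr (Z w). Proof. exact: psd_trace_ge0. Qed.

Let mtau : measurable_fun [set: T] (fun w => \tr (Z w)).
Proof. exact: measurable_trace mxmeasurable_scatter_inv. Qed.

(** Fatou's lemma carries the bound on E (tr G)^2, uniform in e, over to tr Z. This function is the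
    common majorant of the integrands below. *)
Let tau_integrable : P.-integrable [set: T] (EFin \o (fun w => (1 + \tr (Z w)) ^+ 2)).
Proof.
have [K [K0 GK]] := resolvent_trace_sq_bound XN Sp Su hrn.
have bT N : bmeas (fun w => \tr (G (e_ N) w)) by apply: bmeas_trace; [exact: mG|exact: bG].
have b2 N : bmeas (fun w => u w * \tr (G (e_ N) w) ^+ 2).
  by apply: bmeasM => //; exact: bmeasX.
have i2 : P.-integrable [set: T] (EFin \o (fun w => (\tr (Z w)) ^+ 2)).
  apply: (integrable_fatou (F := fun N w => u w * \tr (G (e_ N) w) ^+ 2) (K := K)).
  - by move=> N; exact: bmeas_integrable.
  - by move=> N w; rewrite mulr_ge0 ?sqr_ge0// /u indicE.
  - move=> N; apply: le_trans (GK _ (e_gt0 N)); apply: le_Rintegral => //.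
    + exact: bmeas_integrable.
    + by apply: bmeas_integrable; exact: bmeasX.
    by move=> w _; rewrite ler_piMl ?sqr_ge0// /u indicE; case: (_ \in _).
  move=> w; have E N : u w * \tr (G (e_ N) w) ^+ 2 = \tr (u w *: G (e_ N) w) ^+ 2.
    by rewrite mxtraceZ exprMn /u indicE; case: (_ \in _); rewrite ?expr1n ?expr0n.
  by under eq_fun do rewrite E; apply: cvgM; apply: mxcvg_trace; exact: Gcvg.
apply: (@le_integrable _ _ _ P _ measurableT _ (EFin \o (fun w => 2 + 2 * \tr (Z w) ^+ 2))).
- by apply/measurable_EFinP; apply: measurable_funX; exact: measurable_funD.
- move=> w _; rewrite /= lee_fin; have := tau_ge0 w; set t := \tr _ => t0.
  rewrite ger0_norm ?sqr_ge0// ger0_norm ?addr_ge0 ?mulr_ge0 ?sqr_ge0 ?addr_ge0//.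
  by have := sqr_ge0 (1 - t); nra.
rewrite /comp; under eq_fun do rewrite EFinD EFinM.
apply: integrableD => //; first exact: finite_measure_integrable_cst.
exact: integrableZl.
Qed.

(* Pairs (g, E) with bounded entries: the resolvent is a multiple (1 + tr W^-1) g and
   e times the resolvent is an E, which makes all bounds uniform in e. *)
Let S := {gE : 'M[R]_r * 'M[R]_r | forall i j, `|gE.1 i j| <= 1 /\ `|gE.2 i j| <= 1}.

Let bg : mxbounded (fun s : S => (sval s).1).
Proof. by exists 1 => -[gE h] i j; have [] := h i j. Qed.

Let bE : mxbounded (fun s : S => (sval s).2).
Proof. by exists 1 => -[gE h] i j; have [] := h i j. Qed.

Let scaled (M E : 'M[R]_r) (t : R) : 0 <= t ->
  (forall i j, `|M i j| <= t) -> (forall i j, `|E i j| <= 1) ->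
  exists s : S, M = (1 + t) *: (sval s).1 /\ E = (sval s).2.
Proof.
move=> t0 Mt E1; have t1 : 0 < 1 + t by rewrite ltr_pwDl.
have h i j : `|((1 + t)^-1 *: M, E).1 i j| <= 1 /\ `|((1 + t)^-1 *: M, E).2 i j| <= 1.
  split=> //=; rewrite mxE normrM gtr0_norm ?invr_gt0// mulrC ler_pdivrMr// mul1r.
  by apply: le_trans (Mt i j) _; rewrite lerDr.
exists (exist _ _ h); split=> //=.
by rewrite scalerA mulfV ?gt_eqF// scale1r.
Qed.

Lemma integrable_AZAZ (A : 'M[R]_r) :
  P.-integrable [set: T] (EFin \o (fun w => \tr (A *m Z w *m A *m Z w))).
Proof.
have mZ := mxmeasurable_scatter_inv.
have [K bK] : exists K, forall s : S, `|\tr (A *m (sval s).1 *m A *m (sval s).1)| <= K.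
  apply: mxbounded_trace; apply: mxboundedM => //; apply: mxboundedM; last exact: mxbounded_cst.
  by apply: mxboundedM => //; exact: mxbounded_cst.
apply: (@le_integrable _ _ _ P _ measurableT _ (EFin \o (fun w => K * (1 + \tr (Z w)) ^+ 2))).
- apply/measurable_EFinP; apply: measurable_trace; apply: mxmeasurableM => //.
  apply: mxmeasurableM; last exact: mxmeasurable_cst.
  by apply: mxmeasurableM => //; exact: mxmeasurable_cst.
- move=> w _; rewrite /= lee_fin.
  have := tau_ge0 w; set k := 1 + \tr (Z w) => t0.
  have [s [-> _]] : exists s : S, Z w = k *: (sval s).1 /\ (0 : 'M[R]_r) = (sval s).2.
    apply: scaled; first exact: tau_ge0.
      by move=> i j; exact: psd_entry_le.
    by move=> i j; rewrite mxE normr0.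
  rewrite -!(scalemxAl, scalemxAr) scalerA mxtraceZ -expr2 normrM mulrC.
  by rewrite [leRHS]normrM; apply: ler_pM => //; exact: le_trans (bK s) (ler_norm K).
rewrite /comp; under eq_fun do rewrite EFinM.
exact: integrableZl.
Qed.


(* The integrand of stein_haff, with M and E standing for G and e G. *)
Let Phi (A M E : 'M[R]_r) : R :=
  (n%:R - r%:R - 3) * \tr (A *m M *m A *m M) - \tr (A *m M) ^+ 2
  + (\tr (A *m M) * \tr (A *m (E *m M)) + 2 * \tr (A *m (E *m M) *m A *m M)
     + \tr (A *m M *m A *m M) * \tr E)
  - \tr (A *m M *m A *m (1%:M - E) *m invmx Sigma).

Let Phi_cvg A (M E : nat -> 'M[R]_r) M0 E0 :
  mxcvg (\oo : set_system nat) M M0 -> mxcvg (\oo : set_system nat) E E0 ->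
  Phi A (M N) (E N) @[N --> \oo] --> Phi A M0 E0.
Proof.
move=> cM cE; have FF : Filter (\oo : set_system nat) by exact: eventually_filter.
have cA : mxcvg (\oo : set_system nat) (fun=> A) A by exact: mxcvg_cst.
have c1 := mxcvgM (FF := FF) cA cM.
have c2 := mxcvgM (FF := FF) c1 cA.
have c3 := mxcvgM (FF := FF) c2 cM.
have cEM := mxcvgM (FF := FF) cE cM.
have c4 := mxcvgM (FF := FF) cA cEM.
have c5 := mxcvgM (FF := FF) (mxcvgM (FF := FF) c4 cA) cM.
have c6 := mxcvgD (FF := FF) (@mxcvg_cst R _ _ FF _ _ (1%:M : 'M[R]_r)) (mxcvgN (FF := FF) cE).
have c7 := mxcvgM (FF := FF) (mxcvgM (FF := FF) c2 c6) (@mxcvg_cst R _ _ FF _ _ (invmx Sigma)).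
apply: cvgB; last exact: mxcvg_trace c7.
apply: cvgD.
  apply: cvgB; first by apply: cvgM; [exact: cvg_cst|exact: mxcvg_trace c3].
  by apply: cvgM; exact: mxcvg_trace c1.
apply: cvgD; last by apply: cvgM; [exact: mxcvg_trace c3|exact: mxcvg_trace cE].
apply: cvgD; first by apply: cvgM; [exact: mxcvg_trace c1|exact: mxcvg_trace c4].
by apply: cvgM; [exact: cvg_cst|exact: mxcvg_trace c5].
Qed.

Let Phi_measurable A (M E : T -> 'M[R]_r) : mxmeasurable M -> mxmeasurable E ->
  measurable_fun [set: T] (fun w => Phi A (M w) (E w)).
Proof.
move=> cM cE; have cA : mxmeasurable (fun _ : T => A) by exact: mxmeasurable_cst.
have c1 := mxmeasurableM cA cM.
have c2 := mxmeasurableM c1 cA.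
have c3 := mxmeasurableM c2 cM.
have cEM := mxmeasurableM cE cM.
have c4 := mxmeasurableM cA cEM.
have c5 := mxmeasurableM (mxmeasurableM c4 cA) cM.
have c6 := mxmeasurableD (mxmeasurable_cst 1%:M) (mxmeasurableN cE).
have c7 := mxmeasurableM (mxmeasurableM c2 c6) (mxmeasurable_cst (invmx Sigma)).
apply: measurable_funB; last exact: measurable_trace c7.
apply: measurable_funD.
  apply: measurable_funB; first by apply: measurable_funM => //; exact: measurable_trace c3.
  by apply: measurable_funX; exact: measurable_trace c1.
apply: measurable_funD.
  apply: measurable_funD.
    by apply: measurable_funM; [exact: measurable_trace c1|exact: measurable_trace c4].
  by apply: measurable_funM => //; exact: measurable_trace c5.
by apply: measurable_funM; [exact: measurable_trace c3|exact: measurable_trace cE].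
Qed.

(** Phi has degree two in M except for its last term, which has degree one; scaling by k = 1 + t >=
    1 therefore costs at most k^2. *)
Let Phi_bounded A : exists K, forall (M E : 'M[R]_r) t, 0 <= t ->
  (forall i j, `|M i j| <= t) -> (forall i j, `|E i j| <= 1) ->
  `|Phi A M E| <= K * (1 + t) ^+ 2.
Proof.
have cA : mxbounded (fun _ : S => A) by exact: mxbounded_cst.
have c1 := mxboundedM cA bg.
have c2 := mxboundedM c1 cA.
have c3 := mxboundedM c2 bg.
have cEM := mxboundedM bE bg.
have c4 := mxboundedM cA cEM.
have c5 := mxboundedM (mxboundedM c4 cA) bg.
have c6 := mxboundedD (mxbounded_cst 1%:M) (mxboundedN bE).
have c7 := mxboundedM (mxboundedM c2 c6) (mxbounded_cst (invmx Sigma)).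
have [K1 B1] : bounded_real (fun s : S =>
  (n%:R - r%:R - 3) * \tr (A *m (sval s).1 *m A *m (sval s).1) -
    \tr (A *m (sval s).1) * \tr (A *m (sval s).1)
  + (\tr (A *m (sval s).1) * \tr (A *m ((sval s).2 *m (sval s).1)) +
      2 * \tr (A *m ((sval s).2 *m (sval s).1) *m A *m (sval s).1)
     + \tr (A *m (sval s).1 *m A *m (sval s).1) * \tr (sval s).2)).
  apply: boundedD.
    apply: boundedD; first by apply: boundedM; [exact: bounded_cst|exact: mxbounded_trace c3].
    by apply: boundedN; apply: boundedM; exact: mxbounded_trace c1.
  apply: boundedD.
    apply: boundedD.
      by apply: boundedM; [exact: mxbounded_trace c1|exact: mxbounded_trace c4].
    by apply: boundedM; [exact: bounded_cst|exact: mxbounded_trace c5].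
  by apply: boundedM; [exact: mxbounded_trace c3|exact: mxbounded_trace bE].
have [K2 B2] := mxbounded_trace c7.
exists (K1 + K2) => M E t t0 Mt E1.
have [s [-> ->]] := scaled t0 Mt E1.
set k := 1 + t; have k1 : 1 <= k by rewrite lerDl.
move: (B1 s) (B2 s); set x := (X in `|X| <= K1); set y := (X in `|X| <= K2) => xK yK.
have -> : Phi A (k *: (sval s).1) (sval s).2 = k ^+ 2 * x - k * y.
  rewrite /Phi /x /y -!(scalemxAl, scalemxAr) !scalerA !mxtraceZ; ring.
apply: le_trans (ler_normB _ _) _; rewrite [`|k ^+ 2 * x|]normrM [`|k * y|]normrM.
rewrite ger0_norm ?sqr_ge0// [`|k|]ger0_norm ?(le_trans ler01)//.
rewrite [leRHS]mulrDl lerD//; first by rewrite mulrC ler_wpM2r ?sqr_ge0.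
apply: (@le_trans _ _ (k * K2)); first by rewrite ler_wpM2l ?(le_trans ler01).
rewrite mulrC ler_wpM2l ?(le_trans _ yK)// expr2 ler_peMl// (le_trans ler01)//.
Qed.

(** [stein_haff] in the limit e -> 0, by dominated convergence: G tends to Z, and E = e G, which
    stays bounded by 1, tends to 0. *)
Lemma inverse_wishart_identity (A : 'M[R]_r) : A^T = A ->
  P.-integrable [set: T] (EFin \o (fun w => Phi A (Z w) 0)) /\
  \int[P]_w Phi A (Z w) 0 = 0.
Proof.
move=> As; have [K PK] := Phi_bounded A.
pose M N w := u w *: G (e_ N) w.
pose E N w := e_ N *: M N w.
have uT w : 0 <= u w <= 1 by rewrite /u indicE; case: (_ \in _); rewrite ?lexx ?ler01.
have mM N : mxmeasurable (M N).
  move=> i j; rewrite /M; under eq_fun do rewrite mxE.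
  by apply: measurable_funM; [case: bu|exact: mG].
have mE N : mxmeasurable (E N) by exact: mxmeasurableZ.
have mF N : measurable_fun [set: T] (fun w => Phi A (M N w) (E N w)) by exact: Phi_measurable.
have F0 N : \int[P]_w Phi A (M N w) (E N w) = 0.
  rewrite -(stein_haff XN Sp Su n0 As (e_gt0 N)) /Rintegral; congr fine.
  have G0 w : Phi A (G (e_ N) w) (e_ N *: G (e_ N) w) =
     (n%:R - r%:R - 3) * \tr (A *m G (e_ N) w *m A *m G (e_ N) w) - \tr (A *m G (e_ N) w) ^+ 2
     + e_ N * (\tr (A *m G (e_ N) w) * \tr (A *m (G (e_ N) w *m G (e_ N) w))
           + 2 * \tr (A *m (G (e_ N) w *m G (e_ N) w) *m A *m G (e_ N) w)
           + \tr (A *m G (e_ N) w *m A *m G (e_ N) w) * \tr (G (e_ N) w))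
    - \tr (A *m G (e_ N) w *m A *m G (e_ N) w *m W w *m invmx Sigma).
    rewrite /Phi -(resolvent_mul (Wpsd w) (e_gt0 N)) !mulmxA -!(scalemxAl, scalemxAr) !mxtraceZ.
    by ring.
  under [RHS]eq_integral do rewrite -G0.
  (* The cut-off by [u] changes the integrand only on the null event where W is singular. *)
  apply: ae_eq_integral => //; try exact/measurable_EFinP.
    by apply/measurable_EFinP; apply: Phi_measurable => //; apply: mxmeasurableZ; exact: mG.
  apply: filterS (scatter_ae_unit XN Sp Su hrn) => w Wu _.
  by rewrite /E /M u_unit// !scale1r.
have cF w : Phi A (M N w) (E N w) @[N --> \oo] --> Phi A (Z w) 0.
  apply: Phi_cvg; first exact: Gcvg.
  rewrite -(scale0r (Z w)); apply: mxcvgZ; [exact: cvg_harmonic|exact: Gcvg].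
have MG N w i j : `|M N w i j| <= \tr (Z w).
  rewrite /M /scatter_inv; case: ifPn => [Wu|Wu]; last first.
    by rewrite u_sing// scale0r mxE normr0 mxtrace0.
  rewrite u_unit// scale1r; apply: le_trans (resolvent_trace_le (Wpsd w) Wu (e_gt0 N)).
  by apply: psd_entry_le; exact: resolvent_psd.
have EG N w i j : `|E N w i j| <= 1.
  have /andP[u0 u1] := uT w.
  rewrite /E /M !mxE mulrCA normrM [`|e_ N * _|]normrM ger0_norm// [`|e_ N|]gtr0_norm//.
  apply: mulr_ile1 => //; last exact: (resolvent_entry_le (Wpsd w) (e_gt0 N)).
  by rewrite mulr_ge0// (ltW (e_gt0 N)).
have iK : P.-integrable [set: T] (EFin \o (fun w => K * (1 + \tr (Z w)) ^+ 2)).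
  by rewrite /comp; under eq_fun do rewrite EFinM; exact: integrableZl.
have [iP cP] := @Rintegral_dominated R d T P (fun N w => Phi A (M N w) (E N w))
   (fun w => Phi A (Z w) 0) (fun w => K * (1 + \tr (Z w)) ^+ 2) mF
   (Phi_measurable A mxmeasurable_scatter_inv (mxmeasurable_cst 0)) iK
   (fun N w => PK _ _ _ (tau_ge0 w) (MG N w) (EG N w)) (aeW P cF).
split=> //; rewrite -(cvg_lim (@Rhausdorff R) cP).
by under eq_fun do rewrite F0; rewrite lim_cst.
Qed.


Lemma integrable_AZAV (A V : 'M[R]_r) :
  P.-integrable [set: T] (EFin \o (fun w => \tr (A *m Z w *m A *m V))).
Proof.
have mZ := mxmeasurable_scatter_inv.
have [K bK] : exists K, forall s : S, `|\tr (A *m (sval s).1 *m A *m V)| <= K.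
  apply: mxbounded_trace; apply: mxboundedM; last exact: mxbounded_cst.
  apply: mxboundedM; last exact: mxbounded_cst.
  by apply: mxboundedM => //; exact: mxbounded_cst.
apply: (@le_integrable _ _ _ P _ measurableT _ (EFin \o (fun w => K * (1 + \tr (Z w)) ^+ 2))).
- apply/measurable_EFinP; apply: measurable_trace; apply: mxmeasurableM;
    last exact: mxmeasurable_cst.
  apply: mxmeasurableM; last exact: mxmeasurable_cst.
  by apply: mxmeasurableM => //; exact: mxmeasurable_cst.
- move=> w _; rewrite /= lee_fin.
  have := tau_ge0 w; set k := 1 + \tr (Z w) => t0.
  have [s [-> _]] : exists s : S, Z w = k *: (sval s).1 /\ (0 : 'M[R]_r) = (sval s).2.
    apply: scaled; first exact: tau_ge0.
      by move=> i j; exact: psd_entry_le.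
    by move=> i j; rewrite mxE normr0.
  rewrite -!(scalemxAl, scalemxAr) mxtraceZ normrM mulrC.
  have k1 : 1 <= k by rewrite lerDl.
  rewrite [leRHS]normrM; apply: ler_pM => //; first exact: le_trans (bK s) (ler_norm K).
  by rewrite normrX expr2 ler_peMl// ger0_norm// (le_trans ler01).
rewrite /comp; under eq_fun do rewrite EFinM.
exact: integrableZl.
Qed.

(** The identity at E = 0 says that (n - r - 3) tr(AZAZ) - tr(AZ)^2 - tr(AZA Sigma^-1) has mean 0,
    and tr(AZ)^2 is at least tr(AZAZ). *)
Lemma inverse_wishart_moments q (L : 'M[R]_(r, q)) (A := L *m L^T) :
  \int[P]_w \tr (A *m Z w *m A *m invmx Sigma) <=
  (n%:R - r%:R - 4) * \int[P]_w \tr (A *m Z w *m A *m Z w).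
Proof.
have As : A^T = A by rewrite trmx_mul trmxK.
have [iPhi Phi0] := inverse_wishart_identity As.
have i1 := integrable_AZAZ A; have i2 := integrable_AZAV A (invmx Sigma).
have iZ : P.-integrable [set: T] (EFin \o (fun w =>
  (n%:R - r%:R - 4) * \tr (A *m Z w *m A *m Z w))).
  by rewrite /comp; under eq_fun do rewrite EFinM; exact: integrableZl.
rewrite -RintegralZl// -subr_ge0 -RintegralB// -Phi0; apply: le_Rintegral => //.
  by rewrite /comp; under eq_fun do rewrite EFinB; exact: integrableB.
move=> w _; rewrite /Phi subr0 mulmx1 mul0mx mulmx0 !mul0mx mxtrace0.
have := trace_gram_sq_le L (Zpsd w); rewrite -/A; lra.
Qed.

(** The integrand is the squared Frobenius norm of L^T Z L. If its mean were 0, this matrix would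
    vanish almost surely, and so would Z after multiplication by B^T and B, although Z inverts W
    almost surely. Strict dominance rests on this positivity. *)
Lemma inverse_wishart_moment_gt0 q (L : 'M[R]_(r, q)) (B : 'M[R]_(q, r)) (A := L *m L^T) :
  (0 < r)%N -> L *m B = 1%:M -> 0 < \int[P]_w \tr (A *m Z w *m A *m Z w).
Proof.
move=> r0 LB.
have AE w : \tr (A *m Z w *m A *m Z w) = frobenius_sq (L^T *m Z w *m L).
  by rewrite frobenius_sq_gram//; have [] := Zpsd w.
have A0 w : 0 <= \tr (A *m Z w *m A *m Z w).
  by rewrite AE; do 2 apply: sumr_ge0 => ? _; exact: sqr_ge0.
have i1 := integrable_AZAZ A.
rewrite lt_neqAle Rintegral_ge0// andbT eq_sym; apply/negP => /eqP I0.
have : (\int[P]_w `|(\tr (A *m Z w *m A *m Z w))%:E| = 0)%E.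
  rewrite -[RHS]/(0%:E) -I0 /Rintegral fineK; last exact: integrable_fin_num i1.
  by apply: eq_integral => w _; rewrite /= ger0_norm.
move/ae_eq_integral_abs => /(_ measurableT (measurable_int _ i1)) [N [mN N0 hN]].
have uN : unitW `<=` N.
  move=> w Wu; apply: hN => /= /(_ I); rewrite AE => -[F0].
  have M0 : L^T *m Z w *m L = 0.
    apply/matrixP => i j; rewrite [RHS]mxE; apply/eqP; rewrite -sqrf_eq0.
    have : \sum_(j < q) (L^T *m Z w *m L) i j ^+ 2 == 0.
      move/eqP: F0; rewrite psumr_eq0; last by move=> k _; apply: sumr_ge0 => l _; exact: sqr_ge0.
      by move=> /allP /(_ i); rewrite mem_index_enum => /(_ isT).
    rewrite psumr_eq0; last by move=> l _; exact: sqr_ge0.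
    by move=> /allP /(_ j); rewrite mem_index_enum => /(_ isT).
  have Z0 : Z w = 0.
    have := congr1 (fun M => B^T *m M *m B) M0.
    rewrite /= -!mulmxA LB mulmx1 !mulmxA -trmx_mul LB trmx1 mul1mx.
    by rewrite mulmx0 mul0mx.
  have := mulmxV Wu; move: Z0; rewrite /scatter_inv ifT// => ->.
  rewrite mulmx0 => /(congr1 (fun M : 'M[R]_r => M (Ordinal r0) (Ordinal r0))).
  by rewrite !mxE eqxx => /esym/eqP; rewrite oner_eq0.
(* The whole space would be covered by two null events. *)
have : (P setT <= P N + P (~` unitW))%E.
  apply: le_trans (measureU2 _ _ _) => //; last first.
    by apply: measurableC; exact: scatter_unit_measurable XN.
  apply: le_measure; rewrite ?inE//.
    apply: measurableU => //; apply: measurableC; exact: scatter_unit_measurable XN.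
  by move=> w _; have [/uN|] := pselect (unitW w); [left|right].
have -> : ~` unitW = [set w | W w \notin unitmx].
  by apply/seteqP; split=> w /= /negP.
rewrite (scatter_singular_null XN Sp Su hrn) N0 adde0.
have -> : P setT = 1%E by exact: probability_setT.
by rewrite lee_fin ler10.
Qed.

End WishartInverse.

(** * Pseudoinverses *)

Section Pseudoinverse.
Context {R : realType}.

(** Tikhonov regularisation. With N the pseudoinverse, M^T = N M M^T and N = N N^T N M M^T, so the
    error is e times N N^T N (1 - e G), whose second factor is bounded. The pseudoinverse is not
    continuous, but as a pointwise limit it is measurable. *)
Lemma mpinv_cvg m q (M : 'M[R]_(m, q)) :
  mxcvg (\oo : set_system nat)
    (fun k => M^T *m resolvent (M *m M^T) k.+1%:R^-1) (mpinv M).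
Proof.
have [a b c e] := penrose_mpinv M; set N := mpinv M in a b c e *.
have MMp : psdmx (M *m M^T) by have := psd_congr M (psd1 q); rewrite mulmx1.
have MT : M^T = N *m (M *m M^T).
  by rewrite mulmxA -e -trmx_mul mulmxA a.
have NE : N = N *m N^T *m N *m (M *m M^T).
  by rewrite -!mulmxA -MT -trmx_mul c mulmxA b.
have e0 k : 0 < k.+1%:R^-1 :> R by rewrite invr_gt0.
have D k : M^T *m resolvent (M *m M^T) k.+1%:R^-1 = N -
   k.+1%:R^-1 *: (N *m N^T *m N *m (1%:M - k.+1%:R^-1 *: resolvent (M *m M^T) k.+1%:R^-1)).
  transitivity (N *m (M *m M^T *m resolvent (M *m M^T) k.+1%:R^-1)); first by rewrite mulmxA -MT.
  have h := mul_resolvent MMp (e0 k).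
  by rewrite -h [in RHS]mulmxA -NE h mulmxBr mulmx1 scalemxAr.
have [K KB] : mxbounded (fun k : nat =>
    N *m N^T *m N *m (1%:M - k.+1%:R^-1 *: resolvent (M *m M^T) k.+1%:R^-1)).
  apply: mxboundedM; first exact: mxbounded_cst.
  apply: mxboundedD; first exact: mxbounded_cst.
  apply: mxboundedN; exists 1 => k i j.
  by rewrite mxE normrM gtr0_norm// resolvent_entry_le.
move=> i j; apply/subr_cvg0/cvgr0Pnorm_le => /= eps eps0.
have hK : (fun k : nat => k.+1%:R^-1 * (`|K| + 1)) @ \oo --> (0 : R).
  by rewrite -[X in _ --> X](mul0r (`|K| + 1)); apply: cvgMl; exact: cvg_harmonic.
have /cvgr0Pnorm_le /(_ _ eps0) := hK; apply: filterS => k hk.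
rewrite D; move: (KB k i j); move: (N *m N^T *m N *m (1%:M - _)) => Q QK.
rewrite !mxE [X in `|X|]addrC addKr normrN; apply: le_trans hk.
rewrite normrM [leRHS]normrM ler_wpM2l// (le_trans QK)//.
by rewrite [leRHS]ger0_norm ?addr_ge0// (le_trans (ler_norm K))// lerDl.
Qed.

Lemma mxmeasurable_mpinv d (T : measurableType d) m q (F : T -> 'M[R]_(m, q)) :
  mxmeasurable F -> mxmeasurable (fun w => mpinv (F w)).
Proof.
move=> mF i j.
apply: (measurable_fun_limR (F := fun k w =>
  ((F w)^T *m resolvent (F w *m (F w)^T) k.+1%:R^-1) i j)) => [k|w]; last exact: mpinv_cvg.
apply: mxmeasurableM; first exact: mxmeasurable_tr.
apply: mxmeasurable_inv.
  apply: mxmeasurableD; last exact: mxmeasurable_cst.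
  by apply: mxmeasurableM => //; exact: mxmeasurable_tr.
move=> w; apply: shift_unitmx; last by rewrite invr_gt0.
by have := psd_congr (F w) (psd1 q); rewrite mulmx1.
Qed.

End Pseudoinverse.

Section LeftInverse.
Context {R : realType} {p r : nat}.
Variables (B : 'M[R]_(p, r)) (L : 'M[R]_(r, p)).
Hypotheses (LB : L *m B = 1%:M) (BL : (B *m L)^T = B *m L).

(** The hypotheses on L make it the pseudoinverse of B. Both products of the two matrices equal the
    orthogonal projection B L, from which the Penrose equations follow. *)
Lemma mpinv_sandwich (M : 'M[R]_r) : M \in unitmx ->
  mpinv (B *m M *m B^T) = L^T *m invmx M *m L.
Proof.
move=> Mu; apply: (penrose_unique (penrose_mpinv _)).
have BLT : B^T *m L^T = 1%:M by rewrite -trmx_mul LB trmx1.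
have AN : (B *m M *m B^T) *m (L^T *m invmx M *m L) = B *m L.
  by rewrite !mulmxA -(mulmxA _ B^T) BLT mulmx1 -(mulmxA B M) mulmxV// mulmx1.
have NA : (L^T *m invmx M *m L) *m (B *m M *m B^T) = B *m L.
  rewrite !mulmxA -(mulmxA _ L B) LB mulmx1 -(mulmxA L^T) mulVmx// mulmx1.
  by rewrite -trmx_mul BL.
split; rewrite ?AN ?NA//.
- by rewrite !mulmxA -(mulmxA B L B) LB mulmx1.
- by rewrite -BL trmx_mul !mulmxA -(mulmxA L^T B^T L^T) BLT mulmx1.
Qed.

End LeftInverse.

Section RankFactor.
Context {R : realType} {p : nat}.
Variable (Sigma : 'M[R]_p).
Hypothesis Sp : psdmx Sigma.

(** B is a basis of the column space of Sigma and L = (B^T B)^-1 B^T, so that B L is the orthogonal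
    projection onto that space. By symmetry, Sigma is unchanged by this projection on either
    side. *)
Lemma psd_rank_factor r : \rank Sigma = r -> exists (B : 'M[R]_(p, r)) (L : 'M[R]_(r, p)),
  [/\ L *m B = 1%:M, (B *m L)^T = B *m L, B *m L *m Sigma = Sigma,
      Sigma = B *m (L *m Sigma *m L^T) *m B^T & L *m Sigma *m L^T \in unitmx].
Proof.
move=> rk; have [B [F [BBu BF]]] : exists (B : 'M[R]_(p, r)) (F : 'M[R]_(r, p)),
    B^T *m B \in unitmx /\ B *m F = Sigma.
  rewrite -rk; exists (col_base Sigma), (row_base Sigma); split; last exact: mulmx_base.
  have /row_free_gram_unit : row_free (col_base Sigma)^T.
    by rewrite /row_free mxrank_tr; exact: col_base_full.
  by rewrite trmxK.
pose L := invmx (B^T *m B) *m B^T.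
have LB : L *m B = 1%:M by rewrite /L -mulmxA mulVmx.
have BLs : (B *m L)^T = B *m L.
  by rewrite /L !trmx_mul trmxK trmx_inv trmx_mul trmxK mulmxA.
move: (L) LB BLs => {}L LB BLs.
have BLS : B *m L *m Sigma = Sigma.
  by rewrite -[in LHS]BF mulmxA -(mulmxA B) LB mulmx1 BF.
have SE : Sigma = B *m (L *m Sigma *m L^T) *m B^T.
  have [Ss _] := Sp.
  rewrite !mulmxA BLS -mulmxA -trmx_mul BLs -[in RHS]BLs -{2}Ss.
  by rewrite -trmx_mul BLS Ss.
exists B, L; split=> //.
(* Sigma factors through S', so S' has rank at least r. *)
rewrite -row_free_unit /row_free eqn_leq rank_leq_row /=.
rewrite -{1}rk {1}SE; apply: leq_trans (mxrankM_maxl _ _) _.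
exact: mxrankM_maxr.
Qed.

End RankFactor.

Section SampleCovariance.
Context {R : realType} {n p : nat}.

Lemma sample_cov_scatter (x : 'I_n -> 'cV[R]_p) :
  sample_cov x = n%:R^-1 *: scatter (centering n) (data_mx x).
Proof.
rewrite /sample_cov; congr (_ *: _).
have E i : x i - sample_mean x = col i (data_mx x *m centering n).
  apply/colP => k; rewrite !mxE summxE.
  under [in RHS]eq_bigr do rewrite !mxE mulrBr.
  rewrite sumrB [in RHS](bigD1 i)//= eqxx mulr1 [in RHS]big1 ?addr0 => [|j ji]; last first.
    by rewrite (negbTE ji) mulr0.
  by rewrite -mulr_suml mulrC.
under eq_bigr do rewrite E.
rewrite scatter_gram.
move: (_ *m centering n) => D.
apply/matrixP => k l; rewrite summxE mxE; apply: eq_bigr => i _.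
by rewrite mxE big_ord1 !mxE.
Qed.

End SampleCovariance.

(** * The risk *)

Section Support.
Context {R : realType} {d : measure_display} {T : measurableType d}.

Lemma EFin_Rintegral (P : probability T R) (f : T -> R) :
  P.-integrable [set: T] (EFin \o f) -> (\int[P]_w (f w)%:E = (\int[P]_w f w)%:E)%E.
Proof. by move=> fi; rewrite /Rintegral fineK//; exact: integrable_fin_num fi. Qed.

(** Each row of K gives a functional of variance 0, whose law is the Dirac mass at its mean. *)
Lemma multinormal_kernel_ae (P : probability T R) p q (X : T -> 'cV[R]_p) mu Sigma
    (K : 'M[R]_(q, p)) :
  multinormal P X mu Sigma -> K *m Sigma = 0 -> {ae P, forall w, K *m (X w - mu) = 0}.
Proof.
move=> XN KS.
have h k : {ae P, forall w, (row k K *m X w) 0 0 = (row k K *m mu) 0 0}.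
  have v0 : (row k K *m Sigma *m (row k K)^T) 0 0 = 0 by rewrite -row_mul KS row0 mul0mx mxE.
  have [_ /(_ (row k K)^T)] := XN; rewrite trmxK v0.
  move=> /(_ (~` [set (row k K *m mu) 0 0])) law.
  exists ((fun w => (row k K *m X w) 0 0) @^-1` (~` [set (row k K *m mu) 0 0])).
  split=> //.
  - rewrite -[X in measurable X]setTI.
    have := multinormal_measurable_form (row k K)^T XN; rewrite trmxK; apply=> //.
    by apply: measurableC; exact: measurable_set1.
  - rewrite law; last by apply: measurableC; exact: measurable_set1.
    by rewrite /normal_law eqxx diracE memNset//=; apply.
have := @filter_forall _ _ _ _ (ae_filter_ringOfSetsType P) h.
apply: filterS => w hw; apply/colP => k; rewrite [RHS]mxE mulmxBr.
have := hw k; rewrite -!row_mul !mxE => ->; rewrite subrr//.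
Qed.

End Support.

Section RiskFormula.
Context {R : realType} {d : measure_display} {T : measurableType d}.
Context {n p r : nat}.
Variables (P : probability T R) (X : 'I_n -> T -> 'cV[R]_p).
Variables (mu : 'cV[R]_p) (Sigma : 'M[R]_p).
Hypotheses (XN : iid_normal P X mu Sigma) (Sr : cov_rank r Sigma).
Hypotheses (r0 : (0 < r)%N) (hrn : (r + 5 <= n)%N).

(** Here t = E tr(S^+2), m = E tr(S^+ Sigma^+) and q is the squared Frobenius norm of Sigma^+. All
    three are finite, so the comparison of risks becomes real arithmetic. *)
Lemma risk_quadratic : exists t m q : R,
  [/\ 0 < t, m <= (n%:R - r%:R - 4) / n%:R * t,
      expected_tr_pinv2 P X = t%:E
    & forall a, risk P X (scaled_pinv_estimator a) Sigma = (a ^+ 2 * t - 2 * a * m + q)%:E].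
Proof.
have [Sp rk] := Sr.
have [B [L [LB BL BLS SE S'u]]] := psd_rank_factor Sp rk.
set S' := L *m Sigma *m L^T in SE S'u.
have S'p : psdmx S' by exact: psd_congr.
have YN := iid_normal_mulmx L XN.
pose A := L *m L^T.
pose W w := scatter (centering n) (data_mx (fun j => L *m X j w)).
pose Z w := scatter_inv (W w).
pose V := invmx S'.
have n0 : (0 < n)%N by apply: leq_trans hrn; rewrite addnS.
have n0R : n%:R != 0 :> R by rewrite pnatr_eq0 -lt0n.
have i1 : P.-integrable [set: T] (EFin \o (fun w => \tr (A *m Z w *m A *m Z w))).
  exact: integrable_AZAZ YN S'p S'u hrn A.
have i2 : P.-integrable [set: T] (EFin \o (fun w => \tr (A *m Z w *m A *m V))).
  exact: integrable_AZAV YN S'p S'u hrn A V.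
have le12 := inverse_wishart_moments YN S'p S'u hrn L.
have gt1 := inverse_wishart_moment_gt0 YN S'p S'u hrn r0 LB.
have SpE : mpinv Sigma = L^T *m V *m L by rewrite [in LHS]SE (mpinv_sandwich LB BL).
have Vs : V^T = V by have [] := psd_inv S'p S'u.
have Zs w : (Z w)^T = Z w.
  rewrite /Z /scatter_inv; case: ifP => _; last by rewrite trmx0.
  by rewrite trmx_inv; have [->] := scatter_psd (centering_tr n) (centering_idem n) (data_mx
    (fun j => L *m X j w)).
have aeS : {ae P, forall w, pinv_estimator (fun j => X j w) = n%:R *: (L^T *m Z w *m L)}.
  have aeW : {ae P, forall w, W w \in unitmx} := scatter_ae_unit YN S'p S'u hrn.
  have aeK : {ae P, forall w, forall j, (1%:M - B *m L) *m (X j w - mu) = 0}.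
    have K0 : (1%:M - B *m L) *m Sigma = 0 by rewrite mulmxBl mul1mx BLS subrr.
    have [XN1 _] := XN.
    by apply: (@filter_forall _ _ _ _ (ae_filter_ringOfSetsType P)) => j;
      exact: multinormal_kernel_ae (XN1 j) K0.
  move: aeW aeK; apply: filterS2 => w Wu hX.
  rewrite /pinv_estimator sample_cov_scatter.
  set D := data_mx (fun j => X j w).
  have LD : data_mx (fun j => L *m X j w) = L *m D.
    by apply/matrixP => i j; rewrite !mxE; apply: eq_bigr => k _; rewrite !mxE.
  (* Outside the column space of Sigma all observations coincide with mu, so centering removes that
     component. *)
  have KD : (1%:M - B *m L) *m D = (1%:M - B *m L) *m mu *m const_mx 1.
    apply/matrixP => i j; rewrite [RHS]mxE big_ord1 [const_mx _ _ _]mxE mulr1.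
    have /eqP := hX j; rewrite mulmxBr subr_eq0 => /eqP <-.
    by rewrite !mxE; apply: eq_bigr => k _; rewrite [D _ _]mxE.
  have DC : D *m centering n = B *m (L *m D) *m centering n.
    have := const_centering n ((1%:M - B *m L) *m mu); rewrite -KD !mulmxBl mul1mx => /eqP.
    by rewrite subr_eq0 => /eqP ->; rewrite mulmxA.
  have WE : scatter (centering n) D = B *m W w *m B^T.
    by rewrite /W !scatter_gram LD DC -!mulmxA trmx_mul !mulmxA.
  have -> : n%:R^-1 *: scatter (centering n) D = B *m (n%:R^-1 *: W w) *m B^T.
    by rewrite WE -scalemxAr -scalemxAl.
  have nWu : n%:R^-1 *: W w \in unitmx by rewrite unitmxZ// unitfE invr_eq0.
  rewrite (mpinv_sandwich LB BL nWu) /Z /scatter_inv Wu invmxZ// invrK.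
  by rewrite -scalemxAr -scalemxAl.
have mpS : mxmeasurable (fun w => pinv_estimator (fun j => X j w)).
  apply: mxmeasurable_mpinv; under eq_fun do rewrite sample_cov_scatter.
  apply: mxmeasurableZ; rewrite /scatter; have mD := mxmeasurable_data XN.
  by apply: mxmeasurableM; [apply: mxmeasurableM => //;
    exact: mxmeasurable_cst|exact: mxmeasurable_tr].
have trE w x : frobenius_sq (x *: (L^T *m Z w *m L) - L^T *m V *m L) =
    x ^+ 2 * \tr (A *m Z w *m A *m Z w) - 2 * x * \tr (A *m Z w *m A *m V) + \tr (A *m V *m A *m V).
  have -> : x *: (L^T *m Z w *m L) - L^T *m V *m L = L^T *m (x *: Z w - V) *m L.
    by rewrite mulmxBr mulmxBl -scalemxAr -scalemxAl.
  rewrite frobenius_sq_gram; last by rewrite linearB linearZ /= Zs Vs.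
  exact: trace_sandwich_sq.
exists (n%:R ^+ 2 * \int[P]_w \tr (A *m Z w *m A *m Z w)),
  (n%:R * \int[P]_w \tr (A *m Z w *m A *m V)), (\tr (A *m V *m A *m V)).
split.
- by rewrite mulr_gt0// exprn_gt0// ltr0n.
- have -> : (n%:R - r%:R - 4) / n%:R * (n%:R ^+ 2 * \int[P]_w \tr (A *m Z w *m A *m Z w)) =
      n%:R * ((n%:R - r%:R - 4) * \int[P]_w \tr (A *m Z w *m A *m Z w)) by field.
  by rewrite ler_pM2l ?ltr0n.
- rewrite /expected_tr_pinv2 unlock.
  rewrite -RintegralZl// -EFin_Rintegral; last first.
    by rewrite /comp; under eq_fun do rewrite EFinM; exact: integrableZl.
  apply: ae_eq_integral => //.
  + apply/measurable_EFinP; apply: measurable_trace; exact: mxmeasurableM.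
  + by apply/measurable_EFinP; apply: measurable_funM => //; apply/measurable_EFinP;
      exact: (measurable_int _ i1).
  apply: filterS aeS => w -> _ /=; congr (_%:E).
  rewrite -scalemxAl -scalemxAr scalerA mxtraceZ -expr2; congr (_ * _).
  by rewrite /A -!mulmxA [in RHS]mxtrace_mulC !mulmxA.
- move=> a; rewrite /risk unlock.
  pose f w := (a ^+ 2 * n%:R ^+ 2) * \tr (A *m Z w *m A *m Z w)
     - (2 * a * n%:R) * \tr (A *m Z w *m A *m V) + \tr (A *m V *m A *m V).
  have j1 : P.-integrable [set: T] (EFin \o (fun w =>
    (a ^+ 2 * n%:R ^+ 2) * \tr (A *m Z w *m A *m Z w))).
    by rewrite /comp; under eq_fun do rewrite EFinM; exact: integrableZl.
  have j2 : P.-integrable [set: T] (EFin \o (fun w => (2 * a * n%:R) * \tr (A *m Z w *m A *m V))).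
    by rewrite /comp; under eq_fun do rewrite EFinM; exact: integrableZl.
  have j12 : P.-integrable [set: T] (EFin \o (fun w =>
    (a ^+ 2 * n%:R ^+ 2) * \tr (A *m Z w *m A *m Z w)
     - (2 * a * n%:R) * \tr (A *m Z w *m A *m V))).
    by rewrite /comp; under eq_fun do rewrite EFinB; exact: integrableB.
  have j3 : P.-integrable [set: T] (EFin \o (fun=> \tr (A *m V *m A *m V))).
    exact: finite_measure_integrable_cst.
  have jf : P.-integrable [set: T] (EFin \o f).
    by rewrite /f /comp; under eq_fun do rewrite EFinD; exact: integrableD.
  transitivity (\int[P]_w (f w)%:E)%E.
    apply: ae_eq_integral => //.
    + apply/measurable_EFinP; apply: measurable_sumR => i; apply: measurable_sumR => j.
      apply: measurable_funX.
      exact: (mxmeasurableD (mxmeasurableZ a mpS) (mxmeasurable_cst (- mpinv Sigma))).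
    + exact: measurable_int jf.
    apply: filterS aeS => w E _ /=; congr (_%:E).
    by rewrite /scaled_pinv_estimator E SpE scalerA trE exprMn mulrA.
  rewrite EFin_Rintegral//; congr (_%:E).
  rewrite RintegralD// RintegralB// !RintegralZl// Rintegral_prob_cst; ring.
Qed.

End RiskFormula.

(** A parameter at which the strict inequality of the dominance statements can be asserted. *)
Lemma exists_cov_rank (R : realType) (p r : nat) :
  (r <= p)%N -> cov_rank r (pid_mx r : 'M[R]_p).
Proof.
move=> rp; split; last exact: rank_pid_mx.
have := psd_congr (pid_mx r : 'M[R]_p) (psd1 p).
by rewrite mulmx1 tr_pid_mx mul_pid_mx minnn (minn_idPr rp).
Qed.

Theorem proposition3 (R : realType) (n p r : nat)
    (hr : (r < minn n p)%N) (hr1 : (1 <= r)%N) (hrn : (r + 5 <= n)%N) :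
  let c : R := (n%:R - r%:R - 2%:R) / n%:R in
  let c4 : R := (n%:R - r%:R - 4%:R) / n%:R in
  let c6 : R := (n%:R - r%:R - 6%:R) / n%:R in
  (forall (d : measure_display) (T : measurableType d) (P : probability T R)
      (X : 'I_n -> T -> 'cV[R]_p) (mu : 'cV[R]_p) (Sigma : 'M[R]_p),
    cov_rank r Sigma -> iid_normal P X mu Sigma ->
    let upper_bound (a : R) : \bar R :=
      (risk P X (scaled_pinv_estimator c) Sigma
       + ((a - c) * (a - c6))%:E * expected_tr_pinv2 P X)%E in
    [/\ forall a : R, a <= c ->
          (risk P X (scaled_pinv_estimator a) Sigma <= upper_bound a)%E,
        c4 <= c
      & forall a : R, a != c4 -> (upper_bound c4 < upper_bound a)%E]) /\
  (forall (d : measure_display) (T : measurableType d)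
      (P : 'cV[R]_p -> 'M[R]_p -> probability T R)
      (X : 'I_n -> T -> 'cV[R]_p),
    normal_model r P X ->
    risk_dominates r P X (scaled_pinv_estimator c4) (scaled_pinv_estimator c) /\
    risk_dominates r P X (scaled_pinv_estimator c)
      pinv_estimator).
Proof.
move=> c c4 c6.
have n0 : 0 < n%:R :> R by rewrite ltr0n (leq_trans _ hrn)// addnS.
(* The three constants are equally spaced: c = c4 + h and c6 = c4 - h. Nothing else about them is
   kept, except h > 0 and c < 1. *)
pose h : R := 2 / n%:R.
have h0 : 0 < h by rewrite divr_gt0.
have cE : c = c4 + h by rewrite /c /c4 /h; field; rewrite gt_eqF.
have c6E : c6 = c4 - h by rewrite /c6 /c4 /h; field; rewrite gt_eqF.
have c1 : c < 1.
  rewrite ltr_pdivrMr// mul1r -addrA gtrDl -opprD oppr_lt0 ltr_wpDl ?ltr0n//.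
have rq d (T : measurableType d) (P : probability T R)
    (X : 'I_n -> T -> 'cV[R]_p) mu Sigma : cov_rank r Sigma -> iid_normal P X mu Sigma ->
    exists t m q : R, [/\ 0 < t, m <= c4 * t, expected_tr_pinv2 P X = t%:E
    & forall a, risk P X (scaled_pinv_estimator a) Sigma = (a ^+ 2 * t - 2 * a * m + q)%:E].
  by move=> Sr XN; exact: (risk_quadratic XN Sr hr1 hrn).
clearbody c c4 c6 h; subst c c6.
split=> [d T P X mu Sigma Sr XN ub|d T P X PN].
  have [t [m [q [t0 mt Et Er]]]] := rq _ _ _ _ _ _ Sr XN.
  have ubE a : ub a = ((c4 + h) ^+ 2 * t - 2 * (c4 + h) * m + q
      + (a - (c4 + h)) * (a - (c4 - h)) * t)%:E.
    by rewrite /ub Er Et -EFinM -EFinD.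
  split=> [a ac||a ac4].
  (* The risks at a and c differ by (a - c)((a + c) t - 2 m). As a - c <= 0, m may be replaced by c4
     t, and a + c - 2 c4 = a - c6. *)
  - rewrite ubE Er lee_fin; nra.
  - by rewrite lerDl ltW.
  - rewrite !ubE lte_fin.
    (* (a - c)(a - c6) = (a - c4)^2 - h^2, so the bound is least exactly at c4. *)
    have : 0 < (a - c4) ^+ 2 * t by rewrite mulr_gt0// exprn_even_gt0//= subr_eq0.
    nra.
have Sr : cov_rank r (pid_mx r : 'M[R]_p).
  by apply: exists_cov_rank; move: hr; rewrite ltn_min => /andP[_ /ltnW].
have dom1 mu Sigma : cov_rank r Sigma ->
    (risk (P mu Sigma) X (scaled_pinv_estimator c4) Sigma <
     risk (P mu Sigma) X (scaled_pinv_estimator (c4 + h)) Sigma)%E.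
  move=> SR; have [t [m [q [t0 mt _ Er]]]] := rq _ _ _ _ _ _ SR (PN mu _ SR).
  have ht : 0 < h * t by rewrite mulr_gt0.
  (* The risk at c minus the risk at c4. *)
  have : 0 < h * (2 * (c4 * t - m) + h * t) by rewrite mulr_gt0//; lra.
  rewrite !Er lte_fin; lra.
have dom2 mu Sigma : cov_rank r Sigma ->
    (risk (P mu Sigma) X (scaled_pinv_estimator (c4 + h)) Sigma <
     risk (P mu Sigma) X pinv_estimator Sigma)%E.
  move=> SR; have [t [m [q [t0 mt _ Er]]]] := rq _ _ _ _ _ _ SR (PN mu _ SR).
  have -> : pinv_estimator = scaled_pinv_estimator 1 :> (('I_n -> 'cV[R]_p) -> 'M[R]_p).
    by apply/funext => x; rewrite /scaled_pinv_estimator scale1r.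
  have ht : 0 < (1 - (c4 + h)) * t by rewrite mulr_gt0// subr_gt0.
  (* The risk at 1 minus the risk at c; the second factor is positive since both 1 and c exceed c4
     and m <= c4 t. *)
  have : 0 < (1 - (c4 + h)) * ((1 + (c4 + h)) * t - 2 * m).
    rewrite mulr_gt0 ?subr_gt0//; have : 0 < h * t by rewrite mulr_gt0.
    lra.
  rewrite !Er lte_fin; lra.
split; split=> [mu Sigma SR|].
- by apply: ltW; exact: dom1.
- by exists 0, (pid_mx r); split; last exact: dom1.
- by apply: ltW; exact: dom2.
- by exists 0, (pid_mx r); split; last exact: dom2.
Qed.
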